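(* Assume that for each $i=1,2,3,4$: (a) there exist $L_i>0$ and a positive function $\kappa_i$ on $E_i$ of at most polynomial growth such that $|a_i(x)-a_i(y)|\le L_i|x-y|$, $|c_i(x,z)-c_i(y,z)|\le \kappa_i(z)|x-y|$ and $|c_i(x,z)|\le\kappa_i(z)(1+|x|)$ for all $x,y\in\mathbb{R}^{d_i}$, $z\in E_i$; (b) $a_i\in C^4_{\uparrow}(\mathbb{R}^{d_i})$; (c) there exist $\bar r_i>0$ and $K_i>0$ such that $f_i(z)\mathbf{1}_{\{|z|\le \bar r_i\}}\le K_i|z|^{1-d_i}$, and $\int|z|^Lf_i(z)dz<\infty$ for all $L\ge1$; (d) for some $c_{i,0}>0$, $\inf_x|c_i(x,z)|\ge c_{i,0}|z|$ for all $z$ near the origin. Let $m\in\mathcal M\setminus\{m^*\}$ be such that Model $m^*$ is nested in Model $m$. Assume that for each $l\in\{m,m^*\}$ the prior density $\pi_l$ is continuous and bounded on $\bar\Theta_l$ with $\pi_l(\theta_{l,0})>0$, and that there exists $\chi>0$ such that $\mathbf Y_l(\theta_l)\le-\chi|\theta_l-\theta_{l,0}|^2$ for all $\theta_l\in\Theta_l$. Then $$\mathbf P\bigl(\mathbf{QBIC}_n(m^* )<\mathbf{QBIC}_n(m)\bigr)\longrightarrow1\qquad(n\to\infty).$$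
   Context: True model. $(\Omega,\mathcal F,(\mathcal F_t)_{t\ge0},\mathbf P)$ is a filtered probability space. $p_1,p_2,k_1\le p_1,k_2\le p_2,r_1,\dots,r_4$ are positive integers, $p=p_1+p_2$, $(d_1,d_2,d_3,d_4)=(k_1,p_1,p_2,k_2)$, $E_i=\mathbb{R}^{d_i}\setminus\{0\}$. For $i=1,2,3,4$, $W_i$ is an $r_i$-dimensional standard $(\mathcal F_t)$-Wiener process and $\mu_i(dt,dz)$ is a Poisson random measure on $\mathbb{R}_+\times E_i$ with compensator $f_i(z)\,dz\,dt$, $f_i=\lambda_{i,0}F_i$, $\lambda_{i,0}>0$, $F_i$ a probability density. For every $t\ge0$, the $\sigma$-algebras $\mathcal F_t$, $\sigma(W_{i,u}-W_{i,t};u\ge t)$ $(i=1,\dots,4)$ and $\sigma(\mu_i(A\cap((t,\infty)\times E_i));A\subset\mathbb{R}_+\times E_i\text{ Borel})$ $(i=1,\dots,4)$ are independent. The latent càdlàg $(\mathcal F_t)$-adapted processes $Y_1=\xi$, $Y_2=\delta$, $Y_3=\varepsilon$, $Y_4=\zeta$ ($Y_i$ is $\mathbb{R}^{d_i}$-valued) solve $$dY_{i,t}=a_i(Y_{i,t-})dt+\mathbf S_{i,0}dW_{i,t}+\int_{E_i}c_i(Y_{i,t-},z)\mu_i(dt,dz),\quad Y_{i,0}=x_{i,0},$$ with Borel functions $a_i:\mathbb{R}^{d_i}\to\mathbb{R}^{d_i}$, $c_i:\mathbb{R}^{d_i}\times E_i\to\mathbb{R}^{d_i}$, constant matrices $\mathbf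 S_{i,0}\in\mathbb{R}^{d_i\times r_i}$ and non-random $x_{i,0}$. The observed process is $X_t=(X_{1,t}^\top,X_{2,t}^\top)^\top\in\mathbb{R}^p$, $X_{1,t}=\mathbf\Lambda_{1,0}\xi_t+\delta_t$, $X_{2,t}=\mathbf\Lambda_{2,0}\eta_t+\varepsilon_t$, $\eta_t=\mathbf B_0\eta_t+\mathbf\Gamma_0\xi_t+\zeta_t$, where $\mathbf\Lambda_{1,0}\in\mathbb{R}^{p_1\times k_1}$, $\mathbf\Lambda_{2,0}\in\mathbb{R}^{p_2\times k_2}$ have full column rank, $\mathbf\Gamma_0\in\mathbb{R}^{k_2\times k_1}$, $\mathbf B_0\in\mathbb{R}^{k_2\times k_2}$ has zero diagonal and $\mathbf\Psi_0=\mathbb I_{k_2}-\mathbf B_0$ is non-singular. With $\mathbf\Sigma_{\xi\xi,0}=\mathbf S_{1,0}\mathbf S_{1,0}^\top$, $\mathbf\Sigma_{\delta\delta,0}=\mathbf S_{2,0}\mathbf S_{2,0}^\top$, $\mathbf\Sigma_{\varepsilon\varepsilon,0}=\mathbf S_{3,0}\mathbf S_{3,0}^\top$, $\mathbf\Sigma_{\zeta\zeta,0}=\mathbf S_{4,0}\mathbf S_{4,0}^\top$, let $\mathbf\Sigma_0$ be the symmetric $p\times p$ matrix with blocks $\mathbf\Sigma_0^{11}=\mathbf\Lambda_{1,0}\mathbf\Sigma_{\xi\xi,0}\mathbf\Lambda_{1,0}^\top+\mathbf\Sigma_{\delta\delta,0}$, $\mathbf\Sigma_0^{12}=\mathbf\Lambda_{1,0}\mathbf\Sigma_{\xi\xi,0}\mathbf\Gamma_0^\top\mathbf\Psi_0^{-1\top}\mathbf\Lambda_{2,0}^\top$,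 $\mathbf\Sigma_0^{22}=\mathbf\Lambda_{2,0}\mathbf\Psi_0^{-1}(\mathbf\Gamma_0\mathbf\Sigma_{\xi\xi,0}\mathbf\Gamma_0^\top+\mathbf\Sigma_{\zeta\zeta,0})\mathbf\Psi_0^{-1\top}\mathbf\Lambda_{2,0}^\top+\mathbf\Sigma_{\varepsilon\varepsilon,0}$, assumed positive definite. The data are $X_{t_i^n}$, $t_i^n=ih_n$, $i=0,\dots,n$, with $T=nh_n$ fixed; $\Delta_i^nX=X_{t_i^n}-X_{t_{i-1}^n}$. Parametric models $m\in\{1,\dots,M\}$. $\Theta_m\subset\mathbb{R}^{q_m}$ is a bounded open convex set; $\theta_m\in\Theta_m$ consists of the unknown entries of the loading and volatility matrices. Model $m$ is the same system with $\mathbf\Lambda_{1,0},\mathbf\Lambda_{2,0},\mathbf\Gamma_0,\mathbf B_0,\mathbf S_{i,0}$ replaced by matrices $\mathbf\Lambda_{1,m}^\theta,\mathbf\Lambda_{2,m}^\theta,\mathbf\Gamma_m^\theta,\mathbf B_m^\theta,\mathbf S_{i,m}^\theta$ depending on $\theta_m$ ($\mathbf\Lambda_{1,m}^\theta,\mathbf\Lambda_{2,m}^\theta$ of full column rank, $\mathbf B_m^\theta$ with zero diagonal, $\mathbf\Psi_m^\theta=\mathbb I-\mathbf B_m^\theta$ non-singular). With $\mathbf\Sigma_{\xi\xi,m}^\theta=\mathbf S_{1,m}^\theta\mathbf S_{1,m}^{\theta\top}$, $\mathbf\Sigma_{\delta\delta,m}^\theta=\mathbf S_{2,m}^\theta\mathbf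 S_{2,m}^{\theta\top}$, $\mathbf\Sigma_{\varepsilon\varepsilon,m}^\theta=\mathbf S_{3,m}^\theta\mathbf S_{3,m}^{\theta\top}$, $\mathbf\Sigma_{\zeta\zeta,m}^\theta=\mathbf S_{4,m}^\theta\mathbf S_{4,m}^{\theta\top}$, $\mathbf\Sigma_m(\theta_m)$ is the symmetric $p\times p$ matrix with blocks $\mathbf\Sigma_m^{11}(\theta_m)=\mathbf\Lambda_{1,m}^\theta\mathbf\Sigma_{\xi\xi,m}^\theta\mathbf\Lambda_{1,m}^{\theta\top}+\mathbf\Sigma_{\delta\delta,m}^\theta$, $\mathbf\Sigma_m^{12}(\theta_m)=\mathbf\Lambda_{1,m}^\theta\mathbf\Sigma_{\xi\xi,m}^\theta\mathbf\Gamma_m^{\theta\top}\mathbf\Psi_m^{\theta-1\top}\mathbf\Lambda_{2,m}^{\theta\top}$, $\mathbf\Sigma_m^{22}(\theta_m)=\mathbf\Lambda_{2,m}^\theta\mathbf\Psi_m^{\theta-1}(\mathbf\Gamma_m^\theta\mathbf\Sigma_{\xi\xi,m}^\theta\mathbf\Gamma_m^{\theta\top}+\mathbf\Sigma_{\zeta\zeta,m}^\theta)\mathbf\Psi_m^{\theta-1\top}\mathbf\Lambda_{2,m}^{\theta\top}+\mathbf\Sigma_{\varepsilon\varepsilon,m}^\theta$; it is positive definite for all $\theta_m\in\bar\Theta_m$. With $D>0$ and $\rho\in[1/3,1/2)$, $$\mathbf H_{m,n}(\theta_m)=-\frac1{2h_n}\sum_{i=1}^n(\Delta_i^nX)^\top\mathbf\Sigma_m(\theta_m)^{-1}(\Delta_i^nX)\mathbf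 1_{\{|\Delta_i^nX|\le Dh_n^\rho\}}-\frac12\sum_{i=1}^n\log\det\mathbf\Sigma_m(\theta_m)\mathbf 1_{\{|\Delta_i^nX|\le Dh_n^\rho\}},$$ which is three times continuously differentiable in $\theta_m$ with derivatives up to order three extending continuously to $\partial\Theta_m$. The estimator $\hat\theta_{m,n}\in\bar\Theta_m$ satisfies $\mathbf H_{m,n}(\hat\theta_{m,n})=\sup_{\theta_m\in\bar\Theta_m}\mathbf H_{m,n}(\theta_m)$, and $$\mathbf{QBIC}_n(m)=-2\mathbf H_{m,n}(\hat\theta_{m,n})+q_m\log n.$$ Let $\mathcal M=\{m\in\{1,\dots,M\}:\exists\,\theta_{m,0}\in\Theta_m,\ \mathbf\Sigma_0=\mathbf\Sigma_m(\theta_{m,0})\}$ be the set of correctly specified models. The optimal model $m^*=\mathrm{argmin}_{m\in\mathcal M}\dim(\Theta_m)$ ($\dim(\Theta_m)=q_m$) is assumed to be unique. For $m\in\mathcal M$ put $\mathbf H_m(\theta_m)=-\frac12\mathrm{tr}\{\mathbf\Sigma_m(\theta_m)^{-1}\mathbf\Sigma_m(\theta_{m,0})\}-\frac12\log\det\mathbf\Sigma_m(\theta_m)$ and $\mathbf Y_m(\theta_m)=\mathbf H_m(\theta_m)-\mathbf H_m(\theta_{m,0})$. $\pi_m$ is the prior density of Model $m$ on $\Theta_m$. Model $i$ is nested in Model $j$ if $q_i<q_j$ and there exist $F_{i,j}\in\mathbb{R}^{q_j\times q_i}$ with $F_{i,j}^\top F_{i,j}=\mathbb I_{q_i}$ and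 $c_j\in\mathbb{R}^{q_j}$ such that, for all $\theta_i\in\Theta_i$, $F_{i,j}\theta_i+c_j\in\Theta_j$ and $\mathbf H_{i,n}(\theta_i)=\mathbf H_{j,n}(F_{i,j}\theta_i+c_j)$. Notation: $|M|=\sqrt{\mathrm{tr}(MM^\top)}$ for vectors and matrices; $C^k_\uparrow(\mathbb{R}^d)$ is the set of functions on $\mathbb{R}^d$ continuously differentiable up to order $k$ whose derivatives are of polynomial growth. *)

(* Defs.v *)
From HB Require Import structures.
From mathcomp Require Import all_boot all_order all_algebra.
From mathcomp Require Import all_classical all_reals all_analysis.
From mathcomp Require Import measurable_realfun lebesgue_integral_fubini.

Set Implicit Arguments.
Unset Strict Implicit.
Unset Printing Implicit Defensive.
Import Order.TTheory GRing.Theory Num.Theory.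
Import numFieldNormedType.Exports.
Local Open Scope classical_set_scope.
Local Open Scope ring_scope.

(* Vectors of R^d are column vectors 'cV[R]_d. The library norm of a matrix is
   the sup norm; it is used here only through its topology and bounded sets, and
   |.| is the Euclidean (Frobenius) norm [enorm]. *)

Definition mx_display : measure_display.
Proof. exact: default_measure_display. Qed.

Section measurable_matrix.
Variables (R : realType) (m n : nat).

Definition mx_borel : set (set 'M[R]_(m, n)) :=
  <<s [set A | exists i j B, measurable B /\
                 A = (fun M : 'M[R]_(m, n) => M i j) @^-1` B] >>.

Let mx_borel0 : mx_borel set0.
Proof. exact: sigma_algebra0. Qed.

Let mx_borelC A : mx_borel A -> mx_borel (~` A).
Proof. exact: sigma_algebraC. Qed.

Let mx_borel_bigcup (F : (set 'M[R]_(m, n))^nat) :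
  (forall i, mx_borel (F i)) -> mx_borel (\bigcup_i F i).
Proof. exact: sigma_algebra_bigcup. Qed.

HB.instance Definition _ := @isMeasurable.Build mx_display
  'M[R]_(m, n) mx_borel mx_borel0 mx_borelC mx_borel_bigcup.

Lemma measurable_coord (i : 'I_m) (j : 'I_n) :
  measurable_fun setT (fun M : 'M[R]_(m, n) => M i j).
Proof.
by move=> _ B mB; rewrite setTI; apply: sub_sigma_algebra; exists i, j, B.
Qed.

Lemma measurable_fun_mxP d (T : measurableType d) (f : T -> 'M[R]_(m, n)) :
  measurable_fun setT f <->
  forall i j, measurable_fun setT (fun x => f x i j).
Proof.
split=> [mf i j|mf].
  exact: (measurableT_comp (measurable_coord i j) mf).
move=> _ B mB; rewrite setTI.
suff : <<s [set A | exists i j B, measurable B /\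
              A = (fun M : 'M[R]_(m, n) => M i j) @^-1` B] >>
       `<=` [set B | measurable (f @^-1` B)].
  exact.
apply: smallest_sub.
  split=> /=.
  - by rewrite preimage_set0.
  - by move=> A mA; rewrite setTD preimage_setC; exact: measurableC.
  - by move=> F mF; rewrite preimage_bigcup; exact: bigcupT_measurable.
move=> _ [i [j [C [mC ->]]]] /=.
by have := mf i j measurableT _ mC; rewrite setTI.
Qed.

End measurable_matrix.

(* Lebesgue measure on R^n, by recursion on n as the image of lambda^1 x lambda^n
   under (x, v) |-> (x, v_0, ..., v_(n-1)); see [lebesgue_cV_box]. *)
Section lebesgue_Rn.
Variable R : realType.

Definition cV_cons n (x : measurableTypeR R * 'cV[R]_n) : 'cV[R]_n.+1 :=
  \col_i oapp (fun k => x.2 k 0) x.1 (unlift ord0 i).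

Definition cV_uncons n (v : 'cV[R]_n.+1) : measurableTypeR R * 'cV[R]_n :=
  (v ord0 0, \col_k v (lift ord0 k) 0).

Lemma cV_consK n : cancel (@cV_cons n) (@cV_uncons n).
Proof.
case=> x v; rewrite /cV_uncons !mxE unlift_none /=; congr pair.
by apply/colP => k; rewrite !mxE liftK.
Qed.

Lemma measurable_cV_cons n : measurable_fun setT (@cV_cons n).
Proof.
apply/measurable_fun_mxP => i j; case: (unliftP ord0 i) => [k|] ->.
  rewrite (_ : (fun _ => _) = (fun v : 'cV[R]_n => v k 0) \o snd).
    by apply: measurableT_comp; [exact: measurable_coord|exact: measurable_snd].
  by apply/funext => x; rewrite mxE liftK.
rewrite (_ : (fun _ => _) = fst); first exact: measurable_fst.
by apply/funext => x; rewrite mxE unlift_none.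
Qed.

Lemma measurable_cV_uncons n : measurable_fun setT (@cV_uncons n).
Proof.
apply/measurable_fun_pairP; split; first exact: measurable_coord.
apply/measurable_fun_mxP => i j /=.
rewrite (_ : (fun _ => _) = (fun v : 'cV[R]_n.+1 => v (lift ord0 i) 0)).
  exact: measurable_coord.
by apply/funext => v; rewrite mxE.
Qed.

Section step.
Variables (n : nat) (mu : {sigma_finite_measure set 'cV[R]_n -> \bar R}).

Definition lebesgue_cV_step : set 'cV[R]_n.+1 -> \bar R :=
  pushforward (lebesgue_measure \x mu)%E (@cV_cons n).

HB.instance Definition _ := Measure.copy lebesgue_cV_step
  (measure_function_pushforward__canonical__measure_function_Measure
    (lebesgue_measure \x mu)%E (@measurable_cV_cons n)).

Let sigma_finite_step : sigma_finite setT lebesgue_cV_step.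
Proof.
have /sigma_finiteP[F [FT ndF Foo]] := sigma_finiteT (@lebesgue_measure R).
have /sigma_finiteP[G [GT ndG Goo]] := sigma_finiteT mu.
exists (fun k => @cV_uncons n @^-1` (F k `*` G k)).
  rewrite -preimage_bigcup (_ : \bigcup_k _ = setT) ?preimage_setT //.
  apply/seteqP; split=> // -[x v] _.
  have [i _ Fx] : (\bigcup_i F i) x by rewrite -FT.
  have [j _ Gv] : (\bigcup_i G i) v by rewrite -GT.
  exists (maxn i j) => //; split => /=.
  - by move: x Fx; exact/subsetPset/ndF/leq_maxl.
  - by move: v Gv; exact/subsetPset/ndG/leq_maxr.
move=> k; have [mF Fk] := Foo k; have [mG Gk] := Goo k; split.
  by rewrite -[X in measurable X]setTI; apply: measurable_cV_uncons => //;
    exact: measurableX.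
rewrite /lebesgue_cV_step /pushforward -comp_preimage.
rewrite (_ : _ \o _ = id); last exact/funext/cV_consK.
by rewrite preimage_id product_measure1E // lte_mul_pinfty // ge0_fin_numE.
Qed.

HB.instance Definition _ :=
  Measure_isSigmaFinite.Build _ _ _ lebesgue_cV_step sigma_finite_step.
End step.

Fixpoint lebesgue_cV n : {sigma_finite_measure set 'cV[R]_n -> \bar R} :=
  if n is k.+1 then lebesgue_cV_step (lebesgue_cV k) else \d_(0 : 'cV[R]_0).

Lemma lebesgue_cV_box n (A : 'I_n -> set R) : (forall i, measurable (A i)) ->
  lebesgue_cV n [set v : 'cV[R]_n | forall i, A i (v i 0)] =
  (\prod_(i < n) lebesgue_measure (A i))%E.
Proof.
elim: n A => [|n IHn] A mA.
  by rewrite big_ord0 /= diracE mem_set //= => -[].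
rewrite big_ord_recl /= /lebesgue_cV_step /pushforward.
pose B := [set v : 'cV[R]_n | forall i, A (lift ord0 i) (v i 0)].
have -> : @cV_cons n @^-1` [set v : 'cV[R]_n.+1 | forall i, A i (v i 0)] =
    A ord0 `*` B.
  apply/seteqP; split => -[x v] /=.
    by move=> AH; split=> [|i /=];
      [have := AH ord0|have := AH (lift ord0 i)];
      rewrite mxE ?unlift_none ?liftK.
  move=> [Ax Bv] i; rewrite mxE; case: (unliftP ord0 i) => [k|] -> /=.
    exact: Bv.
  exact: Ax.
rewrite product_measure1E //; last first.
  rewrite (_ : B = \bigcap_(i in [set: 'I_n])
      ((fun v : 'cV[R]_n => v i 0) @^-1` A (lift ord0 i))).
    apply: fin_bigcap_measurable; first exact: finite_finset.
    move=> i _; rewrite -[X in measurable X]setTI.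
    exact: (measurable_coord _ _ measurableT).
  by apply/seteqP; split => v /= H i; [move=> _|]; exact: H.
- exact: mA.
by congr (_ * _)%E; exact: (IHn (fun i => A (lift ord0 i))).
Qed.
End lebesgue_Rn.

Section euclidean.
Variable R : realType.

Definition enorm m n (A : 'M[R]_(m, n)) : R := Num.sqrt (\tr (A *m A^T)).

Definition posdef n (A : 'M[R]_n) : Prop :=
  A^T = A /\ forall x : 'cV[R]_n, x != 0 -> 0 < (x^T *m A *m x) 0 0.

Definition poly_growth_on d (D : set 'cV[R]_d) (f : 'cV[R]_d -> R) : Prop :=
  exists (C : R) (N : nat), forall z, D z -> `|f z| <= C * (1 + enorm z) ^+ N.

(* The class C^k_uparrow(R^d), through iterated partial derivatives. *)
Fixpoint C_poly k d (f : 'cV[R]_d -> R) : Prop :=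
  [/\ continuous f, poly_growth_on setT f &
      if k is k'.+1 then
        forall j : 'I_d, (forall x, derivable f x (delta_mx j 0)) /\
          C_poly k' (fun x => 'D_(delta_mx j 0) f x)
      else True].

Definition extends_to_closure d (U : set 'cV[R]_d) (f : 'cV[R]_d -> R) : Prop :=
  exists2 g : 'cV[R]_d -> R,
    {within closure U, continuous g} & forall x, U x -> g x = f x.

(* For U open: f is C^k on U and its partial derivatives of order <= k extend
   continuously to the closure of U. The derivatives at points of U only depend
   on the values of f on U. *)
Fixpoint C_closure k d (U : set 'cV[R]_d) (f : 'cV[R]_d -> R) : Prop :=
  extends_to_closure U f /\
  (if k is k'.+1 then
     forall j : 'I_d, (forall x, U x -> derivable f x (delta_mx j 0)) /\
       C_closure k' U (fun x => 'D_(delta_mx j 0) f x)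
   else True).

Definition punctured d : set 'cV[R]_d := [set~ 0].

Definition is_density d (D : set 'cV[R]_d) (f : 'cV[R]_d -> R) : Prop :=
  [/\ measurable_fun D f, forall x, D x -> 0 <= f x &
      (\int[lebesgue_cV R d]_(x in D) (f x)%:E = 1)%E].

End euclidean.

Section processes.
Variables (R : realType) (disp : measure_display) (Omega : measurableType disp).
Variable P : probability Omega R.
Variable Fil : R -> set (set Omega).

Definition mutually_independent (I : finType) (G : I -> set (set Omega)) : Prop :=
  forall (J : {set I}) (A : I -> set Omega), (forall i, i \in J -> G i (A i)) ->
    P [set w | forall i, i \in J -> A i w] = (\prod_(i in J) P (A i))%E.

Definition is_filtration : Prop :=
  (forall t, 0 <= t -> sigma_algebra setT (Fil t) /\ Fil t `<=` measurable) /\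
  (forall s t, 0 <= s -> s <= t -> Fil s `<=` Fil t).

Definition adapted d (Y : R -> Omega -> 'cV[R]_d) : Prop :=
  forall t, 0 <= t -> forall B, measurable B -> Fil t (Y t @^-1` B).

Definition cadlag d (Y : R -> Omega -> 'cV[R]_d) : Prop :=
  forall w t, 0 <= t ->
    (Y s w @[s --> t^'+] --> Y t w) /\ (0 < t -> cvg (Y s w @[s --> t^'-])).

Definition left_limit d (Y : R -> Omega -> 'cV[R]_d) (t : R) (w : Omega) :
  'cV[R]_d := lim (Y s w @[s --> t^'-]).

(* W_t - W_s is independent of Fil s with law N(0, (t - s) I_r). *)
Definition is_wiener r (W : R -> Omega -> 'cV[R]_r) : Prop :=
  [/\ adapted W,
      {ae P, forall w, W 0 w = 0},
      {ae P, forall w, {within `[0, +oo[, continuous (W ^~ w)}} &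
      forall s t, 0 <= s -> s < t ->
      forall (G : set Omega) (B : 'I_r -> set R),
        Fil s G -> (forall j, measurable (B j)) ->
        P (G `&` [set w | forall j, B j ((W t w - W s w) j 0)]) =
        (P G * \prod_(j < r) normal_prob 0 (Num.sqrt (t - s)) (B j))%E].

Definition increments_after r (W : R -> Omega -> 'cV[R]_r) (t : R) :
    set (set Omega) :=
  <<s [set A | exists (u : R) (B : set 'cV[R]_r), [/\ t <= u, measurable B &
         A = (fun w => W u w - W t w) @^-1` B]] >>.

Definition random_measure d : Type :=
  Omega -> {measure set (measurableTypeR R * 'cV[R]_d)%type -> \bar R}.

(* Mass of A under f(z) dz dt carried by R_+ x (R^d \ {0}). *)
Definition jump_intensity d (f : 'cV[R]_d -> R)
    (A : set (measurableTypeR R * 'cV[R]_d)) : \bar R :=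
  (\int[lebesgue_measure \x lebesgue_cV R d]_(x in
      A `&` (`[0%R, +oo[ `*` @punctured R d)) (f x.2)%:E)%E.

(* The Poisson weights are written out because the library's [poisson_pmf] is
   constantly 1 at rate 0, a rate that does occur here. The third clause covers
   the compensator being relative to the filtration. *)
Definition is_poisson_random_measure d (mu : random_measure d)
    (f : 'cV[R]_d -> R) : Prop :=
  [/\ forall A, measurable A -> measurable_fun setT (fun w => mu w A : \bar R),
      forall A, measurable A -> (jump_intensity f A < +oo)%E -> forall k : nat,
        P [set w | mu w A = k%:R%:E] =
        (let l := fine (jump_intensity f A) in
         l ^+ k / k`!%:R * expR (- l))%:E,
      forall (t : R) (A : set (measurableTypeR R * 'cV[R]_d)),
        0 <= t -> measurable A -> A `<=` `[0, t] `*` @punctured R d ->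
        forall B : set (\bar R), measurable B ->
          Fil t ((fun w => mu w A) @^-1` B) &
      forall n (A : 'I_n -> set (measurableTypeR R * 'cV[R]_d)),
        (forall i, measurable (A i)) -> trivIset setT A ->
        mutually_independent
          (fun i => preimage_set_system setT (fun w => mu w (A i) : \bar R) measurable)].

Definition jumps_after d (mu : random_measure d) (t : R) : set (set Omega) :=
  <<s [set C | exists (A : set (measurableTypeR R * 'cV[R]_d)) (B : set (\bar R)),
         [/\ measurable A, measurable B &
         C = (fun w => mu w (A `&` (`]t, +oo[ `*` @punctured R d))) @^-1` B]] >>.

(* dY_t = a(Y_{t-}) dt + S dW_t + int c(Y_{t-}, z) mu(dt, dz), Y_0 = x0, in
   integrated form, almost surely for all t. As S is constant the Wiener integral
   is S W_t, and the other two integrals are pathwise. *)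
Definition solves_jump_sde d r (a : 'cV[R]_d -> 'cV[R]_d) (S : 'M[R]_(d, r))
    (c : 'cV[R]_d -> 'cV[R]_d -> 'cV[R]_d) (x0 : 'cV[R]_d)
    (W : R -> Omega -> 'cV[R]_r) (mu : random_measure d)
    (Y : R -> Omega -> 'cV[R]_d) : Prop :=
  {ae P, forall w, Y 0 w = x0 /\ forall t, 0 <= t -> forall j : 'I_d,
    Y t w j 0 = x0 j 0
      + \int[lebesgue_measure]_(s in `[0, t]) (a (left_limit Y s w) j 0)
      + (S *m W t w) j 0
      + \int[mu w]_(x in `]0, t] `*` @punctured R d)
          (c (left_limit Y x.1 w) x.2 j 0)}.

End processes.

Section sem.
Variable R : realType.

(* Latent processes are indexed by 'I_4: xi, delta, epsilon, zeta. *)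
Definition ixi : 'I_4 := @Ordinal 4 0 isT.
Definition idelta : 'I_4 := @Ordinal 4 1 isT.
Definition ieps : 'I_4 := @Ordinal 4 2 isT.
Definition izeta : 'I_4 := @Ordinal 4 3 isT.

Definition ldim (k1 p1 p2 k2 : nat) (i : 'I_4) : nat :=
  nth 0%N [:: k1; p1; p2; k2] i.

Record sem_param (k1 p1 p2 k2 : nat) (r : 'I_4 -> nat) := SemParam {
  Lambda1 : 'M[R]_(p1, k1);
  Lambda2 : 'M[R]_(p2, k2);
  Gamma : 'M[R]_(k2, k1);
  Beta : 'M[R]_k2;
  Vol : forall i : 'I_4, 'M[R]_(ldim k1 p1 p2 k2 i, r i) }.

Variables (k1 p1 p2 k2 : nat) (r : 'I_4 -> nat).
Implicit Type s : sem_param k1 p1 p2 k2 r.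

Definition Psi s : 'M[R]_k2 := 1%:M - Beta s.

Definition sem_regular s : Prop :=
  [/\ \rank (Lambda1 s) = k1, \rank (Lambda2 s) = k2,
      forall i, Beta s i i = 0 & Psi s \in unitmx].

Definition Sigma_xixi s : 'M[R]_k1 := Vol s ixi *m (Vol s ixi)^T.
Definition Sigma_deltadelta s : 'M[R]_p1 := Vol s idelta *m (Vol s idelta)^T.
Definition Sigma_epseps s : 'M[R]_p2 := Vol s ieps *m (Vol s ieps)^T.
Definition Sigma_zetazeta s : 'M[R]_k2 := Vol s izeta *m (Vol s izeta)^T.

Definition Sigma11 s : 'M[R]_p1 :=
  Lambda1 s *m Sigma_xixi s *m (Lambda1 s)^T + Sigma_deltadelta s.
Definition Sigma12 s : 'M[R]_(p1, p2) :=
  Lambda1 s *m Sigma_xixi s *m (Gamma s)^T *m (invmx (Psi s))^T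
    *m (Lambda2 s)^T.
Definition Sigma22 s : 'M[R]_p2 :=
  Lambda2 s *m invmx (Psi s)
    *m (Gamma s *m Sigma_xixi s *m (Gamma s)^T + Sigma_zetazeta s)
    *m (invmx (Psi s))^T *m (Lambda2 s)^T + Sigma_epseps s.
Definition Sigma s : 'M[R]_(p1 + p2) :=
  block_mx (Sigma11 s) (Sigma12 s) (Sigma12 s)^T (Sigma22 s).

Variable Omega : Type.

Definition structural_equation s
    (Y : forall i : 'I_4, R -> Omega -> 'cV[R]_(ldim k1 p1 p2 k2 i))
    (eta : R -> Omega -> 'cV[R]_k2) : Prop :=
  forall t w, 0 <= t ->
    eta t w = Beta s *m eta t w + Gamma s *m Y ixi t w + Y izeta t w.

Definition observed s
    (Y : forall i : 'I_4, R -> Omega -> 'cV[R]_(ldim k1 p1 p2 k2 i))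
    (eta : R -> Omega -> 'cV[R]_k2) (t : R) (w : Omega) : 'cV[R]_(p1 + p2) :=
  col_mx (Lambda1 s *m Y ixi t w + Y idelta t w)
         (Lambda2 s *m eta t w + Y ieps t w).

End sem.

Section quasi_likelihood.
Variables (R : realType) (Omega : Type) (p : nat).

(* [increment X T n w i] is X_{t_{i+1}} - X_{t_i} for t_i = i T / n. *)
Definition increment (X : R -> Omega -> 'cV[R]_p) (T : R) (n : nat) (w : Omega)
    (i : nat) : 'cV[R]_p :=
  X (i.+1%:R * (T / n%:R)) w - X (i%:R * (T / n%:R)) w.

Definition quasi_loglik (X : R -> Omega -> 'cV[R]_p) (T D rho : R) (n : nat)
    (w : Omega) (Sig : 'M[R]_p) : R :=
  let h := T / n%:R in
  let dX := increment X T n w in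
  - (1 / (2 * h)) * (\sum_(i < n | enorm (dX i) <= D * h `^ rho)
                       ((dX i)^T *m invmx Sig *m dX i) 0 0)
  - 1 / 2 * (\sum_(i < n | enorm (dX i) <= D * h `^ rho) ln (\det Sig)).

Definition qbic (q n : nat) (Hmax : R) : R := - 2 * Hmax + q%:R * ln n%:R.

Definition limit_loglik (Sig0 Sig : 'M[R]_p) : R :=
  - (1 / 2) * \tr (invmx Sig *m Sig0) - 1 / 2 * ln (\det Sig).

Definition contrast (Sig0 Sig : 'M[R]_p) : R :=
  limit_loglik Sig0 Sig - limit_loglik Sig0 Sig0.

Definition nested_in (qi qj : nat) (Ti : set 'cV[R]_qi) (Tj : set 'cV[R]_qj)
    (Hi : nat -> Omega -> 'cV[R]_qi -> R) (Hj : nat -> Omega -> 'cV[R]_qj -> R) :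
    Prop :=
  (qi < qj)%N /\
  exists (F : 'M[R]_(qj, qi)) (c : 'cV[R]_qj), F^T *m F = 1%:M /\
    forall th, Ti th -> Tj (F *m th + c) /\
      forall n w, (0 < n)%N -> Hi n w th = Hj n w (F *m th + c).

End quasi_likelihood.

(* Main.v *)
(** The quasi-log-likelihood depends on the parameter only through the matrix
   [Sig]: it is [-(1/2) tr (Sig^-1 S) - (N/2) ln det Sig], where [S] is the
   truncated sum of [dX dX^T / h] and [N] the number of increments kept.
   Maximized over all positive definite [Sig], it exceeds its value at the true
   [Sigma0] by at most [(N/2) tr (Sigma0^-1 E V^-1 E)], with [V = S / N] and
   [E = V - Sigma0].  Since the jumps have finite activity, all but boundedly many
   increments are Gaussian up to a drift of order [h], and an increment that jumps
   but survives truncation contributes at most [D^2 h^(2 rho - 1) = O(sqrt n)], so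
   [S - N Sigma0 = O(sqrt n)] in probability and the log-likelihood gain of the
   larger model is tight, while the penalty difference grows like [ln n]. *)
Require Import Defs.
From HB Require Import structures.
From mathcomp Require Import all_boot all_order all_algebra.
From mathcomp Require Import all_classical all_reals all_analysis.
From mathcomp Require Import measurable_realfun lebesgue_integral_fubini.
From mathcomp Require Import ring lra.

Set Implicit Arguments.
Unset Strict Implicit.
Unset Printing Implicit Defensive.
Import Order.TTheory GRing.Theory Num.Theory.
Import numFieldNormedType.Exports.
Local Open Scope classical_set_scope.
Local Open Scope ring_scope.

(** * Positive definite matrices and the Gaussian log-likelihood *)

Section positive_definite.
Variable R : realType.

(** Both maximized log-likelihoods are measured against the value at [Sigma0]: the optimal model
    reaches at least this value because [theta0] lies in its parameter set, and the larger model
    exceeds it by at most a constant, on an event of probability close to 1. The bound is quadratic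
    in [E] with a factor [N] of order [n], so an error [E] of order [n^(-1/2)] is what makes this
    constant independent of [n]. The two bounds on [rho] act at different places. The lower one
    makes an increment that jumps and survives truncation contribute O(sqrt n); the upper one keeps
    the threshold [D h^rho] above the Gaussian increments and the drift, so that only intervals with
    a jump are ever discarded. A Lipschitz drift may be unbounded. Paths are therefore confined to
    an event, chosen before [n], on which the latent processes are bounded by one constant at the
    grid points of every mesh; left limits inherit this bound, and the event is measurable because
    there are countably many grid points. *)

Lemma posdef_schur n (A : 'M[R]_(1 + n)) : posdef A ->
  0 < A ord0 ord0 /\
  posdef (drsubmx A - (A ord0 ord0)^-1 *: (dlsubmx A *m (dlsubmx A)^T)).
Proof.
case=> sA pA; set a := A ord0 ord0; set v := dlsubmx A; set B := drsubmx A.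
have aE : ulsubmx A = a%:M.
  by rewrite [LHS]mx11_scalar !mxE; congr (A _ _)%:M; apply/val_inj.
have sAE i j : A j i = A i j by rewrite -[in LHS]sA mxE.
have uE : ursubmx A = v^T by apply/matrixP => i j; rewrite !mxE sAE.
have sB : B^T = B by apply/matrixP => i j; rewrite !mxE sAE.
have AE : A = block_mx a%:M v^T v B by rewrite -aE -uE submxK.
have quad (t : 'M[R]_1) (y : 'cV[R]_n) : (col_mx t y)^T *m A *m col_mx t y =
    (a *: t^T + y^T *m v) *m t + (t^T *m v^T + y^T *m B) *m y.
  rewrite AE tr_col_mx mul_row_block mul_row_col.
  by rewrite -scalemx1 -scalemxAr mulmx1.
have a_gt0 : 0 < a.
  have := pA (col_mx 1%:M 0); rewrite quad trmx1 trmx0 !mul0mx mulmx0 !addr0.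
  rewrite mulmx1 !mxE eqxx mulr1; apply.
  apply/eqP => /(congr1 (@usubmx _ 1 n 1)); rewrite col_mxKu linear0.
  by move=> /matrixP/(_ ord0 ord0)/eqP; rewrite !mxE oner_eq0.
split=> //; split.
  by rewrite linearB linearZ /= trmx_mul trmxK sB.
move=> y y0.
(* This first coordinate minimizes the quadratic form for given [y]; the minimum is the form of the
   Schur complement at [y]. *)
have := pA (col_mx ((- a^-1) *: (v^T *m y)) y); rewrite quad.
have -> : ((- a^-1) *: (v^T *m y))^T = (- a^-1) *: (y^T *m v).
  by rewrite linearZ /= trmx_mul trmxK.
rewrite scalerA mulrN divff ?gt_eqF // scaleN1r addNr mul0mx add0r => H.
have -> : y^T *m (B - a^-1 *: (v *m v^T)) *m y =
   ((- a^-1) *: (y^T *m v) *m v^T + y^T *m B) *m y.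
  rewrite mulmxBr addrC; congr ((_ + _) *m _).
  by rewrite -scalemxAr -scalemxAl -scaleNr mulmxA.
apply: H; apply: contra y0 => /eqP; rewrite -[0]col_mx0 => /eq_col_mx[_ ->].
by [].
Qed.

(** Induction through the Schur complement: the first column of [L] is [(sqrt a, v / sqrt a)], the
    rest is a factor of the complement. Positivity of the determinant, invertibility and coercivity
    are all read off this triangular factor. *)
Lemma posdef_cholesky n (A : 'M[R]_n) : posdef A ->
  exists L : 'M[R]_n, [/\ A = L *m L^T, is_trig_mx L & forall i, 0 < L i i].
Proof.
elim: n A => [A _|n IH A pA].
  by exists 1%:M; split=> [||[]//]; [apply/matrixP=> -[]|apply/is_trig_mxP => -[]].
have [a_gt0 /IH[L [LE tL L_gt0]]] := @posdef_schur n A pA.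
set a := A _ _ in a_gt0 LE; set v := dlsubmx (A : 'M[R]_(1 + n)) in LE.
have [sA _] := pA.
have aE : ulsubmx (A : 'M[R]_(1 + n)) = a%:M.
  by rewrite [LHS]mx11_scalar !mxE; congr (A _ _)%:M; apply/val_inj.
have uE : ursubmx (A : 'M[R]_(1 + n)) = v^T.
  by apply/matrixP => i j; rewrite !mxE -[in LHS]sA mxE.
have s_gt0 : 0 < Num.sqrt a by rewrite sqrtr_gt0.
exists (block_mx (Num.sqrt a)%:M 0 ((Num.sqrt a)^-1 *: v) L : 'M[R]_(1 + n)); split.
- rewrite (@tr_block_mx _ 1 n 1 n) (@mulmx_block _ 1 n 1 n 1 n).
  rewrite !trmx0 !mul0mx !mulmx0 !addr0 tr_scalar_mx -scalar_mxM -expr2 sqr_sqrtr ?ltW//.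
  rewrite mul_mx_scalar mul_scalar_mx linearZ /= -scalemxAl -scalemxAr !scalerA.
  rewrite mulfV ?gt_eqF // !scale1r -invfM -expr2 sqr_sqrtr ?ltW//.
  by rewrite -LE addrC subrK -aE -uE -[LHS](@submxK _ 1 n 1 n).
- by rewrite (@is_trig_block_mx _ 1 n 1 n) // eqxx tL scalar_mx_is_trig.
- move=> i; case: (@split_ordP 1 n i) => j ->.
    by rewrite (@block_mxEul _ 1 n 1 n) ord1 mxE eqxx.
  by rewrite (@block_mxEdr _ 1 n 1 n).
Qed.

Lemma posdef_det_gt0 n (A : 'M[R]_n) : posdef A -> 0 < \det A.
Proof.
move=> /posdef_cholesky[L [-> tL L_gt0]].
rewrite det_mulmx det_tr -expr2 exprn_even_gt0 //= det_trig //.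
by rewrite gt_eqF // prodr_gt0.
Qed.

Lemma posdef_unitmx n (A : 'M[R]_n) : posdef A -> A \in unitmx.
Proof. by move=> /posdef_det_gt0 ?; rewrite unitmxE unitfE gt_eqF. Qed.

Lemma posdef_congr n (A B : 'M[R]_n) : posdef A -> B \in unitmx ->
  posdef (B^T *m A *m B).
Proof.
move=> [sA pA] uB; split; first by rewrite !trmx_mul trmxK sA mulmxA.
move=> x x0; have := pA (B *m x); rewrite trmx_mul !mulmxA; apply.
by apply: contra x0 => /eqP Bx0; rewrite -[x](mulKmx uB) Bx0 mulmx0.
Qed.

Lemma posdef_invmx n (A : 'M[R]_n) : posdef A -> posdef (invmx A).
Proof.
move=> pA; have uA := posdef_unitmx pA; have [sA _] := pA.
have := posdef_congr pA (B := invmx A); rewrite unitmx_inv => /(_ uA).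
by rewrite trmx_inv sA mulVmx // mul1mx.
Qed.

(** With [A = L L^T], the determinant is the product of the [L i i ^+ 2], and [A i i] is at least
    [L i i ^+ 2]; it remains to apply [ln x <= x - 1] to each of them. *)
Lemma ln_det_le_trace n (A : 'M[R]_n) : posdef A -> ln (\det A) <= \tr A - n%:R.
Proof.
move=> /posdef_cholesky[L [-> tL L_gt0]].
rewrite det_mulmx det_tr det_trig //.
have -> : \tr (L *m L^T) - n%:R = \sum_i ((L *m L^T) i i - 1).
  by rewrite sumrB sumr_const card_ord.
have -> : ln ((\prod_i L i i) * (\prod_i L i i)) = \sum_i (ln (L i i ^+ 2)).
  rewrite -big_split /=.
  (* The relation carries positivity along, which is what allows [ln] to be split factor by
     factor. *)
  pose lnrel x y := 0 < x /\ ln x = y :> R.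
  apply: (proj2 (_ : lnrel _ _)); apply: big_ind2 => [|x1 x2 y1 y2|i _].
  - by split; rewrite ?ln1.
  - by move=> [x1_gt0 <-] [y1_gt0 <-]; split; rewrite ?mulr_gt0 ?lnM.
  - by split; rewrite ?mulr_gt0 -?expr2.
apply: ler_sum => i _; rewrite mxE.
have -> : ln (L i i ^+ 2) = ln (1 + (L i i ^+ 2 - 1)) by rewrite addrC subrK.
rewrite (le_trans (le_ln1Dx _)) //.
  by rewrite ltrBrDl subrr exprn_gt0.
rewrite lerD2r (bigD1 i) //= mxE -expr2 lerDl sumr_ge0 // => j _.
by rewrite mxE -expr2 sqr_ge0.
Qed.

(* The gap is twice the Kullback-Leibler divergence of the centred Gaussian laws
   with covariances [S] and [K^-1]. *)
Lemma ln_det_mul_le_trace n (K S : 'M[R]_n) : posdef K -> posdef S ->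
  ln (\det K) + ln (\det S) <= \tr (K *m S) - n%:R.
Proof.
move=> pK pS; have [L [SE tL L_gt0]] := posdef_cholesky pS.
have uL : L \in unitmx.
  by move: (posdef_unitmx pS); rewrite SE unitmx_mul => /andP[].
have := ln_det_le_trace (posdef_congr pK uL).
rewrite !det_mulmx det_tr [_ * \det K]mulrC -mulrA -{1}(det_tr L) -det_mulmx.
have -> : \det (L^T *m L) = \det S by rewrite SE !det_mulmx mulrC.
rewrite lnM ?posrE ?posdef_det_gt0 //.
by rewrite SE -mulmxA mxtrace_mulC !mulmxA.
Qed.

Lemma ln_det_invmx n (A : 'M[R]_n) : posdef A ->
  ln (\det (invmx A)) = - ln (\det A).
Proof. by move=> pA; rewrite det_inv lnV // posrE posdef_det_gt0. Qed.

End positive_definite.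

(** * Likelihood ratios and perturbation of positive definite matrices *)

Section gaussian_loglik.
Variable R : realType.

Definition gauss_loglik p (S : 'M[R]_p) (N : R) (Sig : 'M[R]_p) : R :=
  - (1 / 2) * \tr (invmx Sig *m S) - N / 2 * ln (\det Sig).

(* The unrestricted maximum over all positive definite matrices is attained at
   [V], whatever the parametrization of [Sig]. *)
Lemma gauss_loglik_ratio_le p (N : R) (V Sig Sig0 : 'M[R]_p) :
  0 < N -> posdef Sig -> posdef Sig0 -> posdef V ->
  gauss_loglik (N *: V) N Sig - gauss_loglik (N *: V) N Sig0 <=
  N / 2 * \tr (invmx Sig0 *m (V - Sig0) *m invmx V *m (V - Sig0)).
Proof.
move=> N_gt0 pSig pSig0 pV.
(* [h1] says that no [Sig] does better than [V]. [h2], the same inequality with [V] and [Sig0]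
   exchanged, bounds the deficit of [Sig0] by the symmetrized divergence
   [tr (Sig0^-1 V) + tr (V^-1 Sig0) - 2 p], which equals the trace of the conclusion. *)
have h1 := ln_det_mul_le_trace (posdef_invmx pSig) pV.
have h2 := ln_det_mul_le_trace (posdef_invmx pV) pSig0.
rewrite ln_det_invmx // in h1; rewrite ln_det_invmx // in h2.
have uV := posdef_unitmx pV; have u0 := posdef_unitmx pSig0.
have -> : \tr (invmx Sig0 *m (V - Sig0) *m invmx V *m (V - Sig0)) =
    \tr (invmx Sig0 *m V) + \tr (invmx V *m Sig0) - p%:R - p%:R.
  have -> : invmx Sig0 *m (V - Sig0) *m invmx V = invmx Sig0 - invmx V.
    by rewrite mulmxBr mulVmx // mulmxBl mul1mx mulmxK.
  rewrite mulmxBl !mulmxBr !mulVmx // !raddfB /= mxtrace1.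
  by ring.
rewrite /gauss_loglik -!scalemxAr !mxtraceZ.
nra.
Qed.

Lemma quad_formE n (A : 'M[R]_n) (x : 'cV[R]_n) :
  (x^T *m A *m x) 0 0 = \sum_i \sum_j x i 0 * A i j * x j 0.
Proof.
rewrite -mulmxA mxE; apply: eq_bigr => i _; rewrite !mxE mulr_sumr.
by apply: eq_bigr => j _; rewrite mulrA.
Qed.

(** For [y = L^T x] the form is the squared length [s] of [y], and [x = K y] has entries at most
    [k sqrt s]. Using [n.+1] instead of [n] keeps the constant invertible in dimension 0. *)
Lemma posdef_coercive n (A : 'M[R]_n) : posdef A ->
  exists2 c : R, 0 < c & forall x : 'cV[R]_n,
    c * \sum_i x i 0 ^+ 2 <= (x^T *m A *m x) 0 0.
Proof.
move=> pA; have [L [AE tL L_gt0]] := posdef_cholesky pA.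
have uL : L^T \in unitmx.
  by move: (posdef_unitmx pA); rewrite AE unitmx_mul => /andP[].
pose K := invmx L^T.
pose k := 1 + \sum_i \sum_j `|K i j|.
have k_gt0 : 0 < k by rewrite ltr_wpDr // sumr_ge0 // => i _; exact: sumr_ge0.
have n1_gt0 : 0 < n.+1%:R :> R by [].
exists (n.+1%:R * k ^+ 2)^-1; first by rewrite invr_gt0 mulr_gt0 // exprn_gt0.
move=> x; rewrite mulrC ler_pdivrMr ?mulr_gt0 ?exprn_gt0 //.
pose y := L^T *m x; pose s := \sum_j y j 0 ^+ 2.
have -> : (x^T *m A *m x) 0 0 = s.
  rewrite AE mulmxA -[x^T *m L]trmxK trmx_mul trmxK -mulmxA mxE.
  by apply: eq_bigr => j _; rewrite mxE expr2.
have s_ge0 : 0 <= s by apply: sumr_ge0 => j _; exact: sqr_ge0.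
have y_le j : `|y j 0| <= Num.sqrt s.
  by rewrite -sqrtr_sqr ler_wsqrtr // /s (bigD1 j) //= lerDl sumr_ge0 // => i _;
     exact: sqr_ge0.
have x_le i : x i 0 ^+ 2 <= k ^+ 2 * s.
  rewrite -[s]sqr_sqrtr // -exprMn -real_normK ?num_real //.
  rewrite lerXn2r ?nnegrE ?mulr_ge0 ?sqrtr_ge0 ?(ltW k_gt0) //.
  rewrite -[x](mulKmx uL) -/y mxE (le_trans (ler_norm_sum _ _ _)) //.
  apply: (@le_trans _ _ (\sum_j `|K i j| * Num.sqrt s)).
    by apply: ler_sum => j _; rewrite normrM ler_wpM2l.
  rewrite -mulr_suml ler_wpM2r ?sqrtr_ge0 // /k.
  rewrite [X in 1 + X](bigD1 i) //= ler_wpDl // ler_wpDr //.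
  by apply: sumr_ge0 => j _; exact: sumr_ge0.
apply: (@le_trans _ _ (\sum_(i < n) k ^+ 2 * s)); first exact: ler_sum.
rewrite sumr_const card_ord -[leLHS]mulr_natl mulrA [s * _]mulrC.
rewrite ler_wpM2r //.
by rewrite ler_wpM2r ?exprn_ge0 ?(ltW k_gt0) // ler_nat.
Qed.

Lemma quad_form_le n (E : 'M[R]_n) (eps : R) (x : 'cV[R]_n) :
  (forall i j, `|E i j| <= eps) ->
  `|(x^T *m E *m x) 0 0| <= eps * n%:R * \sum_i x i 0 ^+ 2.
Proof.
move=> E_le; rewrite quad_formE (le_trans (ler_norm_sum _ _ _)) //.
apply: (@le_trans _ _ (\sum_i \sum_j (eps * (x i 0 ^+ 2 + x j 0 ^+ 2) / 2))).
  apply: ler_sum => i _; rewrite (le_trans (ler_norm_sum _ _ _)) //.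
  apply: ler_sum => j _; rewrite !normrM mulrAC mulrC -mulrA ler_pM ?mulr_ge0 //.
  rewrite -(real_normK (num_real (x i 0))) -(real_normK (num_real (x j 0))).
  have := sqr_ge0 (`|x i 0| - `|x j 0|); nra.
rewrite le_eqVlt; apply/orP; left; apply/eqP.
set q := \sum_i x i 0 ^+ 2.
transitivity (\sum_(i < n) (eps / 2 * n%:R * x i 0 ^+ 2 + eps / 2 * q)).
  apply: eq_bigr => i _; have -> : n%:R = \sum_(j < n) 1 :> R by rewrite sumr_const card_ord.
  rewrite /q !mulr_sumr mulr_suml -big_split /=.
  by apply: eq_bigr => j _; ring.
rewrite big_split /= -mulr_sumr -/q sumr_const card_ord -[X in _ + X]mulr_natr.
by field.
Qed.

(** If [c] is a coercivity constant of [A], an entrywise perturbation below [delta] moves the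
    quadratic form by at most [c / 2] times the squared length. Hence [V] is coercive with constant
    [c / 2], the entries of its inverse are at most [2 / c], and the trace is quadratic in
    [V - A]. *)
Lemma posdef_perturb p (A : 'M[R]_p) : posdef A ->
  exists C delta : R, [/\ 0 < C, 0 < delta &
    forall (V : 'M[R]_p) (eps : R), V^T = V -> eps <= delta ->
      (forall i j, `|V i j - A i j| <= eps) ->
      posdef V /\
      \tr (invmx A *m (V - A) *m invmx V *m (V - A)) <= C * eps ^+ 2].
Proof.
move=> pA; have [c c_gt0 cA] := posdef_coercive pA.
pose K := invmx A; pose k := \sum_i \sum_j `|K i j|.
have k_ge0 : 0 <= k by apply: sumr_ge0 => i _; exact: sumr_ge0.
(* [k] sums the entries of [invmx A], [2 / c] bounds those of [invmx V], and the two remaining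
   indices of the expanded trace give [p ^ 2]; the summand 1 makes the constant positive. *)
exists (1 + k * (2 / c) * p%:R ^+ 2), (c / (2 * p.+1%:R)); split.
- by rewrite ltr_wpDr // !mulr_ge0 // ?invr_ge0 ltW.
- by rewrite divr_gt0 // mulr_gt0.
move=> V eps sV eps_le V_le.
have cV (x : 'cV[R]_p) : c / 2 * \sum_i x i 0 ^+ 2 <= (x^T *m V *m x) 0 0.
  have -> : V = A + (V - A) by rewrite addrC subrK.
  rewrite mulmxDr mulmxDl [leRHS]mxE.
  have := @quad_form_le p (V - A) eps x; rewrite ler_norml.
  move=> /(_ _)/andP[|+ _]; first by move=> i j; rewrite !mxE.
  have := cA x; set q := \sum_i _; have q_ge0 : 0 <= q.
    by apply: sumr_ge0 => i _; exact: sqr_ge0.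
  move=> h1 h2.
  have : eps * p%:R <= c / 2.
    case: (lerP eps 0) => [eps0|eps0].
      by rewrite (@le_trans _ _ 0) ?divr_ge0 ?(ltW c_gt0) // mulr_le0_ge0.
    rewrite (@le_trans _ _ (eps * p.+1%:R)) //.
      by rewrite ler_wpM2l ?ler_nat // ltW.
    by move: eps_le; rewrite invfM mulrA ler_pdivlMr.
  nra.
have pV : posdef V.
  split=> // x x0; apply: lt_le_trans (cV x); rewrite mulr_gt0 ?divr_gt0 //.
  have [i xi0] : exists i, x i 0 != 0.
    by apply/existsP; apply: contra_neqT x0 => /existsPn H; apply/colP => i;
       rewrite mxE; apply/eqP; move: (H i); rewrite negbK.
  rewrite (bigD1 i) //= ltr_wpDr ?sumr_ge0 // => [j _|]; first exact: sqr_ge0.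
  by rewrite exprn_even_gt0.
split=> //.
have uV := posdef_unitmx pV.
set B := invmx V; have [sB _] := posdef_invmx pV; rewrite -/B in sB.
(* The form of [V] at column [j] of its inverse is [B j j], so coercivity gives
   [c / 2 * B l j ^+ 2 <= B j j]; the case [l = j] bounds the diagonal, and the diagonal bounds the
   rest. *)
have B_le i j : `|B i j| <= 2 / c.
  pose y := col j B.
  have yV : (y^T *m V *m y) 0 0 = B j j.
    transitivity ((B^T *m V *m B) j j); last by rewrite sB mulVmx // mul1mx.
    by rewrite /y tr_col -row_mul !mxE; apply: eq_bigr => l _; rewrite !mxE.
  have y_le l : c / 2 * B l j ^+ 2 <= B j j.
    rewrite -yV; apply: le_trans (cV y); rewrite ler_pM2l ?divr_gt0 //.
    by rewrite (bigD1 l) //= mxE lerDl sumr_ge0 // => i' _; exact: sqr_ge0.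
  have Bjj_le : B j j <= 2 / c.
    by rewrite ler_pdivlMr //; have := y_le j; case: (lerP (B j j) 0) => ? ?; nra.
  rewrite -(ler_pXn2r (n := 2)) ?nnegrE ?divr_ge0 ?(ltW c_gt0) // real_normK ?num_real //.
  have := y_le i; rewrite -ler_pdivlMl ?divr_gt0 // => /le_trans; apply.
  by rewrite invf_div expr2 ler_wpM2l // divr_ge0 // ltW.
pose E := V - A.
have E_le i j : `|E i j| <= eps by have := V_le i j; rewrite !mxE.
have expand : \tr (K *m E *m B *m E) =
    \sum_i \sum_j \sum_l \sum_o K i o * E o l * B l j * E j i.
  rewrite /mxtrace; apply: eq_bigr => i _; rewrite mxE; apply: eq_bigr => j _.
  rewrite mxE mulr_suml; apply: eq_bigr => l _; rewrite mxE !mulr_suml.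
  by [].
apply: (le_trans (ler_norm _)); rewrite -/K -/E expand.
apply: (@le_trans _ _
    (\sum_(i < p) \sum_(j < p) \sum_(l < p) \sum_o `|K i o| * (2 / c) * eps ^+ 2)).
  rewrite (le_trans (ler_norm_sum _ _ _)) //; apply: ler_sum => i _.
  rewrite (le_trans (ler_norm_sum _ _ _)) //; apply: ler_sum => j _.
  rewrite (le_trans (ler_norm_sum _ _ _)) //; apply: ler_sum => l _.
  rewrite (le_trans (ler_norm_sum _ _ _)) //; apply: ler_sum => o _.
  have -> : `|K i o| * (2 / c) * eps ^+ 2 = `|K i o| * (eps * (2 / c) * eps) by ring.
  move: (2 / c) B_le => d B_le; rewrite !normrM -!mulrA ler_wpM2l //.
  by rewrite ler_pM ?mulr_ge0 // ler_pM.
have -> : \sum_(i < p) \sum_(j < p) \sum_(l < p) \sum_o `|K i o| * (2 / c) * eps ^+ 2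
    = k * (2 / c) * eps ^+ 2 *+ p *+ p.
  rewrite /k [_ * (2 / c)]mulr_suml mulr_suml -!sumrMnl; apply: eq_bigr => i _.
  by rewrite !sumr_const !card_ord -!mulr_suml.
rewrite -mulrnA -[leLHS]mulr_natr natrM -expr2 mulrAC ler_wpM2r ?sqr_ge0 //.
by rewrite lerDr.
Qed.
End gaussian_loglik.

(** * Integrable random variables and independence *)

Section real_expectation.
Context d (T : measurableType d) (R : realType) (P : probability T R).
Implicit Types f g : T -> R.

Definition integrableR (f : T -> R) : Prop := P.-integrable setT (EFin \o f).

Lemma integrableR_measurable f : integrableR f -> measurable_fun setT f.
Proof. by move=> /measurable_int/measurable_EFinP. Qed.

Lemma integrableR_cst (c : R) : integrableR (fun=> c).
Proof. exact: finite_measure_integrable_cst. Qed.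

Lemma integrableRD f g : integrableR f -> integrableR g ->
  integrableR (fun x => f x + g x).
Proof.
move=> fi gi; rewrite /integrableR (_ : EFin \o _ = (EFin \o f) \+ (EFin \o g))%E.
  exact: integrableD.
by apply/funext => x /=; rewrite EFinD.
Qed.

Lemma integrableRZl c f : integrableR f -> integrableR (fun x => c * f x).
Proof.
move=> fi; rewrite /integrableR (_ : EFin \o _ = fun x => c%:E * (EFin \o f) x)%E.
  exact: integrableZl.
by apply/funext => x /=; rewrite EFinM.
Qed.

Lemma integrableR_le f g : measurable_fun setT f ->
  (forall x, `|f x| <= g x) -> integrableR g -> integrableR f.
Proof.
move=> mf fg; apply: le_integrable => //; first exact/measurable_EFinP.
by move=> x _ /=; rewrite lee_fin (le_trans (fg x)) // ler_norm.
Qed.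

Lemma ge0_integrableR f c : measurable_fun setT f -> (forall x, 0 <= f x) ->
  (\int[P]_x (f x)%:E <= c%:E)%E -> integrableR f /\ \int[P]_x f x <= c.
Proof.
move=> mf f0 fc; have fi : integrableR f.
  apply/integrableP; split; first exact/measurable_EFinP.
  apply: le_lt_trans (ltry c); rewrite (le_trans _ fc) //.
  by rewrite le_eqVlt; apply/orP; left; apply/eqP; apply: eq_integral => x _ /=;
    rewrite ger0_norm.
split=> //; rewrite -lee_fin fineK //.
exact: integrable_fin_num fi.
Qed.

Lemma markov_ineq f (c : R) : integrableR f -> (forall x, 0 <= f x) -> 0 < c ->
  (P [set x | (c <= f x)%R] <= ((\int[P]_x f x) / c)%R%:E)%E.
Proof.
move=> fi f0 c0; have mf := integrableR_measurable fi.
rewrite mulrC EFinM lee_pdivlMl //.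
have mA : measurable [set x | c <= f x].
  rewrite -[X in measurable X]setTI.
  rewrite (_ : [set x | c <= f x] = f @^-1` `[c, +oo[).
    by apply: mf => //; exact: measurable_itv.
  by apply/seteqP; split => x /=; rewrite in_itv/= andbT.
rewrite /Rintegral fineK; last exact: integrable_fin_num fi.
rewrite -integral_cst //= integral_mkcond /=.
apply: ge0_le_integral => //=.
- by move=> x _; apply: erestrict_ge0 => y _; rewrite lee_fin ltW.
- by apply/(measurable_restrict _ _ _).1.
- exact/measurable_EFinP.
- move=> x _; rewrite patchE; case: ifPn => [|_]; last by rewrite lee_fin.
  by rewrite inE lee_fin.
Qed.

Lemma integrableR_sqr_mul f g : integrableR (fun x => f x ^+ 2) ->
  integrableR (fun x => g x ^+ 2) -> measurable_fun setT f ->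
  measurable_fun setT g -> integrableR (fun x => f x * g x).
Proof.
move=> f2 g2 mf mg; apply: integrableR_le (integrableRD f2 g2).
  exact: measurable_funM.
move=> x; rewrite normrM -(real_normK (num_real (f x))) -(real_normK (num_real (g x))).
have := sqr_ge0 (`|f x| - `|g x|); have := normr_ge0 (f x); have := normr_ge0 (g x).
by nra.
Qed.

(* Fubini for the joint law, which is a product measure. *)
Lemma Rintegral_indep_centered (X Y : T -> R) :
  measurable_fun setT X -> measurable_fun setT Y ->
  (forall A B, measurable A -> measurable B ->
    P (X @^-1` A `&` Y @^-1` B) = P (X @^-1` A) * P (Y @^-1` B))%E ->
  integrableR (fun x => X x * Y x) -> integrableR Y -> \int[P]_x Y x = 0 ->
  \int[P]_x (X x * Y x) = 0.
Proof.
move=> mX mY indep XYi Yi Y0.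
pose mX' : {mfun T >-> R} := HB.pack X (isMeasurableFun.Build _ _ _ _ X mX).
pose mY' : {mfun T >-> R} := HB.pack Y (isMeasurableFun.Build _ _ _ _ Y mY).
pose PX := distribution P mX'; pose PY := distribution P mY'.
have mXY : measurable_fun setT (fun x => (X x, Y x)).
  exact/measurable_fun_pairP.
pose XY : {mfun T >-> (R * R)%type} := HB.pack (fun x => (X x, Y x)) (isMeasurableFun.Build _ _ _ _ _ mXY).
pose PXY := distribution P XY.
have PE A : measurable A -> (PX \x PY)%E A = PXY A.
  apply: product_measure_unique => A1 A2 mA1 mA2.
  by rewrite /PXY /distribution /pushforward /= -indep.
have mmul : measurable_fun setT (fun z : R * R => (z.1 * z.2)%:E).
  by apply/measurable_EFinP; exact: measurable_funM.
have intXY : (PX \x PY)%E.-integrable setT (fun z : R * R => (z.1 * z.2)%:E).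
  apply/integrableP; split=> //.
  rewrite (eq_measure_integral PXY) => [|A mA _]; last exact: PE.
  rewrite ge0_integral_pushforward //=.
    by case/integrableP: XYi.
  apply/measurable_EFinP; apply: measurableT_comp => //.
  exact: measurable_funM.
have : (\int[PX \x PY]_z (z.1 * z.2)%:E = \int[P]_x (X x * Y x)%:E)%E.
  rewrite (eq_measure_integral PXY) => [|A mA _]; last exact: PE.
  by rewrite integral_pushforward //= preimage_setT.
rewrite -(integral12_prod_meas1 intXY) /Rintegral => <-.
rewrite integral0_eq // => x _; rewrite /fubini_F /=.
under eq_integral do rewrite EFinM.
have Yi' : P.-integrable (Y @^-1` setT) (EFin \o Y) by rewrite preimage_setT.
have PYi : PY.-integrable setT (EFin : R -> \bar R).
  by apply/integrable_pushforward.
rewrite integralZl //= integral_pushforward //= preimage_setT.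
have /fineK <- : (\int[P]_z (Y z)%:E)%E \is a fin_num by exact: integrable_fin_num Yi.
by rewrite -/(Rintegral P setT Y) Y0 mule0.
Qed.
End real_expectation.

(** * Gaussian moments *)

Section density.
Local Open Scope ereal_scope.
Import HBNNSimple.
Context d (T : measurableType d) (R : realType).
Variables (mu nu : {measure set T -> \bar R}) (g : T -> R).
Hypotheses (mg : measurable_fun setT g) (g_ge0 : forall x, (0 <= g x)%R).
Hypothesis nuE : forall A, measurable A -> nu A = \int[mu]_(x in A) (g x)%:E.

Let integral_density_nnsfun (h : {nnsfun T >-> R}) :
  \int[nu]_x (h x)%:E = \int[mu]_x ((h x)%:E * (g x)%:E).
Proof.
under [LHS]eq_integral do rewrite fimfunE -fsumEFin//.
rewrite [LHS]ge0_integral_fsum//; last 2 first.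
  - by move=> r; exact/measurable_EFinP/measurableT_comp.
  - by move=> n x _; rewrite EFinM nnfun_muleindic_ge0.
under [RHS]eq_integral.
  move=> x xD; rewrite fimfunE -fsumEFin// ge0_mule_fsuml; last first.
    by move=> r; rewrite EFinM nnfun_muleindic_ge0.
  over.
rewrite [RHS]ge0_integral_fsum//; last 2 first.
  - move=> r; apply/measurable_EFinP; apply: measurable_funM => //.
    exact/measurableT_comp.
  - move=> n x _; apply: mule_ge0; last by rewrite lee_fin.
    by rewrite EFinM nnfun_muleindic_ge0.
apply: eq_fsbigr => r _.
rewrite !integralZl_indic_nnsfun//= integral_indic //= setIT nuE //.
(* For negative [r] the level set of a nonnegative function is empty; for the others the factor [r]
   can be moved inside the integral. *)
case: (ltrP r 0) => [r_lt0|r_ge0].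
  rewrite preimage_nnfun0 // integral_set0 mule0 integral0_eq // => x _.
  by rewrite indic0 mulr0 mul0e.
rewrite integral_mkcond /= -ge0_integralZl //=; last 2 first.
- apply/(measurable_restrict _ _ _).1 => //; rewrite setTI.
  exact/measurable_EFinP/measurable_funTS.
- by move=> x _; rewrite erestrict_ge0 // => y _; rewrite lee_fin.
apply: eq_integral => x _; rewrite patchE indicE.
by case: ifPn => xr; rewrite ?(mulr1, mulr0, mule0, mul0e).
Qed.

(** Both sides agree on simple functions and pass to monotone limits. With [mu] the Lebesgue measure
    and [g] the normal density, moments of the normal law become integrals of explicit functions. *)
Lemma ge0_integral_density (f : T -> \bar R) :
  measurable_fun setT f -> (forall x, 0 <= f x) ->
  \int[nu]_x f x = \int[mu]_x (f x * (g x)%:E).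
Proof.
move=> mf f0; pose f_ := nnsfun_approx measurableT mf.
transitivity (lim (\int[nu]_x (f_ n x)%:E @[n --> \oo])).
  rewrite -monotone_convergence//=.
  - apply: eq_integral => ? /[!inE] xD; apply/esym/cvg_lim => //=.
    exact: cvg_nnsfun_approx.
  - by move=> n; exact/measurable_EFinP/measurable_funTS.
  - by move=> n ? _; rewrite lee_fin.
  - by move=> ? _ ? ? mn; rewrite lee_fin; exact/lefP/nd_nnsfun_approx.
transitivity (lim (\int[mu]_x ((f_ n x)%:E * (g x)%:E) @[n --> \oo])).
  by apply: congr_lim; apply/funext => n /=; exact: integral_density_nnsfun.
rewrite -monotone_convergence//=.
- apply: eq_integral => x /[!inE] xD; apply/cvg_lim => //=.
  by apply: cvgeZr => //; exact: cvg_nnsfun_approx.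
- move=> n; apply/measurable_EFinP/measurable_funM => //.
- by move=> n x _; rewrite mule_ge0 // lee_fin.
- move=> x _ m n mn; rewrite lee_wpmul2r ?lee_fin //.
  exact/lefP/nd_nnsfun_approx.
Qed.

End density.

Section normal_moments.
Variables (R : realType) (s : R).
Hypothesis s_gt0 : 0 < s.
Local Notation N := (normal_prob (0 : R) s).

(** The exponential of a quadratic turns a centred Gaussian density into a multiple of another one.
    Exponential moments of [x ^+ 2] then follow from the total mass of a density, for [b > 1] as
    well as for [b < 1]. *)
Lemma normal_pdf_scale (b x : R) : 0 < b ->
  expR ((1 - b ^- 2) / (2 * s ^+ 2) * x ^+ 2) * normal_pdf 0 s x =
  b * normal_pdf 0 (s * b) x.
Proof.
move=> b_gt0; rewrite !normal_pdfE ?gt_eqF ?mulr_gt0 //= /normal_fun.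
have -> : normal_peak s = b * normal_peak (s * b).
  rewrite /normal_peak.
  have -> : (s * b) ^+ 2 * pi *+ 2 = b ^+ 2 * (s ^+ 2 * pi *+ 2) by ring.
  rewrite sqrtrM ?sqr_ge0 // sqrtr_sqr gtr0_norm // invfM mulrA mulfV ?gt_eqF //.
  by rewrite mul1r.
rewrite -!mulrA mulrCA; congr (_ * _).
rewrite mulrCA; congr (_ * _); rewrite -expRD; congr expR.
by rewrite !subr0; field; rewrite !gt_eqF.
Qed.

(** Completing the square: the exponential tilt moves the mean to [t * s ^+ 2]. *)
Lemma normal_pdf_shift (t x : R) :
  expR (t * x) * normal_pdf 0 s x =
  expR (t ^+ 2 * s ^+ 2 / 2) * normal_pdf (t * s ^+ 2) s x.
Proof.
rewrite !normal_pdfE ?gt_eqF //= /normal_fun mulrCA [RHS]mulrCA.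
congr (_ * _); rewrite -!expRD; congr expR.
by rewrite !subr0; field; rewrite !gt_eqF.
Qed.

Lemma ge0_integral_normal (f : R -> R) :
  measurable_fun setT f -> (forall x, 0 <= f x) ->
  (\int[N]_x (f x)%:E = \int[lebesgue_measure]_x (f x * normal_pdf 0 s x)%:E)%E.
Proof.
move=> mf f0; rewrite (@ge0_integral_density _ _ _ lebesgue_measure N (normal_pdf 0 s)) //.
- exact: measurable_normal_pdf.
- by move=> x; exact: normal_pdf_ge0.
- exact/measurable_EFinP.
Qed.

Lemma integral_normal_expR_sqr (b : R) : 0 < b ->
  (\int[N]_x (expR ((1 - b ^- 2) / (2 * s ^+ 2) * x ^+ 2))%:E = b%:E)%E.
Proof.
move=> b_gt0; rewrite ge0_integral_normal; last 2 first.
- apply: measurableT_comp => //; exact: measurable_funM.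
- by move=> x; exact: expR_ge0.
under eq_integral do rewrite normal_pdf_scale // EFinM.
rewrite ge0_integralZl //=; last 3 first.
- by apply/measurable_EFinP; exact: measurable_normal_pdf.
- by move=> x _; rewrite lee_fin normal_pdf_ge0.
- by rewrite lee_fin ltW.
by rewrite integral_normal_pdf ?gt_eqF ?mulr_gt0 // mule1.
Qed.

Lemma integral_normal_expR (t : R) :
  (\int[N]_x (expR (t * x))%:E = (expR (t ^+ 2 * s ^+ 2 / 2))%:E)%E.
Proof.
rewrite ge0_integral_normal; last 2 first.
- by apply: measurableT_comp => //; apply: measurable_funM.
- by move=> x; exact: expR_ge0.
under eq_integral do rewrite normal_pdf_shift EFinM.
rewrite ge0_integralZl //=; last 2 first.
- by apply/measurable_EFinP; exact: measurable_normal_pdf.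
- by move=> x _; rewrite lee_fin normal_pdf_ge0.
by rewrite integral_normal_pdf ?gt_eqF // mule1.
Qed.

(* [1 + t x^2 <= exp (t x^2)] for both signs of [t] squeezes the variance between
   derivatives at 0 of the moment generating function of [x^2]. *)
Lemma integral_normal_sqr : (\int[N]_x (x ^+ 2)%:E = (s ^+ 2)%:E)%E.
Proof.
have s2 : 0 < s ^+ 2 by rewrite exprn_gt0.
have msq : measurable_fun setT (fun x : R => x ^+ 2) by exact: exprn_measurable.
have mexp (t : R) : measurable_fun setT (fun x : R => expR (t * x ^+ 2)).
  by apply: measurableT_comp => //; apply: measurable_funM.
set v := (\int[N]_x _)%E.
have v0 : (0 <= v)%E by apply: integral_ge0 => x _; rewrite lee_fin sqr_ge0.
have intZ (t : R) : 0 <= t -> (\int[N]_x (t * x ^+ 2)%:E = t%:E * v)%E.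
  move=> t0; under eq_integral do rewrite EFinM.
  rewrite ge0_integralZl //=; first exact/measurable_EFinP.
  by move=> x _; rewrite lee_fin sqr_ge0.
have int1 : (\int[N]_x (1 : R)%:E = 1)%E.
  by rewrite integral_cst //= probability_setT mule1.
have up (b : R) : 1 < b -> (((1 - b ^- 2) / (2 * s ^+ 2))%:E * v <= b%:E - 1)%E.
  move=> b1; have b0 : 0 < b by apply: lt_trans b1.
  set t := (1 - _) / _.
  have t0 : 0 <= t.
    apply: divr_ge0; last by rewrite mulr_ge0 // ltW.
    by rewrite subr_ge0 invf_le1 ?exprn_gt0 // exprn_ege1 // ltW.
  rewrite leeBrDl // -(integral_normal_expR_sqr b0) -int1 -intZ //.
  rewrite -ge0_integralD //=; last 2 first.
  - by move=> x _; rewrite lee_fin mulr_ge0 ?sqr_ge0.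
  - by apply/measurable_EFinP; exact: measurable_funM.
  apply: ge0_le_integral => //=.
  - by move=> x _; rewrite lee_fin addr_ge0 // mulr_ge0 ?sqr_ge0.
  - by apply/measurable_EFinP; apply: measurable_funD => //; exact: measurable_funM.
  - by apply/measurable_EFinP; exact: mexp.
  - by move=> x _; rewrite lee_fin expR_ge1Dx.
(* The case [b = 2] of [up] bounds a positive multiple of [v] by 1. *)
have vfin : v \is a fin_num.
  rewrite ge0_fin_numE // ltNge leye_eq. apply/negP => /eqP vy.
  have := up 2 (ltr1n _ 2); rewrite vy gt0_muley; first by [].
  rewrite lte_fin divr_gt0 ?mulr_gt0 // subr_gt0 invf_lt1 ?exprn_gt0 //.
  by rewrite exprn_egt1 // ltr1n.
have low (b : R) (b0 : 0 < b) (b1 : b < 1) :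
    (1 - b%:E <= (- ((1 - b ^- 2) / (2 * s ^+ 2)))%:E * v)%E.
  set t := (1 - _) / _.
  have t0 : 0 <= - t.
    rewrite /t -mulNr; apply: divr_ge0; last by rewrite mulr_ge0 // ltW.
    by rewrite opprB subr_ge0 invf_ge1 ?exprn_gt0 // exprn_ile1 // ltW.
  rewrite leeBlDr // -(integral_normal_expR_sqr b0) -{1}int1 -intZ //.
  rewrite -ge0_integralD //=; last 3 first.
  - by move=> x _; rewrite lee_fin mulr_ge0 ?sqr_ge0.
  - by apply/measurable_EFinP; exact: measurable_funM.
  - by apply/measurable_EFinP; exact: mexp.
  apply: ge0_le_integral => //=.
  - by apply/measurable_EFinP; apply: measurable_funD => //; [exact: measurable_funM|exact: mexp].
  - move=> x _; rewrite lee_fin; have := expR_ge1Dx (t * x ^+ 2).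
    by rewrite mulNr; lra.
have vE := fineK vfin; move: (fine v) vE => u vE.
rewrite -vE in v0 up low *; rewrite lee_fin in v0.
(* Both sides of [up] have a factor [b - 1]. Dividing by it leaves [(b + 1) u <= 2 s^2 b^2], where
   [b + 1 >= 2]; [lb] is the mirror case [b < 1]. *)
have ub (b : R) : 1 < b -> u <= s ^+ 2 * b ^+ 2.
  move=> b1; have b0 : 0 < b by apply: lt_trans b1.
  have := up _ b1; rewrite -EFinM -EFinB lee_fin.
  have -> : (1 - b ^- 2) / (2 * s ^+ 2) * u =
      (b - 1) * ((b + 1) / (2 * s ^+ 2 * b ^+ 2) * u).
    by field; rewrite !gt_eqF.
  rewrite -{2}[b - 1]mulr1 ler_pM2l ?subr_gt0 // mulrAC.
  rewrite ler_pdivrMr ?mulr_gt0 ?exprn_gt0 // mul1r => h.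
  have : 2 * u <= (b + 1) * u by rewrite ler_wpM2r //; lra.
  by lra.
have lb (b : R) : 0 < b -> b < 1 -> s ^+ 2 * b ^+ 2 <= u.
  move=> b0 b1.
  have := low _ b0 b1; rewrite -EFinM -EFinB lee_fin.
  have -> : - ((1 - b ^- 2) / (2 * s ^+ 2)) * u =
      (1 - b) * ((b + 1) / (2 * s ^+ 2 * b ^+ 2) * u).
    by field; rewrite !gt_eqF.
  rewrite -{1}[1 - b]mulr1 ler_pM2l ?subr_gt0 // mulrAC.
  rewrite ler_pdivlMr ?mulr_gt0 ?exprn_gt0 // mul1r => h.
  have : (b + 1) * u <= 2 * u by rewrite ler_wpM2r //; lra.
  by lra.
(* If [r > 1], the harmonic mean of 1 and [r] lies strictly between 1 and [sqrt r] and contradicts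
   [ub]; if [r < 1], their arithmetic mean lies strictly between [sqrt r] and 1 and contradicts
   [lb]. *)
congr (_%:E); pose r := u / s ^+ 2.
have uE : u = s ^+ 2 * r by rewrite /r mulrC divfK // gt_eqF.
have r0 : 0 <= r by rewrite divr_ge0 // ltW.
have r10 : 0 < 1 + r by lra.
apply/eqP; rewrite eq_le !leNgt; apply/andP; split; apply/negP => us.
  have r1 : 1 < r by rewrite ltr_pdivlMr // mul1r.
  have b1 : 1 < 2 * r / (1 + r) by rewrite ltr_pdivlMr //; lra.
  have := ub _ b1; rewrite uE ler_pM2l // exprMn exprVn ler_pdivlMr ?exprn_gt0 //.
  have : 0 < r * (r - 1) ^+ 2 by rewrite mulr_gt0 ?exprn_gt0 ?subr_gt0 //; lra.
  by lra.
have r1 : r < 1 by rewrite ltr_pdivrMr // mul1r.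
have b0 : 0 < (1 + r) / 2 by rewrite divr_gt0.
have b1 : (1 + r) / 2 < 1 by lra.
have := lb _ b0 b1; rewrite uE ler_pM2l //.
have : 0 < (1 - r) ^+ 2 by rewrite exprn_gt0 // subr_gt0.
by lra.
Qed.
End normal_moments.

Section normal_random_variable.
Context d (T : measurableType d) (R : realType) (P : probability T R).
Variables (U : T -> R) (s : R).
Hypotheses (mU : measurable_fun setT U) (s_gt0 : 0 < s).
Hypothesis U_law : forall B, measurable B -> P (U @^-1` B) = normal_prob 0 s B.

Let s2_gt0 : 0 < s ^+ 2. Proof. by rewrite exprn_gt0. Qed.

Let law_integral (f : R -> R) : measurable_fun setT f -> (forall x, 0 <= f x) ->
  (\int[P]_w (f (U w))%:E = \int[normal_prob 0 s]_x (f x)%:E)%E.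
Proof.
move=> mf f0; have mEf : measurable_fun setT (EFin \o f) by exact/measurable_EFinP.
pose mU' : {mfun T >-> measurableTypeR R} :=
  HB.pack (U : T -> measurableTypeR R) (isMeasurableFun.Build _ _ T (measurableTypeR R) U mU).
rewrite -(@eq_measure_integral _ _ _ _ (normal_prob 0 s) (distribution P mU')).
  rewrite ge0_integral_pushforward //=.
  by move=> x _; rewrite lee_fin.
by move=> A mA _; exact: U_law.
Qed.

(** This is the exponential moment at [b = 2], where [(1 - b^-2) / (2 s^2) = 3 / (8 s^2)]. The
    fourth moment and all tail bounds below come from it. *)
Lemma normal_integrable_expR_sqr :
  integrableR P (fun w => expR (3 / (8 * s ^+ 2) * U w ^+ 2)) /\
  \int[P]_w expR (3 / (8 * s ^+ 2) * U w ^+ 2) <= 2.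
Proof.
have me : measurable_fun setT (fun x : R => expR (3 / (8 * s ^+ 2) * x ^+ 2)).
  by apply: measurableT_comp => //; exact: measurable_funM.
apply: ge0_integrableR.
- exact: (measurableT_comp me mU).
- by move=> w; exact: expR_ge0.
- rewrite (law_integral me) => [|x]; last exact: expR_ge0.
  rewrite -(integral_normal_expR_sqr s_gt0 (ltr0n _ 2)).
  rewrite le_eqVlt; apply/orP; left; apply/eqP; apply: eq_integral => x _.
  by congr (expR (_ * _))%:E; field; rewrite gt_eqF.
Qed.

Lemma normal_integrable_sqr :
  integrableR P (fun w => U w ^+ 2) /\ \int[P]_w (U w ^+ 2) = s ^+ 2.
Proof.
have msq : measurable_fun setT (fun x : R => x ^+ 2) by exact: exprn_measurable.
have e : (\int[P]_w (U w ^+ 2)%:E = (s ^+ 2)%:E)%E.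
  rewrite (law_integral msq); first exact: integral_normal_sqr.
  by move=> x; exact: sqr_ge0.
split; last by rewrite /Rintegral e.
apply: (proj1 (ge0_integrableR (c := s ^+ 2) _ _ _)).
- exact: (measurableT_comp msq mU).
- by move=> w; exact: sqr_ge0.
- by rewrite e.
Qed.

Lemma normal_integrable : integrableR P U.
Proof.
have [i2 _] := normal_integrable_sqr.
apply: integrableR_le (integrableRD (integrableR_cst P 1) i2) => // w.
rewrite -(real_normK (num_real (U w))).
by have := sqr_ge0 (`|U w| - 1); have := normr_ge0 (U w); nra.
Qed.

(* Apply [1 + t U <= exp (t U)], whose right-hand side has expectation
   [exp (t^2 s^2 / 2)], and let [t] tend to 0 with the sign of the mean. *)
Lemma normal_centered : \int[P]_w U w = 0.
Proof.
set m := \int[P]_w _.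
have me t : measurable_fun setT (fun x : R => expR (t * x)).
  by apply: measurableT_comp => //; exact: measurable_funM.
have le_exp t : 1 + t * m <= expR (t ^+ 2 * s ^+ 2 / 2).
  have e : (\int[P]_w (expR (t * U w))%:E = (expR (t ^+ 2 * s ^+ 2 / 2))%:E)%E.
    rewrite (law_integral (me t)); first exact: integral_normal_expR.
    by move=> x; exact: expR_ge0.
  have [ei ele] : integrableR P (fun w => expR (t * U w)) /\
      \int[P]_w expR (t * U w) <= expR (t ^+ 2 * s ^+ 2 / 2).
    apply: ge0_integrableR; [exact: (measurableT_comp (me t) mU)| |by rewrite e].
    by move=> w; exact: expR_ge0.
  apply: le_trans ele.
  have -> : 1 + t * m = \int[P]_w (1 + t * U w).
    rewrite RintegralD //; last 2 first.
    - exact: integrableR_cst.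
    - exact: (integrableRZl t normal_integrable).
    rewrite RintegralZl //; last exact: normal_integrable.
    by rewrite Rintegral_cst //= probability_setT mul1r.
  apply: le_Rintegral => //; last by move=> w _; exact: expR_ge1Dx.
  exact: (integrableRD (integrableR_cst P 1) (integrableRZl t normal_integrable)).
apply/eqP/negP => /negP m0.
(* The point is [t = e m], with [e] small enough that [e s^2 <= 1] and [e m^2 < 1]. Bounding [exp y]
   by [1 / (1 - y)] gives [e m^2 (1 - (e s^2 / 2) (1 + e m^2)) <= 0], whose second factor is
   positive. *)
pose e := (1 + s ^+ 2 + m ^+ 2)^-1.
have s2 := s2_gt0; have m2 : 0 < m ^+ 2 by rewrite exprn_even_gt0.
have D0 : 0 < 1 + s ^+ 2 + m ^+ 2 by lra.
have e0 : 0 < e by rewrite invr_gt0.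
have eD : e * (1 + s ^+ 2 + m ^+ 2) = 1 by rewrite mulVf // gt_eqF.
have := le_exp (e * m); set y := (e * m) ^+ 2 * s ^+ 2 / 2 => h.
have h2 : 1 - y <= expR (- y) by exact: expR_ge1Dx.
have : (1 + e * m * m) * (1 - y) <= 1.
  rewrite (@le_trans _ _ ((1 + e * m * m) * expR (- y))) //.
    rewrite ler_wpM2l // -mulrA -expr2 addr_ge0 // mulr_ge0 // ltW //.
  by rewrite expRN ler_pdivrMr ?expR_gt0 // mul1r.
have -> : y = e ^+ 2 * m ^+ 2 * s ^+ 2 / 2 by rewrite /y exprMn.
rewrite -mulrA -expr2 => h3.
have es : e * s ^+ 2 <= 1 by rewrite -eD ler_pM2l //; lra.
have em : e * m ^+ 2 < 1 by rewrite -eD ltr_pM2l //; lra.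
have : e * m ^+ 2 * (1 - e * s ^+ 2 / 2 * (1 + e * m ^+ 2)) <= 0 by lra.
have em0 : 0 < e * m ^+ 2 by exact: mulr_gt0.
rewrite pmulr_rle0 // subr_le0 => h4.
have : 0 <= e * s ^+ 2 by rewrite mulr_ge0 // ltW.
by nra.
Qed.

(** For [y = 3 U^2 / (8 s^2)] one has [U^4 = (128 / 9) s^4 (y^2 / 2)] and [y^2 / 2 <= exp y], whose
    mean is at most 2; and [256 / 9 <= 29]. *)
Lemma normal_integrable_pow4 : integrableR P (fun w => U w ^+ 4) /\
  \int[P]_w (U w ^+ 4) <= 29 * s ^+ 4.
Proof.
have [ei ele] := normal_integrable_expR_sqr.
have U4 w : U w ^+ 4 <= 128 / 9 * s ^+ 4 * expR (3 / (8 * s ^+ 2) * U w ^+ 2).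
  have y0 : 0 <= 3 / (8 * s ^+ 2) * U w ^+ 2.
    by rewrite mulr_ge0 ?sqr_ge0 // divr_ge0 // mulr_ge0 // ltW.
  have := expR_ge1Dxn 1 y0; set e := expR _ => h.
  have -> : U w ^+ 4 = 128 / 9 * s ^+ 4 * ((3 / (8 * s ^+ 2) * U w ^+ 2) ^+ 2 / 2).
    by field; rewrite gt_eqF.
  rewrite ler_wpM2l ?mulr_ge0 ?exprn_ge0 ?ltW //.
  by move: h; rewrite (_ : (2`!)%:R = 2) //; lra.
have ei' := integrableRZl (128 / 9 * s ^+ 4) ei.
have i4 : integrableR P (fun w => U w ^+ 4).
  apply: integrableR_le ei'; first exact: (measurableT_comp (exprn_measurable 4) mU).
  by move=> w; rewrite ger0_norm // exprn_even_ge0.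
split=> //; apply: (le_trans (le_Rintegral measurableT i4 ei' (fun w _ => U4 w))).
rewrite RintegralZl //.
have : 0 < s ^+ 4 by rewrite exprn_gt0.
by set x := s ^+ 4; set y := Rintegral _ _ _ in ele *; nra.
Qed.

(** Markov's inequality for the exponential of the square, with the exponential at the threshold
    bounded below by a single Taylor term. The order [k] stays free, to be chosen against the number
    of increments in a union bound. *)
Lemma normal_tail (l : R) (k : nat) : 0 < l ->
  (P [set w | (l <= `|U w|)%R] <=
     (2 * (k.+1)`!%:R * (8 * s ^+ 2 / (3 * l ^+ 2)) ^+ k.+1)%R%:E)%E.
Proof.
move=> l0; have [ei ele] := normal_integrable_expR_sqr.
pose y := 3 / (8 * s ^+ 2) * l ^+ 2.
have y0 : 0 < y by rewrite mulr_gt0 ?exprn_gt0 // divr_gt0 // mulr_gt0.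
pose c := y ^+ k.+1 / (k.+1)`!%:R.
have c0 : 0 < c by rewrite divr_gt0 ?exprn_gt0 // ltr0n fact_gt0.
have mA f (x : R) : measurable_fun setT (f : T -> R) -> measurable [set w | (x <= f w)%R].
  move=> mf; rewrite -[X in measurable X]setTI.
  rewrite (_ : [set w | (x <= f w)%R] = f @^-1` `[x, +oo[).
    by apply: mf => //; exact: measurable_itv.
  by apply/seteqP; split => w /=; rewrite in_itv/= andbT.
apply: (@le_trans _ _ (P [set w | (c <= expR (3 / (8 * s ^+ 2) * U w ^+ 2))%R])).
  apply: le_measure; rewrite ?inE.
  - by apply: mA; exact: measurableT_comp.
  - by apply: mA; exact: integrableR_measurable ei.
  - move=> w /= lU; have yU : y <= 3 / (8 * s ^+ 2) * U w ^+ 2.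
      apply: ler_wpM2l; first by rewrite divr_ge0 // mulr_ge0 // ltW.
      by rewrite -(real_normK (num_real (U w))) lerXn2r ?nnegrE // ltW.
    apply: le_trans (_ : expR y <= _); last by rewrite ler_expR.
    by have := expR_ge1Dxn k (ltW y0); rewrite -/c; lra.
apply: le_trans (markov_ineq ei _ c0) _; first by move=> w; exact: expR_ge0.
rewrite lee_fin ler_pdivrMr // /c.
set F := (k.+1)`!%:R; have F0 : F != 0 by rewrite pnatr_eq0 -lt0n fact_gt0.
set A := 8 * s ^+ 2 / (3 * l ^+ 2); have AB : A * y = 1 by rewrite /A /y; field; rewrite !gt_eqF.
have -> : 2 * F * A ^+ k.+1 * (y ^+ k.+1 / F) = 2 * (A * y) ^+ k.+1.
  by rewrite [(A * y) ^+ _]exprMn; move: (A ^+ k.+1) (y ^+ k.+1) => A' y'; field.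
by rewrite AB expr1n mulr1.
Qed.
End normal_random_variable.

(** * Concentration of quadratic covariations *)

Section noise.
Context d (T : measurableType d) (R : realType) (P : probability T R).

(* The last clause says that [u] is [F]-conditionally centred. *)
Definition centered_noise (F : set (set T)) (C : R) (u : T -> R) : Prop :=
  [/\ measurable_fun setT u, integrableR P (fun w => u w ^+ 2),
      \int[P]_w (u w ^+ 2) <= C &
      forall S : T -> R, measurable_fun setT S ->
        (forall B, measurable B -> F (S @^-1` B)) ->
        integrableR P (fun w => S w ^+ 2) -> \int[P]_w (S w * u w) = 0].

Lemma integrableR_sqr_integrable (u : T -> R) : measurable_fun setT u ->
  integrableR P (fun w => u w ^+ 2) -> integrableR P u.
Proof.
move=> mu u2; apply: integrableR_le (integrableRD (integrableR_cst P 1) u2) => // w.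
rewrite -(real_normK (num_real (u w))).
by have := sqr_ge0 (`|u w| - 1); have := normr_ge0 (u w); nra.
Qed.

Lemma martingale_second_moment (n : nat) (F : nat -> set (set T)) (C : R)
    (u : nat -> T -> R) :
  (forall i, (i < n)%N -> sigma_algebra setT (F i)) ->
  (forall i, (i < n)%N -> centered_noise (F i) C (u i)) ->
  (forall i j B, (j < i)%N -> (i < n)%N -> measurable B -> F i (u j @^-1` B)) ->
  integrableR P (fun w => (\sum_(i < n) u i w) ^+ 2) /\
  \int[P]_w ((\sum_(i < n) u i w) ^+ 2) <= n%:R * C.
Proof.
move=> sF noise adap.
suff H m : (m <= n)%N -> [/\ measurable_fun setT (fun w => \sum_(i < m) u i w),
    integrableR P (fun w => (\sum_(i < m) u i w) ^+ 2) &
    \int[P]_w ((\sum_(i < m) u i w) ^+ 2) <= m%:R * C].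
  by have [] := H n (leqnn n).
elim: m => [_|m IH mn].
  have -> : (fun w => \sum_(i < 0) u i w) = cst 0.
    by apply/funext => w; rewrite big_ord0.
  have -> : (fun w => (\sum_(i < 0) u i w) ^+ 2) = cst 0.
    by apply/funext => w; rewrite big_ord0 expr0n.
  split; [exact: measurable_cst|exact: integrableR_cst|].
  by rewrite Rintegral_cst // mul0r mul0r.
have [mS S2 leS] := IH (ltnW mn).
have [mu u2 leu cu] := noise m mn.
pose S w := \sum_(i < m) u i w.
have FS B : measurable B -> F m (S @^-1` B).
  move=> mB.
  (* The past sum is [F m]-measurable, so the centring of [u m] removes the cross term and second
     moments add up. Viewing [F m] as the measurable structure of the source makes the measurability
     of sums available. *)
  have : measurable_fun setT (S : g_sigma_algebraType (F m) -> R).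
    apply: measurable_sum => i _ B' mB'; rewrite setTI.
    by apply: sub_sigma_algebra; exact: adap.
  move=> /(_ measurableT B mB); rewrite setTI.
  by rewrite /measurable /= (sigma_algebra_id (sF m mn)).
have SE : (fun w => \sum_(i < m.+1) u i w) = (fun w => S w + u m w).
  by apply/funext => w; rewrite big_ord_recr.
have S2E : (fun w => (\sum_(i < m.+1) u i w) ^+ 2) =
    (fun w => S w ^+ 2 + (2 * (S w * u m w) + u m w ^+ 2)).
  by apply/funext => w; rewrite big_ord_recr /= -/(S w); ring.
have iSu : integrableR P (fun w => S w * u m w) by exact: integrableR_sqr_mul.
have i2Su := integrableRZl 2 iSu.
split.
- by rewrite SE; exact: measurable_funD.
- by rewrite S2E; apply: integrableRD => //; exact: integrableRD.
- rewrite S2E RintegralD //; last exact: integrableRD.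
  rewrite RintegralD // RintegralZl // cu // mulr0 add0r.
  by rewrite -natr1 mulrDl mul1r lerD.
Qed.

Lemma martingale_concentration (n : nat) (F : nat -> set (set T)) (C K : R)
    (u : nat -> T -> R) : (0 < n)%N -> 0 < K ->
  (forall i, (i < n)%N -> sigma_algebra setT (F i)) ->
  (forall i, (i < n)%N -> centered_noise (F i) C (u i)) ->
  (forall i j B, (j < i)%N -> (i < n)%N -> measurable B -> F i (u j @^-1` B)) ->
  (P [set w | (K * Num.sqrt n%:R <= `|\sum_(i < n) u i w|)%R] <= (C / K ^+ 2)%:E)%E.
Proof.
move=> n0 K0 sF noise adap.
have [i2 le2] := martingale_second_moment sF noise adap.
have n0' : 0 < n%:R :> R by rewrite ltr0n.
have KE : K ^+ 2 * n%:R = (K * Num.sqrt n%:R) ^+ 2 by rewrite exprMn sqr_sqrtr.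
have -> : [set w | (K * Num.sqrt n%:R <= `|\sum_(i < n) u i w|)%R] =
    [set w | (K ^+ 2 * n%:R <= (\sum_(i < n) u i w) ^+ 2)%R].
  apply/seteqP; split => w /=; rewrite -(real_normK (num_real (\sum_(i < n) u i w)));
    rewrite KE ler_pXn2r //.
  all: rewrite ?nnegrE ?mulr_ge0 ?sqrtr_ge0 ?normr_ge0 ?(ltW K0) //.
apply: le_trans (markov_ineq i2 _ _) _.
- by move=> w; exact: sqr_ge0.
- by rewrite mulr_gt0 // exprn_gt0.
rewrite lee_fin ler_pdivrMr ?mulr_gt0 ?exprn_gt0 // (le_trans le2) //.
by rewrite mulrA divfK ?gt_eqF ?exprn_gt0 // mulrC.
Qed.
End noise.

(** * Products of Gaussian variables as centred noise *)

Section gaussian_noise.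
Context d (T : measurableType d) (R : realType) (P : probability T R).
Variables (F : set (set T)) (s : R).
Hypotheses (s_gt0 : 0 < s) (FT : F setT) (Fm : F `<=` measurable).
Local Notation N := (normal_prob (0 : R) s).

(** From [(a - c)^2 <= 2 a^2 + 2 c^2] and [2 a^2 <= (U / s)^4 + (V / s)^4], the second moment is at
    most [29 + 29 + 2]. The case [U = V], [c = 1] serves the diagonal, the case [c = 0] the products
    of distinct coordinates. *)
Let normal_product_sqr (U V : T -> R) (c : R) :
  measurable_fun setT U -> measurable_fun setT V ->
  (forall B, measurable B -> P (U @^-1` B) = N B) ->
  (forall B, measurable B -> P (V @^-1` B) = N B) -> c ^+ 2 <= 1 ->
  let u := fun w => U w * V w / s ^+ 2 - c in
  [/\ measurable_fun setT u, integrableR P (fun w => u w ^+ 2) &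
      \int[P]_w (u w ^+ 2) <= 60].
Proof.
move=> mU mV lU lV c1 u.
have s4 : 0 < s ^+ 4 by rewrite exprn_gt0.
have mu : measurable_fun setT u.
  apply: measurable_funB => //; apply: measurable_funM => //.
  exact: measurable_funM.
have [iU leU] := normal_integrable_pow4 mU s_gt0 lU.
have [iV leV] := normal_integrable_pow4 mV s_gt0 lV.
have iUV := integrableRD (integrableRZl (s ^- 4) (integrableRD iU iV)) (integrableR_cst P 2).
have u2 w : u w ^+ 2 <= s ^- 4 * (U w ^+ 4 + V w ^+ 4) + 2.
  have -> : s ^- 4 * (U w ^+ 4 + V w ^+ 4) =
      (U w ^+ 2 / s ^+ 2) ^+ 2 + (V w ^+ 2 / s ^+ 2) ^+ 2.
    by field; rewrite gt_eqF.
  rewrite /u; set a := U w * V w / s ^+ 2.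
  have a2 : a ^+ 2 = (U w ^+ 2 / s ^+ 2) * (V w ^+ 2 / s ^+ 2).
    by rewrite /a; field; rewrite gt_eqF.
  have h1 := sqr_ge0 (U w ^+ 2 / s ^+ 2 - V w ^+ 2 / s ^+ 2).
  have h2 := sqr_ge0 (a + c).
  by move: a2 h1 h2; move: (_ / _) (_ / _) => x y; nra.
have mu2 : measurable_fun setT (fun w => u w ^+ 2) by exact: measurable_funX.
have iu2 : integrableR P (fun w => u w ^+ 2).
  by apply: integrableR_le iUV => // w; rewrite ger0_norm ?sqr_ge0.
split=> //; apply: (le_trans (le_Rintegral measurableT iu2 iUV (fun w _ => u2 w))).
rewrite RintegralD //; last 2 first.
- exact: (integrableRZl (s ^- 4) (integrableRD iU iV)).
- exact: integrableR_cst.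
rewrite RintegralZl //; last exact: integrableRD.
rewrite RintegralD // Rintegral_cst //= probability_setT mulr1.
have h : \int[P]_x (U x ^+ 4) + \int[P]_x (V x ^+ 4) <= 58 * s ^+ 4 by lra.
rewrite -lerBrDr (_ : 60 - 2 = 58); last by ring.
by rewrite ler_pdivrMl // mulrC.
Qed.

Let indep_noise (u : T -> R) : measurable_fun setT u ->
  integrableR P (fun w => u w ^+ 2) -> \int[P]_w u w = 0 ->
  (forall G B, F G -> measurable B ->
     P (G `&` u @^-1` B) = P G * P (u @^-1` B))%E ->
  forall S : T -> R, measurable_fun setT S ->
    (forall B, measurable B -> F (S @^-1` B)) ->
    integrableR P (fun w => S w ^+ 2) -> \int[P]_w (S w * u w) = 0.
Proof.
move=> mu u2 u0 ind S mS FS S2; apply: Rintegral_indep_centered => //.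
- by move=> A B mA mB; rewrite ind //; exact: FS.
- exact: integrableR_sqr_mul.
- exact: integrableR_sqr_integrable.
Qed.

Lemma gaussian_square_noise (U : T -> R) : measurable_fun setT U ->
  (forall G B, F G -> measurable B -> P (G `&` U @^-1` B) = P G * N B)%E ->
  centered_noise P F 60 (fun w => U w * U w / s ^+ 2 - 1).
Proof.
move=> mU jU.
have lU B : measurable B -> P (U @^-1` B) = N B.
  by move=> mB; have := jU _ _ FT mB; rewrite setTI probability_setT mul1e.
have [|mu u2 leu] := normal_product_sqr mU mU lU lU (c := 1).
  by rewrite expr1n.
split=> //; apply: indep_noise => //.
- have [iU2 U2] := normal_integrable_sqr mU s_gt0 lU.
  transitivity (\int[P]_w (s ^- 2 * U w ^+ 2 + - 1)).
    by apply: eq_Rintegral => w _; ring.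
  rewrite RintegralD //; last 2 first.
  + exact: (integrableRZl (s ^- 2) iU2).
  + exact: integrableR_cst.
  rewrite RintegralZl // U2 Rintegral_cst //= probability_setT mulr1.
  by rewrite mulVf ?subrr // gt_eqF // exprn_gt0.
- move=> G B FG mB.
  pose phi (x : R) := x * x / s ^+ 2 - 1.
  have mphi : measurable_fun setT phi.
    by apply: measurable_funB => //; apply: measurable_funM => //; exact: measurable_funM.
  have mB' : measurable (phi @^-1` B).
    by rewrite -[X in measurable X]setTI; exact: mphi.
  by have := jU _ _ FG mB'; rewrite -(lU _ mB').
Qed.

Lemma gaussian_product_noise (U V : T -> R) :
  measurable_fun setT U -> measurable_fun setT V ->
  (forall G A B, F G -> measurable A -> measurable B ->
     P (G `&` (U @^-1` A `&` V @^-1` B)) = P G * (N A * N B))%E ->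
  centered_noise P F 60 (fun w => U w * V w / s ^+ 2).
Proof.
move=> mU mV jUV.
have NT : N setT = 1%E by exact: probability_setT.
have lU B : measurable B -> P (U @^-1` B) = N B.
  move=> mB; have := jUV _ _ _ FT mB measurableT.
  by rewrite setTI preimage_setT setIT probability_setT NT mul1e mule1.
have lV B : measurable B -> P (V @^-1` B) = N B.
  move=> mB; have := jUV _ _ _ FT measurableT mB.
  by rewrite setTI preimage_setT setTI probability_setT NT !mul1e.
have [|] := normal_product_sqr mU mV lU lV (c := 0); first by rewrite expr0n.
rewrite (_ : (fun w => _ - 0) = fun w => U w * V w / s ^+ 2); last first.
  by apply/funext => w; rewrite subr0.
rewrite (_ : (fun w => (_ - 0) ^+ 2) = fun w => (U w * V w / s ^+ 2) ^+ 2); last first.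
  by apply/funext => w; rewrite subr0.
move=> mu u2 leu; split=> //.
have mUV : measurable_fun setT
    ((fun w => (U w, V w)) : T -> (measurableTypeR R * measurableTypeR R)%type).
  exact/measurable_fun_pairP.
(* The hypothesis speaks of rectangles, while an event on the product [U V] is a general set of the
   plane. For [P G] positive, [m'] is the conditional law of [(U, V)] given [G]; it agrees with the
   product of normal laws on rectangles, hence everywhere. For [P G = 0] both sides vanish. *)
have joint G C : F G -> measurable C ->
    (P (G `&` (fun w => (U w, V w)) @^-1` C) = P G * (N \x N)%E C)%E.
  move=> FG mC; have mG := Fm FG.
  have [PG0|PG0] := eqVneq (P G) 0%E.
    rewrite PG0 mul0e; apply/eqP; rewrite eq_le measure_ge0 andbT -PG0.
    apply: le_measure; rewrite ?inE //.
    by apply: measurableI => //; rewrite -[X in measurable X]setTI; exact: mUV.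
  have PGE : P G = (fine (P G))%:E by rewrite fineK // fin_num_measure.
  have p0 : 0 < fine (P G).
    by rewrite lt_neqAle fine_ge0 // andbT eq_sym; apply: contra PG0 => /eqP p0;
      rewrite PGE p0.
  have ip0 : 0 <= (fine (P G))^-1 by rewrite invr_ge0 ltW.
  pose m' : {measure set (measurableTypeR R * measurableTypeR R) -> \bar R} :=
    mscale (NngNum ip0)
    (measure_function_pushforward__canonical__measure_function_Measure
       (mrestr P mG) mUV).
  have m'E X : m' X =
    ((fine (P G))^-1%:E * P ((fun w => (U w, V w)) @^-1` X `&` G))%E by [].
  rewrite (@product_measure_unique _ _ _ _ _ N N m' _ C mC).
    rewrite m'E setIC {1}PGE.
    by rewrite muleA -EFinM mulfV ?gt_eqF // mul1e.
  move=> A B mA mB.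
  rewrite m'E setIC (jUV G A B) //.
  by rewrite PGE muleA -EFinM mulVf ?gt_eqF // mul1e.
apply: indep_noise => //.
- have [iU2 _] := normal_integrable_sqr mU s_gt0 lU.
  have [iV2 _] := normal_integrable_sqr mV s_gt0 lV.
  have iUV := integrableR_sqr_mul iU2 iV2 mU mV.
  under eq_Rintegral do rewrite mulrC.
  rewrite RintegralZl // (@Rintegral_indep_centered _ _ _ P U V) ?mulr0 //.
  + move=> A B mA mB; have := jUV _ _ _ FT mA mB.
    by rewrite setTI probability_setT mul1e lU // lV.
  + exact: normal_integrable lV.
  + exact: normal_centered lV.
- move=> G B FG mB.
  pose phi (z : R * R) := z.1 * z.2 / s ^+ 2.
  have mphi : measurable_fun setT phi.
    by apply: measurable_funM => //; exact: measurable_funM.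
  have mB' : measurable (phi @^-1` B).
    by rewrite -[X in measurable X]setTI; exact: mphi.
  rewrite [X in _ = (_ * X)%E](_ : _ = (N \x N)%E (phi @^-1` B)); first exact: joint.
  by have := joint _ _ FT mB'; rewrite setTI probability_setT mul1e.
Qed.
End gaussian_noise.

(** * Increments of the latent processes *)

Section cadlag_path.
Variables (R : realType) (y L : R -> R) (T : R).
Hypothesis T_gt0 : 0 < T.
Hypothesis y_left : forall t, 0 < t -> y s @[s --> t^'-] --> L t.

(** On the cell []t_k, t_(k+1)]] the value is [y] at the left end, which lies strictly before [s].
    As the mesh shrinks these step functions converge to the left limit, which thereby inherits
    their measurability and bounds. *)
Definition grid_step n (s : R) : R :=
  \sum_(k < n) y (k%:R * (T / n%:R)) *
    \1_(`]k%:R * (T / n%:R), k.+1%:R * (T / n%:R)]%classic) s.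

Lemma measurable_grid_step n : measurable_fun setT (grid_step n).
Proof.
by apply: measurable_sum => k; apply: measurable_funM.
Qed.

Lemma grid_stepE n s : 0 < s -> s <= T -> exists k,
  [/\ (k < n.+1)%N, k%:R * (T / n.+1%:R) < s, s <= k.+1%:R * (T / n.+1%:R) &
      grid_step n.+1 s = y (k%:R * (T / n.+1%:R))].
Proof.
move=> s_gt0 sT; set h := T / n.+1%:R.
have h_gt0 : 0 < h by rewrite divr_gt0.
have [|k sk kmin] := @ex_minnP (fun k => s <= k.+1%:R * h).
  by exists n; rewrite /h mulrC divfK // pnatr_eq0.
have kn : (k < n.+1)%N by rewrite ltnS kmin // /h mulrC divfK // pnatr_eq0.
have ks : k%:R * h < s.
  rewrite ltNge; apply/negP => sk'.
  case: k sk kmin kn sk' => [|k] sk kmin kn sk'.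
    by move: sk'; rewrite mul0r leNgt s_gt0.
  by have := kmin k sk'; rewrite ltnn.
exists k; split=> //.
rewrite /grid_step (bigD1 (Ordinal kn)) //= -/h indicE mem_set ?mulr1; last first.
  by rewrite /= in_itv /= ks sk.
rewrite big1 ?addr0 // => i ik; rewrite indicE memNset ?mulr0 //= in_itv /=.
move=> /andP[is_ si].
have : (i < k.+1)%N by rewrite -(ltr_nat R) -(ltr_pM2r h_gt0) (lt_le_trans is_).
have : (k < i.+1)%N by rewrite -(ltr_nat R) -(ltr_pM2r h_gt0) (lt_le_trans ks).
rewrite !ltnS => ki ik'; move: ik; apply/negP; rewrite negbK.
by apply/eqP/val_inj/eqP; rewrite eqn_leq ik' ki.
Qed.

Lemma cvg_grid_step s : 0 < s -> s <= T -> grid_step n s @[n --> \oo] --> L s.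
Proof.
move=> s_gt0 sT; apply/cvgrPdist_lt => e e_gt0.
have /cvgrPdist_lt/(_ e e_gt0) := y_left s_gt0.
rewrite /prop_near1 /at_left /within /= => /nbhs_ballP[r /= r_gt0 rB].
near=> n.
have n_gt0 : (0 < n)%N by near: n; exists 1%N.
rewrite -(prednK n_gt0).
have [k [_ ks sk ->]] := grid_stepE n.-1 s_gt0 sT.
apply: rB => //=; rewrite prednK // in ks sk *.
rewrite /ball /= gtr0_norm ?subr_gt0 // ltrBlDr.
apply: (le_lt_trans sk); rewrite -natr1 mulrDl mul1r addrC ltrD2r.
rewrite ltr_pdivrMr ?ltr0n // mulrC -ltr_pdivrMr //.
near: n; exact: nbhs_infty_gtr.
Unshelve. all: by end_near. Qed.

Lemma measurable_left_limit : measurable_fun `]0, T] L.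
Proof.
apply: (@measurable_fun_cvg _ _ _ _ grid_step).
  by move=> n; apply: measurable_funTS; exact: measurable_grid_step.
by move=> s; rewrite /= in_itv /= => /andP[? ?]; exact: cvg_grid_step.
Qed.

Lemma left_limit_le (K : R) :
  (forall n k, (k < n)%N -> `|y (k%:R * (T / n%:R))| <= K) ->
  forall s, 0 < s -> s <= T -> `|L s| <= K.
Proof.
move=> yK s s_gt0 sT.
have cL : `|grid_step n.+1 s| @[n --> \oo] --> `|L s|.
  apply: cvg_norm; rewrite (cvg_shiftS (fun n => grid_step n s)) //.
  exact: cvg_grid_step.
rewrite -(cvg_lim _ cL) //; apply: limr_le; first by apply/cvg_ex; exists `|L s|.
by near=> n; have [k [kn _ _ ->]] := grid_stepE n s_gt0 sT; exact: yK.
Unshelve. all: by end_near. Qed.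

Hypothesis y_right : forall t, 0 <= t -> y s @[s --> t^'+] --> y t.

(** Near [t], the path stays within 1 of [y t] on the right and of [L t] on the left, hence is
    bounded by [|y t| + |L t| + 1]; compactness makes the bound uniform. It is a natural number so
    that the bounded paths exhaust [Omega] along a sequence of events. *)
Lemma cadlag_bounded : exists K : nat, forall s, 0 <= s -> s <= T -> `|y s| <= K%:R.
Proof.
have /compact_near_coveringP cov : compact `[0 : R, T] by exact: segment_compact.
have step t : [set` `[0 : R, T]] t ->
    \forall t' \near t & K \near pinfty_nbhs R, 0 <= t' -> `|y t'| <= K.
  rewrite /= in_itv /= => /andP[t0 tT].
  have /cvgrPdist_lt/(_ 1 ltr01) := y_right t0.
  rewrite /prop_near1 /at_right /within /= => /nbhs_ballP[r1 /= r1_gt0 r1B].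
  have [r2 r2_gt0 r2B] : exists2 r2 : R, 0 < r2 &
      forall s, `|t - s| < r2 -> s < t -> 0 <= s -> `|L t - y s| < 1.
    case: (ltrP 0 t) => [t_gt0|t_le0]; last first.
      by exists 1 => // s _ st s0; move: (lt_le_trans st t_le0); rewrite ltNge s0.
    have /cvgrPdist_lt/(_ 1 ltr01) := y_left t_gt0.
    rewrite /prop_near1 /at_left /within /= => /nbhs_ballP[r2 /= r2_gt0 r2B].
    by exists r2 => // s ts st _; exact: r2B.
  exists (ball t (Num.min r1 r2), [set K | `|y t| + `|L t| + 1 < K]) => /=.
    split; first by apply: nbhsx_ballx; rewrite lt_min r1_gt0.
    by exists (`|y t| + `|L t| + 1); split=> //; exact: num_real.
  move=> [s K] /= [sB KM] s0; apply: le_trans (ltW KM).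
  move: sB; rewrite /ball /= lt_min => /andP[ts1 ts2].
  have [st|st|->] := ltgtP s t.
  - have := r2B s ts2 st s0; rewrite distrC => h.
    have := ler_normD (y s - L t) (L t); rewrite subrK.
    by have := normr_ge0 (y t); lra.
  - have := r1B s ts1 st; rewrite distrC => h.
    have := ler_normD (y s - y t) (y t); rewrite subrK.
    by have := normr_ge0 (L t); lra.
  - by have := normr_ge0 (L t); lra.
have [M [_ MB]] := cov R (pinfty_nbhs R) (fun K s => 0 <= s -> `|y s| <= K) _ step.
exists (Num.bound `|M|) => s s0 sT.
apply: (MB (Num.bound `|M|)%:R) => //; last by rewrite /= in_itv /= s0.
by rewrite (le_lt_trans (ler_norm M)) // archi_boundP.
Qed.
End cadlag_path.

(** * A single path of the jump equation *)

Section sde_path.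
Variables (R : realType) (d : nat) (Y : R -> 'cV[R]_d) (T : R).
Hypothesis T_gt0 : 0 < T.
Hypothesis Y_cadlag : forall t, 0 <= t ->
  (Y s @[s --> t^'+] --> Y t) /\ (0 < t -> cvg (Y s @[s --> t^'-])).
Let L t : 'cV[R]_d := lim (Y s @[s --> t^'-]).

Let Y_left j t : 0 < t -> Y s j 0 @[s --> t^'-] --> L t j 0.
Proof.
move=> t_gt0; have [_ /(_ t_gt0) cY] := Y_cadlag (ltW t_gt0).
apply: (@cvg_comp _ _ _ Y (fun M : 'cV[R]_d => M j 0) _ (nbhs (L t))) => //.
exact: coord_continuous.
Qed.

Lemma cadlag_coord_bounded : exists K : nat,
  forall s, 0 <= s -> s <= T -> forall j, `|Y s j 0| <= K%:R.
Proof.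
have bnd (j : 'I_d) : exists K : nat, forall s, 0 <= s -> s <= T -> `|Y s j 0| <= K%:R.
  apply: (@cadlag_bounded R (fun s => Y s j 0) (fun s => L s j 0)).
    by move=> t; exact: Y_left.
  move=> t t0; have [cY _] := Y_cadlag t0.
  apply: (@cvg_comp _ _ _ Y (fun M : 'cV[R]_d => M j 0) _ (nbhs (Y t))) => //.
  exact: coord_continuous.
have [K KP] := choice bnd.
exists (\max_(j < d) K j)%N => s s0 sT j; apply: (le_trans (KP j s s0 sT)).
by rewrite ler_nat leq_bigmax.
Qed.

(** The left limit is controlled on []0, T]]; extension by 0 gives a map measurable on the whole
    line, to be composed with [a] and [c]. *)
Let Lr s : 'cV[R]_d := \col_j ((fun s => L s j 0) \_ `]0, T]) s.

Let measurable_Lr : measurable_fun setT Lr.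
Proof.
apply/measurable_fun_mxP => j k.
rewrite (_ : (fun _ => _) = (fun s => L s j 0) \_ `]0, T]); last first.
  by apply/funext => s; rewrite mxE.
apply/(measurable_restrict _ _ _).1 => //; rewrite setTI.
apply: (@measurable_left_limit R (fun s => Y s j 0)) => //.
by move=> t; exact: Y_left.
Qed.

Let LrE s : 0 < s -> s <= T -> Lr s = L s.
Proof.
move=> s0 sT; apply/colP => j; rewrite mxE patchE mem_set //.
by rewrite /= in_itv /= s0.
Qed.

Variable K : R.
Hypothesis Y_grid : forall n k j, (k < n)%N -> `|Y (k%:R * (T / n%:R)) j 0| <= K.

Let L_le s j : 0 < s -> s <= T -> `|L s j 0| <= K.
Proof.
move=> s0 sT.
apply: (@left_limit_le R (fun s => Y s j 0) (fun s => L s j 0) T) => //.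
- by move=> t; exact: Y_left.
- by move=> n k kn; exact: Y_grid.
Qed.

Variables (a : 'cV[R]_d -> 'cV[R]_d) (C : R).
Hypothesis a_borel : measurable_fun setT a.
Hypothesis a_le : forall x : 'cV[R]_d, (forall j, `|x j 0| <= K) -> forall j, `|a x j 0| <= C.

Let drift j s := a (L s) j 0.

Let measurable_drift j t : 0 <= t -> t <= T -> measurable_fun `[0, t] (drift j).
Proof.
move=> t0 tT.
have -> : `[0, t]%classic = [set 0 : R] `|` `]0, t]%classic.
  by rewrite -(@setU1itv _ _ (BRight t) 0 false) // bnd_simp.
apply/measurable_funU => //; split; first exact: measurable_fun_set1.
apply: (@eq_measurable_fun _ _ _ _ _ (fun s => a (Lr s) j 0)).
  move=> s; rewrite inE /= in_itv /= => /andP[s0 st].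
  by rewrite LrE // (le_trans st).
apply: measurable_funTS.
exact: (measurableT_comp (measurable_coord j 0) (measurableT_comp a_borel measurable_Lr)).
Qed.

Let integrable_drift j t : 0 <= t -> t <= T ->
  lebesgue_measure.-integrable `[0, t] (EFin \o drift j).
Proof.
move=> t0 tT; apply: measurable_bounded_integrable => //.
- by rewrite /= lebesgue_measure_itv /=; case: ifP => _; rewrite ?ltry ?lt0y.
- exact: measurable_drift.
(* At time 0 the left limit is not bounded by [K], so the value there enters the bound
   separately. *)
- exists (Num.max C `|drift j 0|); split; first exact: num_real.
  move=> M MC s; rewrite /= in_itv /= => /andP[s0 st].
  apply: le_trans (ltW MC); rewrite le_max.
  move: s0; rewrite le_eqVlt => /predU1P[<-|s0]; first by rewrite lexx orbT.
  rewrite a_le // => l; apply: L_le => //; exact: le_trans tT.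
Qed.

Let drift_increment j t t' : 0 <= t -> t <= t' -> t' <= T ->
  `|\int[lebesgue_measure]_(s in `[0, t']) drift j s -
    \int[lebesgue_measure]_(s in `[0, t]) drift j s| <= C * (t' - t).
Proof.
move=> t0 tt' t'T; have t'0 := le_trans t0 tt'.
have di := integrable_drift j t'0 t'T.
rewrite Rintegral_itvB //.
have sub : `]t, t']%classic `<=` `[0, t']%classic.
  by move=> s; rewrite /= !in_itv /= => /andP[ts ->]; rewrite (le_trans t0) ?(ltW ts).
have di' : lebesgue_measure.-integrable `]t, t'] (EFin \o drift j).
  by apply: integrableS di => //; exact: sub.
apply: (le_trans (le_normr_Rintegral _ di')) => //.
have -> : C * (t' - t) = \int[lebesgue_measure]_(s in `]t, t']) C.
  rewrite Rintegral_cst //= lebesgue_measure_itv /= lte_fin.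
  case: ltrP => //= t't.
  by rewrite (_ : t' = t) ?subrr ?mulr0 //; apply/le_anti; rewrite t't tt'.
apply: le_Rintegral => //.
- exact: integrable_norm.
- apply: measurable_bounded_integrable => //.
  + by rewrite /= lebesgue_measure_itv /=; case: ifP => _; rewrite ?ltry ?lt0y.
  + by exists `|C|; split; [exact: num_real|move=> M MC s _; exact: ltW].
- move=> s; rewrite /= in_itv /= => /andP[ts st'].
  have s0 := le_lt_trans t0 ts.
  by apply: a_le => l; apply: L_le => //; exact: le_trans t'T.
Qed.

Variables (c : 'cV[R]_d -> 'cV[R]_d -> 'cV[R]_d).
Hypothesis c_borel : measurable_fun (setT `*` @punctured R d) (fun x => c x.1 x.2).
Variable m : {measure set (measurableTypeR R * 'cV[R]_d) -> \bar R}.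

Lemma measurable_punctured : measurable (@punctured R d).
Proof.
apply: measurableC.
rewrite (_ : [set 0] = \bigcap_(j in [set: 'I_d])
    ((fun v : 'cV[R]_d => v j 0) @^-1` [set 0])).
  apply: fin_bigcap_measurable; first exact: finite_finset.
  move=> j _; rewrite -[X in measurable X]setTI.
  exact: (measurable_coord j 0 measurableT).
apply/seteqP; split=> [v /= -> j _|v v0] /=; first by rewrite mxE.
by apply/colP => j; rewrite mxE; exact: v0.
Qed.

Let jump j (x : measurableTypeR R * 'cV[R]_d) := c (L x.1) x.2 j 0.

Let measurable_jump j t : t <= T ->
  measurable_fun (`]0, t] `*` @punctured R d) (jump j).
Proof.
move=> tT; have mp := measurable_punctured.
apply: (@eq_measurable_fun _ _ _ _ _ (fun x => c (Lr x.1) x.2 j 0)).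
  move=> x; rewrite inE => -[/=]; rewrite in_itv /= => /andP[s0 st] _.
  by rewrite LrE // (le_trans st).
apply: (measurableT_comp (measurable_coord j 0)).
apply: (@measurable_comp _ _ _ _ _ _ (setT `*` @punctured R d)
   (fun x => c x.1 x.2) _ (fun x => (Lr x.1, x.2))) => //.
- exact: measurableX.
- by move=> _ [x [_ x2] <-]; split.
- apply: measurable_funTS; apply/measurable_fun_pairP; split=> /=.
    exact: (measurableT_comp measurable_Lr measurable_fst).
  exact: measurable_snd.
Qed.

Let jump_increment j t t' : 0 <= t -> t <= t' -> t' <= T ->
  m (`]t, t'] `*` @punctured R d) = 0%E ->
  \int[m]_(x in `]0, t'] `*` @punctured R d) jump j x =
  \int[m]_(x in `]0, t] `*` @punctured R d) jump j x.
Proof.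
move=> t0 tt' t'T m0; have mp := measurable_punctured.
have mj := measurable_jump j t'T.
rewrite /Rintegral; congr fine.
have E : `]0, t'] `*` @punctured R d =
    (`]0, t] `*` @punctured R d) `|` (`]t, t'] `*` @punctured R d).
  apply/seteqP; split=> [[s z] [/=]|[s z] /= [] []]; rewrite ?in_itv /=.
  - move=> /andP[s0 st'] z0; have [st|ts] := leP s t; [left|right].
      by split=> //=; rewrite ?in_itv /= s0.
    by split=> //=; rewrite ?in_itv /= ts.
  - by move=> /andP[s0 st] z0; split=> //=; rewrite ?in_itv /= s0 (le_trans st).
  - by move=> /andP[ts st] z0; split=> //=; rewrite ?in_itv /= st (le_lt_trans t0).
have mE : measurable_fun (`]0, t] `*` @punctured R d `|` `]t, t'] `*` @punctured R d)
    (EFin \o jump j).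
  by rewrite -E; exact/measurable_EFinP.
have mA (u v : R) : measurable (`]u, v]%classic `*` @punctured R d : set (measurableTypeR R * _)).
  by apply: measurableX.
rewrite E integral_setU //.
- rewrite [X in (_ + X)%E]null_set_integral ?adde0 //.
  by move/(measurable_funU (EFin \o jump j) (mA 0 t) (mA t t')): mE => [].
- apply/disj_setPS => -[s z] [] [/=]; rewrite in_itv /= => /andP[_ st] _ [].
  by rewrite /= in_itv /= ltNge st.
Qed.

(** On subtracting the two integral equations the jump terms cancel, because the strip []t, t']] has
    no mass, and the drift over []t, t']] remains. There the left limits are bounded by [K], where
    [a] is at most [C]. *)
Lemma sde_increment_le (r : nat) (S : 'M[R]_(d, r)) (W : R -> 'cV[R]_r)
    (x0 : 'cV[R]_d) t t' j : 0 <= t -> t <= t' -> t' <= T ->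
  m (`]t, t'] `*` @punctured R d) = 0%E ->
  (forall t, 0 <= t -> forall j : 'I_d, Y t j 0 = x0 j 0
      + \int[lebesgue_measure]_(s in `[0, t]) (a (L s) j 0)
      + (S *m W t) j 0
      + \int[m]_(x in `]0, t] `*` @punctured R d) (c (L x.1) x.2 j 0)) ->
  `|(Y t' - Y t - S *m (W t' - W t)) j 0| <= C * (t' - t).
Proof.
move=> t0 tt' t'T m0 sde; have t'0 := le_trans t0 tt'.
apply: le_trans (drift_increment j t0 tt' t'T).
rewrite mulmxBr !mxE [Y t j 0]sde // [Y t' j 0]sde //.
rewrite -/(jump j) (jump_increment j t0 tt' t'T m0) !mxE.
by rewrite le_eqVlt; apply/orP; left; apply/eqP; congr `|_|; rewrite /drift; ring.
Qed.
End sde_path.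

(** * Truncated sums *)

Section euclidean_norm.
Variable R : realType.

Lemma enormE p (x : 'cV[R]_p) : enorm x = Num.sqrt (\sum_k x k 0 ^+ 2).
Proof.
rewrite /enorm /mxtrace; congr Num.sqrt; apply: eq_bigr => k _.
by rewrite mxE big_ord_recl big_ord0 addr0 !mxE -expr2.
Qed.

Lemma coord_le_enorm p (x : 'cV[R]_p) k : `|x k 0| <= enorm x.
Proof.
rewrite enormE -sqrtr_sqr ler_wsqrtr // (bigD1 k) //= lerDl sumr_ge0 // => i _.
exact: sqr_ge0.
Qed.

Lemma enorm_le_sum p (x : 'cV[R]_p) : enorm x <= \sum_k `|x k 0|.
Proof.
have S0 : 0 <= \sum_k `|x k 0| by apply: sumr_ge0.
rewrite enormE -[leRHS]ger0_norm // -sqrtr_sqr ler_wsqrtr //.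
rewrite expr2 mulr_suml ler_sum // => k _.
rewrite -(real_normK (num_real (x k 0))) expr2 ler_wpM2l //.
by rewrite (bigD1 k) //= lerDl sumr_ge0.
Qed.
End euclidean_norm.

(** * Deterministic estimates: increments [x], Gaussian parts [z], intervals with jumps [J],
    threshold [D * g] *)

Section truncated_sum.
Variables (R : realType) (p n : nat) (T D B c g Kv s : R) (Kj : nat).
Variables (x z : 'I_n -> 'cV[R]_p) (Sig : 'M[R]_p) (J : {pred 'I_n}).
Let h := T / n%:R.
Hypotheses (n_gt0 : (0 < n)%N) (T_gt0 : 0 < T) (D_gt0 : 0 < D) (B_ge0 : 0 <= B)
  (Kv_ge0 : 0 <= Kv) (g_gt0 : 0 < g).
Hypothesis c_le : p%:R * c <= D / 2.
Hypothesis c_leD : c <= D.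
Hypothesis c_ge0 : 0 <= c.
Hypothesis Sig_le : forall k l, `|Sig k l| <= s.
Hypothesis g_le : g ^+ 2 <= Num.sqrt h.
Hypothesis drift_small : p%:R * (B * h) <= D / 2 * g.
Hypothesis noJ : forall i, i \notin J -> forall k, `|x i k 0 - z i k 0| <= B * h.
Hypothesis z_le : forall i k, `|z i k 0| <= c * g.
Hypothesis J_le : (#|J| <= Kj)%N.
Hypothesis z_sum : forall k l,
  `|\sum_i (z i k 0 * z i l 0 / h - Sig k l)| <= Kv * Num.sqrt n%:R.

Let h_gt0 : 0 < h. Proof. by rewrite divr_gt0 // ltr0n. Qed.

(** The Gaussian part and the drift each use at most half of the threshold. *)
Lemma truncation_keeps i : i \notin J -> enorm (x i) <= D * g.
Proof.
move=> iJ; apply: (le_trans (enorm_le_sum _)).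
apply: (@le_trans _ _ (\sum_(k < p) (c * g + B * h))).
  apply: ler_sum => k _; have := noJ iJ k; have := z_le i k.
  by have := ler_normD (x i k 0 - z i k 0) (z i k 0); rewrite subrK; lra.
rewrite sumr_const card_ord -[leLHS]mulr_natl mulrDr mulrA.
have : p%:R * c * g <= D / 2 * g by rewrite ler_wpM2r // ltW.
by have := drift_small; lra.
Qed.

Lemma truncation_card :
  n%:R - Kj%:R <= (\sum_(i | enorm (x i) <= D * g) 1 : R).
Proof.
rewrite lerBlDr (@le_trans _ _ (\sum_(i | enorm (x i) <= D * g) 1 + #|J|%:R)) //; last first.
  by rewrite lerD2l ler_nat.
rewrite !sumr_const -natrD ler_nat -[n in (n <= _)%N]card_ord.
rewrite -(cardC (mem J)) addnC leq_add2r; apply: subset_leq_card.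
by apply/fintype.subsetP => i; rewrite !inE; exact: truncation_keeps.
Qed.

Let sqrt_hn : Num.sqrt h * n%:R = Num.sqrt T * Num.sqrt n%:R.
Proof.
rewrite -[n%:R in LHS]sqr_sqrtr ?ler0n // expr2 mulrA; congr (_ * _).
by rewrite -sqrtrM ?(ltW h_gt0) // /h divfK // pnatr_eq0 -lt0n.
Qed.

(** The right-hand side is [1 / sqrt h]. This is the largest order that the normalized product of
    two increments within the threshold can reach. *)
Let g2h : g ^+ 2 / h <= Num.sqrt n%:R / Num.sqrt T.
Proof.
rewrite ler_pdivrMr // (le_trans g_le) //.
have sT : 0 < Num.sqrt T by rewrite sqrtr_gt0.
rewrite mulrAC ler_pdivlMr // mulrC.
have -> : Num.sqrt T = Num.sqrt h * Num.sqrt n%:R.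
  by rewrite -sqrtrM ?(ltW h_gt0) // /h divfK // pnatr_eq0 -lt0n.
rewrite mulrAC -expr2 sqr_sqrtr ?(ltW h_gt0) // mulrC.
by [].
Qed.

(** These sums are the cross terms of drift and Gaussian part. Each [|z|] is of order [sqrt h], and
    [n sqrt h = sqrt T sqrt n]. *)
Let sum_abs_z k : \sum_i `|z i k 0| <=
  Num.sqrt T / 2 * (1 + s + Kv) * Num.sqrt n%:R.
Proof.
have sh : 0 < Num.sqrt h by rewrite sqrtr_gt0.
have n1 : 1 <= n%:R :> R by rewrite ler1n.
have sn : Num.sqrt n%:R <= n%:R :> R.
  rewrite -[leRHS]sqr_sqrtr ?ler0n // expr2 ler_peMl ?sqrtr_ge0 //.
  by rewrite -[leLHS]sqrtr1 ler_wsqrtr.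
apply: (@le_trans _ _ (\sum_i (Num.sqrt h / 2 * (1 + s + (z i k 0 * z i k 0 / h - Sig k k))))).
  apply: ler_sum => i _.
  have Sk : Sig k k <= s by apply: le_trans (Sig_le k k); exact: ler_norm.
  (* AM-GM: [|z| <= (sqrt h / 2) (1 + z^2 / h)] *)
  apply: (@le_trans _ _ (Num.sqrt h / 2 * (1 + z i k 0 * z i k 0 / h))); last first.
    by rewrite ler_pM2l ?divr_gt0 //; lra.
  have -> : Num.sqrt h / 2 * (1 + z i k 0 * z i k 0 / h) =
      (Num.sqrt h ^+ 2 + `|z i k 0| ^+ 2) / (2 * Num.sqrt h).
    have -> : z i k 0 * z i k 0 / h = z i k 0 ^+ 2 / Num.sqrt h ^+ 2.
      by rewrite sqr_sqrtr ?(ltW h_gt0) // expr2.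
    by rewrite real_normK ?num_real //; field; rewrite gt_eqF.
  rewrite ler_pdivlMr ?mulr_gt0 //.
  by have := sqr_ge0 (Num.sqrt h - `|z i k 0|); lra.
rewrite -mulr_sumr big_split /= sumr_const card_ord -[X in X + _]mulr_natr.
have := z_sum k k; rewrite ler_norml => /andP[_ zk].
have s0 : 0 <= s by apply: le_trans (Sig_le k k).
rewrite (@le_trans _ _ (Num.sqrt h / 2 * ((1 + s + Kv) * n%:R))) //.
  rewrite ler_wpM2l ?divr_ge0 ?sqrtr_ge0 // [leRHS]mulrDl lerD2l (le_trans zk) //.
  by rewrite ler_wpM2l.
rewrite le_eqVlt; apply/orP; left; apply/eqP.
transitivity (Num.sqrt h * n%:R / 2 * (1 + s + Kv)); first by field.
by rewrite sqrt_hn; field.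
Qed.

(** The sum is compared with the untruncated Gaussian one, which contributes [Kv]. Outside [J] the
    error [e i] consists of two cross terms and a squared drift, whence the second and third
    summands. On [J], whether or not the increment is kept, it is at most [jb], of order [sqrt n],
    and there are at most [Kj] such indices. *)
Lemma truncated_sum_le k l :
  `|\sum_(i | enorm (x i) <= D * g) (x i k 0 * x i l 0 / h - Sig k l)| <=
  (Kv + B * Num.sqrt T * (1 + s + Kv) + B ^+ 2 * T
    + 2 * Kj%:R * (D ^+ 2 / Num.sqrt T + s)) * Num.sqrt n%:R.
Proof.
have s0 : 0 <= s by apply: le_trans (Sig_le k l).
have sn1 : 1 <= Num.sqrt n%:R :> R by rewrite -[leLHS]sqrtr1 ler_wsqrtr // ler1n.
pose e i := (if enorm (x i) <= D * g then x i k 0 * x i l 0 / h - Sig k l else 0)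
   - (z i k 0 * z i l 0 / h - Sig k l).
have -> : \sum_(i | enorm (x i) <= D * g) (x i k 0 * x i l 0 / h - Sig k l) =
    \sum_i (z i k 0 * z i l 0 / h - Sig k l) + \sum_i e i.
  rewrite -big_split /= big_mkcond; apply: eq_bigr => i _.
  by rewrite /e addrC subrK.
apply: (le_trans (ler_normD _ _)).
pose jb := 2 * (D ^+ 2 * (g ^+ 2 / h) + s).
have jb0 : 0 <= jb.
  by rewrite mulr_ge0 // addr_ge0 // mulr_ge0 ?sqr_ge0 // divr_ge0 ?sqr_ge0 // ltW.
have eb i : `|e i| <= B * `|z i l 0| + B * `|z i k 0| + B ^+ 2 * h + (if i \in J then jb else 0).
  have Bz0 : 0 <= B * `|z i l 0| + B * `|z i k 0| + B ^+ 2 * h.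
    by rewrite !addr_ge0 ?mulr_ge0 ?sqr_ge0 // ltW.
  case: ifPn => iJ; last first.
    rewrite addr0 /e truncation_keeps //.
    have := noJ iJ k; have := noJ iJ l.
    set bl := x i l 0 - z i l 0; set bk := x i k 0 - z i k 0 => hl hk.
    have -> : x i k 0 * x i l 0 / h - Sig k l - (z i k 0 * z i l 0 / h - Sig k l) =
        bk / h * z i l 0 + bl / h * z i k 0 + bk / h * bl.
      by rewrite /bk /bl; field; rewrite gt_eqF.
    have hk' : `|bk / h| <= B by rewrite normrM [`|h^-1|]gtr0_norm ?invr_gt0 // ler_pdivrMr.
    have hl' : `|bl / h| <= B by rewrite normrM [`|h^-1|]gtr0_norm ?invr_gt0 // ler_pdivrMr.
    apply: (le_trans (ler_normD _ _)); apply: lerD.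
      apply: (le_trans (ler_normD _ _)); apply: lerD; rewrite normrM.
        by rewrite ler_wpM2r.
      by rewrite ler_wpM2r.
    by rewrite normrM expr2 -mulrA ler_pM.
  apply: ler_wpDl => //.
  have g2 : 0 <= g ^+ 2 / h by rewrite divr_ge0 ?sqr_ge0 // ltW.
  have prod_le (u v b : R) : `|u| <= b * g -> `|v| <= b * g -> 0 <= b -> b <= D ->
      `|u * v / h| <= D ^+ 2 * (g ^+ 2 / h).
    move=> hu hv b0 bD; rewrite normrM [`|h^-1|]gtr0_norm ?invr_gt0 // mulrA.
    rewrite ler_wpM2r ?invr_ge0 ?(ltW h_gt0) // normrM -exprMn expr2.
    have bDg : b * g <= D * g by rewrite ler_wpM2r // ltW.
    by rewrite ler_pM // (le_trans _ bDg).
  have h1 := prod_le _ _ _ (z_le i k) (z_le i l) c_ge0 c_leD.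
  have h2 := Sig_le k l.
  rewrite /e /jb; case: ifPn => xD; last first.
    rewrite sub0r normrN; have := ler_normB (z i k 0 * z i l 0 / h) (Sig k l).
    have : 0 <= D ^+ 2 * (g ^+ 2 / h) by rewrite mulr_ge0 ?sqr_ge0.
    by lra.
  have h3 := prod_le _ _ _ (le_trans (coord_le_enorm (x i) k) xD)
    (le_trans (coord_le_enorm (x i) l) xD) (ltW D_gt0) (lexx D).
  have -> : x i k 0 * x i l 0 / h - Sig k l - (z i k 0 * z i l 0 / h - Sig k l) =
    x i k 0 * x i l 0 / h - z i k 0 * z i l 0 / h by ring.
  have := ler_normB (x i k 0 * x i l 0 / h) (z i k 0 * z i l 0 / h).
  by lra.
have esum : `|\sum_i e i| <= B * (Num.sqrt T / 2 * (1 + s + Kv) * Num.sqrt n%:R) +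
    B * (Num.sqrt T / 2 * (1 + s + Kv) * Num.sqrt n%:R) + B ^+ 2 * T + Kj%:R * jb.
  apply: (le_trans (ler_norm_sum _ _ _)).
  apply: (le_trans (ler_sum _ (fun i _ => eb i))).
  rewrite !big_split /= -!mulr_sumr; apply: lerD; last first.
    rewrite -big_mkcond /= sumr_const -[leLHS]mulr_natl ler_wpM2r // ler_nat //.
  apply: lerD; last first.
    rewrite sumr_const card_ord -[n%:R^-1 *+ n]mulr_natr mulVf ?mulr1 //.
    by rewrite pnatr_eq0 -lt0n.
  by apply: lerD; rewrite ler_wpM2l // sum_abs_z.
have g2h' : D ^+ 2 * (g ^+ 2 / h) <= D ^+ 2 / Num.sqrt T * Num.sqrt n%:R.
  by rewrite -mulrA ler_wpM2l ?sqr_ge0 // [leRHS]mulrC; exact: g2h.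
have jbl : jb <= 2 * (D ^+ 2 / Num.sqrt T + s) * Num.sqrt n%:R.
  have : s <= s * Num.sqrt n%:R by rewrite ler_peMr.
  by rewrite /jb; lra.
have jbl' : Kj%:R * jb <= Kj%:R * (2 * (D ^+ 2 / Num.sqrt T + s) * Num.sqrt n%:R).
  by rewrite ler_wpM2l.
have BT : B ^+ 2 * T <= B ^+ 2 * T * Num.sqrt n%:R.
  by rewrite ler_peMr // mulr_ge0 ?sqr_ge0 // ltW.
have := z_sum k l.
by lra.
Qed.
End truncated_sum.

(** * Noise increments *)

Section poisson_jumps.
Context (R : realType) disp (Omega : measurableType disp) (P : probability Omega R).
Variables (Fil : R -> set (set Omega)) (d : nat) (mu : random_measure R Omega d).
Variables (F f : 'cV[R]_d -> R) (lambda : R).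
Hypotheses (lambda_gt0 : 0 < lambda) (F_density : is_density (@punctured R d) F)
  (f_def : forall z, f z = lambda * F z)
  (mu_poisson : is_poisson_random_measure P Fil mu f).

Definition jump_block (u v : R) : set (measurableTypeR R * 'cV[R]_d) :=
  `]u, v]%classic `*` @punctured R d.

Lemma measurable_jump_block u v : measurable (jump_block u v).
Proof. by apply: measurableX => //; exact: measurable_punctured. Qed.

(** By Tonelli, since [F] integrates to 1: [lambda] is the finite total rate of jumps of all
    sizes. *)
Lemma jump_intensity_block u v : 0 <= u -> u <= v ->
  jump_intensity f (jump_block u v) = (lambda * (v - u))%:E.
Proof.
move=> u0 uv; have mp := @measurable_punctured R d.
have [mF F0 F1] := F_density.
have -> : jump_intensity f (jump_block u v) =
    (\int[lebesgue_measure \x lebesgue_cV R d]_x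
      ((\1_(`]u, v]%classic) x.1)%:E * ((EFin \o f) \_ (@punctured R d)) x.2))%E.
  rewrite /jump_intensity (_ : _ `&` _ = jump_block u v).
    rewrite integral_mkcond; apply: eq_integral => -[s z] _.
    rewrite !patchE /jump_block indicE /=.
    have -> : ((s, z) \in (`]u, v]%classic `*` @punctured R d)) =
        (s \in `]u, v]%classic) && (z \in @punctured R d).
      by apply/idP/andP; rewrite !inE => -[].
    by case: (s \in _) => /=; case: (z \in _); rewrite ?mul1e ?mul0e ?mule0.
  apply/seteqP; split=> [x []//|[s z] /= [su sz]]; split=> //; split=> //=.
  by move: su; rewrite /= !in_itv /= andbT => /andP[us _]; rewrite (le_trans u0) // ltW.
have f0 z : @punctured R d z -> 0 <= f z.
  by move=> z0; rewrite f_def mulr_ge0 ?F0 // ltW.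
have mf : measurable_fun (@punctured R d) f.
  rewrite (_ : f = fun z => lambda * F z); last exact/funext.
  exact: measurable_funM.
have fr0 z : (0 <= ((EFin \o f) \_ (@punctured R d)) z)%E.
  by apply: erestrict_ge0 => y y0; rewrite lee_fin f0.
have mfr : measurable_fun setT ((EFin \o f) \_ (@punctured R d)).
  by apply/(measurable_restrict _ _ _).1 => //; rewrite setTI; exact/measurable_EFinP.
have intf : (\int[lebesgue_cV R d]_z ((EFin \o f) \_ (@punctured R d)) z = lambda%:E)%E.
  rewrite -integral_mkcond.
  under eq_integral do rewrite /= f_def EFinM.
  rewrite ge0_integralZl //=.
  - by rewrite F1 mule1.
  - exact/measurable_EFinP.
  - exact: ltW.
rewrite fubini_tonelli1; last 2 first.
- apply: emeasurable_funM.
    apply/measurable_EFinP; apply: measurableT_comp => //.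
  exact: (measurableT_comp mfr measurable_snd).
- by move=> x; rewrite mule_ge0 // lee_fin indicE.
transitivity (\int[lebesgue_measure]_x ((\1_(`]u, v]%classic) x)%:E * lambda%:E))%E.
  apply: eq_integral => x _; rewrite /fubini_F /= ge0_integralZl //= ?intf //.
rewrite ge0_integralZr //=; last 2 first.
- exact/measurable_EFinP/measurable_indic.
- by rewrite ?lee_fin ltW.
rewrite integral_indic //= setIT lebesgue_measure_itv /= lte_fin.
case: ltrP => [_|vu]; first by rewrite -EFinM mulrC.
by rewrite (_ : v = u) ?subrr ?mulr0 ?mul0e //; apply/le_anti; rewrite uv vu.
Qed.

Lemma measurable_jump_event u v :
  measurable [set w | mu w (jump_block u v) != 0%E].
Proof.
have [mmu _ _ _] := mu_poisson.
have := mmu _ (measurable_jump_block u v) measurableT (~` [set 0%E]).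
rewrite setTI => H; have := H (measurableC (emeasurable_set1 _)).
congr measurable; apply/seteqP; split=> w /=; first by move/eqP.
by move/eqP.
Qed.

(** A jump occurs with probability [1 - exp (- x)], which is at most [x = lambda (v - u)]. *)
Lemma jump_probability u v : 0 <= u -> u <= v ->
  (P [set w | mu w (jump_block u v) != 0%E] <= (lambda * (v - u))%:E)%E.
Proof.
move=> u0 uv; have [_ pmu _ _] := mu_poisson.
have lE := jump_intensity_block u0 uv.
have := pmu _ (measurable_jump_block u v); rewrite lE => /(_ (ltry _) 0%N) /=.
rewrite expr0 fact0 divr1 mul1r => p0.
have -> : [set w | mu w (jump_block u v) != 0%E] =
    ~` [set w | mu w (jump_block u v) = 0%:R%:E].
  by apply/seteqP; split=> w /= /eqP.
rewrite probability_setC; last first.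
  rewrite -[X in measurable X]setCK; apply: measurableC.
  have := measurable_jump_event u v; congr measurable.
  by apply/seteqP; split=> w /= /eqP.
rewrite p0 -EFinB lee_fin.
by have := expR_ge1Dx (- (lambda * (v - u))); lra.
Qed.
End poisson_jumps.

(** * Scalar increments of several Wiener processes *)

Section wiener_increments.
Context (R : realType) disp (Omega : measurableType disp) (P : probability Omega R).
Variables (Fil : R -> set (set Omega)) (Fil_filtration : is_filtration Fil).
Variables (I : finType) (r : I -> nat) (W : forall i, R -> Omega -> 'cV[R]_(r i)).
Hypothesis W_wiener : forall i, is_wiener P Fil (W i).
Hypothesis W_indep : forall t i i', 0 <= t -> i != i' -> forall G A B, Fil t G ->
  increments_after (W i) t A -> increments_after (W i') t B ->
  P (G `&` (A `&` B)) = (P G * (P A * P B))%E.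

(** The pair [e] of a process and one of its coordinates merges all Wiener processes into one finite
    family of scalar noises, whose limiting covariation is the identity. *)
Definition increment_coord (s t : R) (e : {i : I & 'I_(r i)}) (w : Omega) : R :=
  (W (tag e) t w - W (tag e) s w) (tagged e) 0.

Lemma adapted_coord dim (Y : R -> Omega -> 'cV[R]_dim) (s t : R) j :
  adapted Fil Y -> 0 <= s -> s <= t ->
  measurable_fun setT ((fun w => Y s w j 0) : g_sigma_algebraType (Fil t) -> R).
Proof.
move=> adY s0 st _ B mB; rewrite setTI.
apply: sub_sigma_algebra; have [_ mono] := Fil_filtration.
apply: (mono s t s0 st).
apply: (adY s s0 ((fun v : 'cV[R]_dim => v j 0) @^-1` B)).
by have := @measurable_coord R dim 1 j 0 measurableT B mB; rewrite setTI.
Qed.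

Lemma adapted_coord_measurable dim (Y : R -> Omega -> 'cV[R]_dim) (s : R) j :
  adapted Fil Y -> 0 <= s -> measurable_fun setT (fun w => Y s w j 0).
Proof.
move=> adY s0 _ B mB; rewrite setTI.
have [mF _] := Fil_filtration; apply: (mF s s0).2.
apply: (adY s s0 ((fun v : 'cV[R]_dim => v j 0) @^-1` B)).
by have := @measurable_coord R dim 1 j 0 measurableT B mB; rewrite setTI.
Qed.

Lemma increment_coord_adapted s t u e : 0 <= s -> 0 <= t -> s <= u -> t <= u ->
  measurable_fun setT (increment_coord s t e : g_sigma_algebraType (Fil u) -> R).
Proof.
move=> s0 t0 su tu; have [adW _ _ _] := W_wiener (tag e).
rewrite (_ : increment_coord s t e =
  fun w => W (tag e) t w (tagged e) 0 - W (tag e) s w (tagged e) 0); last first.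
  by apply/funext => w; rewrite /increment_coord !mxE.
by apply: measurable_funB; exact: adapted_coord.
Qed.

Lemma increment_coord_measurable s t e : 0 <= s -> 0 <= t ->
  measurable_fun setT (increment_coord s t e).
Proof.
move=> s0 t0; have [adW _ _ _] := W_wiener (tag e).
rewrite (_ : increment_coord s t e =
  fun w => W (tag e) t w (tagged e) 0 - W (tag e) s w (tagged e) 0); last first.
  by apply/funext => w; rewrite /increment_coord !mxE.
by apply: measurable_funB; exact: adapted_coord_measurable.
Qed.

Variables (s t : R).
Hypotheses (s_ge0 : 0 <= s) (st : s < t).
Local Notation N := (normal_prob (0 : R) (Num.sqrt (t - s))).

Let NT : N setT = 1%E. Proof. exact: probability_setT. Qed.

Lemma increment_coord_law e G B : Fil s G -> measurable B ->
  P (G `&` increment_coord s t e @^-1` B) = (P G * N B)%E.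
Proof.
case: e => i j FG mB; have [_ _ _ lawW] := W_wiener i.
have := lawW s t s_ge0 st G (fun k => if k == j then B else setT) FG.
rewrite (bigD1 j) //= eqxx big1 ?mule1; last by move=> k /negbTE ->.
move=> <-; last by move=> k; case: ifP.
congr (P (_ `&` _)); apply/seteqP; split => w /=.
  by move=> Bw k; case: eqP => [->|].
by move=> /(_ j); rewrite eqxx.
Qed.

(** Two coordinates of one process factor by its Gaussian law, two coordinates of different
    processes by the joint independence of both processes and the past. *)
Lemma increment_coord_pair_law e e' G A B : e != e' -> Fil s G ->
  measurable A -> measurable B ->
  P (G `&` (increment_coord s t e @^-1` A `&` increment_coord s t e' @^-1` B)) =
  (P G * (N A * N B))%E.
Proof.
have [sF _] := Fil_filtration.
have FT : Fil s setT.
  have [[F0 FC _] _] := sF s s_ge0; have := FC _ F0.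
  by rewrite setD0.
move=> ee' FG mA mB.
have [ii'|ii'] := eqVneq (tag e) (tag e'); last first.
  have lA := increment_coord_law e FT mA; have lB := increment_coord_law e' FT mB.
  rewrite setTI probability_setT mul1e in lA; rewrite setTI probability_setT mul1e in lB.
  rewrite -lA -lB.
  have inc (x : {i : I & 'I_(r i)}) C : measurable C ->
      increments_after (W (tag x)) s (increment_coord s t x @^-1` C).
    move=> mC; apply: sub_sigma_algebra.
    exists t, ((fun v : 'cV[R]_(r (tag x)) => v (tagged x) 0) @^-1` C); split=> //.
      exact: ltW.
    by have := @measurable_coord R _ 1 (tagged x) 0 measurableT C mC; rewrite setTI.
  by apply: (W_indep s_ge0 ii') => //; exact: inc.
case: e e' ii' ee' => [i j] [i' j'] /= ii'; case: i' / ii' j' => j'.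
rewrite -tag_eqE /tag_eq eqxx /= tagged_asE => jj'.
have [_ _ _ lawW] := W_wiener i.
have := lawW s t s_ge0 st G
  (fun k => if k == j then A else if k == j' then B else setT) FG.
rewrite (bigD1 j) //= eqxx (bigD1 j') /=; last by rewrite eq_sym.
rewrite eq_sym (negbTE jj') eqxx big1 ?mule1; last first.
  by move=> k /andP[/negbTE -> /negbTE ->].
move=> <-; last by move=> k; case: ifP => // _; case: ifP.
congr (P (_ `&` _)); apply/seteqP; split => w /=.
  by move=> [Aw Bw] k; case: eqP => [->//|_]; case: eqP => [->|].
move=> H; split; first by have := H j; rewrite eqxx.
by have := H j'; rewrite eq_sym (negbTE jj') eqxx.
Qed.

Lemma increment_noise e e' : centered_noise P (Fil s) 60
  (fun w => increment_coord s t e w * increment_coord s t e' w / (t - s)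
     - (e == e')%:R).
Proof.
have [sF _] := Fil_filtration; have [saF Fm] := sF s s_ge0.
have FT : Fil s setT.
  by case: saF => F0 FC _; have := FC _ F0; rewrite setD0.
have t0 : 0 <= t by rewrite ltW // (le_lt_trans s_ge0).
have sq_gt0 : 0 < Num.sqrt (t - s) by rewrite sqrtr_gt0 subr_gt0.
have sqE : Num.sqrt (t - s) ^+ 2 = t - s by rewrite sqr_sqrtr // subr_ge0 ltW.
have me x := increment_coord_measurable x s_ge0 t0.
have [<-|ee'] := eqVneq e e'.
  rewrite (_ : (fun w => _) = fun w => increment_coord s t e w * increment_coord s t e w
    / Num.sqrt (t - s) ^+ 2 - 1); last by apply/funext => w; rewrite sqE.
  apply: gaussian_square_noise => //.
  exact: increment_coord_law.
rewrite (_ : (fun w => _) = fun w => increment_coord s t e w * increment_coord s t e' w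
    / Num.sqrt (t - s) ^+ 2); last by apply/funext => w; rewrite subr0 sqE.
apply: gaussian_product_noise => //.
by move=> G A B; exact: increment_coord_pair_law.
Qed.

Lemma increment_tail e (l : R) (k : nat) : 0 < l ->
  (P [set w | (l <= `|increment_coord s t e w|)%R] <=
     (2 * (k.+1)`!%:R * (8 * (t - s) / (3 * l ^+ 2)) ^+ k.+1)%R%:E)%E.
Proof.
move=> l0; have [sF _] := Fil_filtration; have [saF Fm] := sF s s_ge0.
have FT : Fil s setT.
  by case: saF => F0 FC _; have := FC _ F0; rewrite setD0.
have t0 : 0 <= t by rewrite ltW // (le_lt_trans s_ge0).
have sq_gt0 : 0 < Num.sqrt (t - s) by rewrite sqrtr_gt0 subr_gt0.
have sqE : Num.sqrt (t - s) ^+ 2 = t - s by rewrite sqr_sqrtr // subr_ge0 ltW.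
rewrite -sqE; apply: normal_tail => //; first exact: increment_coord_measurable.
move=> B mB; have := increment_coord_law e FT mB.
by rewrite setTI probability_setT mul1e.
Qed.

End wiener_increments.

(** * Tightness of the truncated covariation *)

Lemma sum_latent (V : zmodType) (F : 'I_4 -> V) :
  \sum_a F a = F ixi + F idelta + F ieps + F izeta.
Proof.
rewrite !big_ord_recl big_ord0 addr0 !addrA.
by congr (F _ + F _ + F _ + F _); apply/val_inj.
Qed.

Section reduced_form.
Variables (R : realType) (k1 k2 p1 p2 : nat) (r : 'I_4 -> nat).
Implicit Type s : sem_param R k1 p1 p2 k2 r.

(* Coefficients of the latent processes in the observed one, once the structural
   equation is solved for eta. *)
Definition load s (a : 'I_4) : 'M[R]_(p1 + p2, ldim k1 p1 p2 k2 a) :=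
  match a with Ordinal i _ =>
    match i return 'M[R]_(p1 + p2, nth 0%N [:: k1; p1; p2; k2] i) with
    | 0 => col_mx (Lambda1 s) (Lambda2 s *m (invmx (Psi s) *m Gamma s))
    | 1 => col_mx 1%:M 0
    | 2 => col_mx 0 1%:M
    | 3 => col_mx 0 (Lambda2 s *m invmx (Psi s))
    | _ => 0
    end
  end.

Lemma observed_load s (Omega : Type)
    (Y : forall i : 'I_4, R -> Omega -> 'cV[R]_(ldim k1 p1 p2 k2 i))
    (eta : R -> Omega -> 'cV[R]_k2) t w :
  sem_regular s -> structural_equation s Y eta -> 0 <= t ->
  observed s Y eta t w = \sum_a load s a *m Y a t w.
Proof.
move=> [_ _ _ uPsi] etaE t0.
have -> : observed s Y eta t w = col_mx (Lambda1 s *m Y ixi t w + Y idelta t w)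
    (Lambda2 s *m (invmx (Psi s) *m (Gamma s *m Y ixi t w + Y izeta t w)) + Y ieps t w).
  rewrite /observed; congr (col_mx _ (_ *m _ + _)).
  have -> : Gamma s *m Y ixi t w + Y izeta t w = Psi s *m eta t w.
    apply/esym/eqP; rewrite /Psi mulmxBl mul1mx subr_eq.
    by rewrite {1}(etaE t w t0) -addrA addrC.
  by rewrite mulKmx.
rewrite sum_latent /= !mul_col_mx !mul0mx !mul1mx !add_col_mx !addr0.
by rewrite !mulmxDr !mulmxA addrAC.
Qed.

(** Each noise contributes one outer product, the form in which the limit of the covariation of the
    increments appears. *)
Lemma Sigma_load s :
  Sigma s = \sum_a (load s a *m Vol s a) *m (load s a *m Vol s a)^T.
Proof.
have outer d e (A : 'M[R]_(p1, d)) (B : 'M[R]_(p2, d)) (V : 'M[R]_(d, e)) :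
    (col_mx A B *m V) *m (col_mx A B *m V)^T = block_mx
      (A *m V *m (A *m V)^T) (A *m V *m (B *m V)^T)
      (B *m V *m (A *m V)^T) (B *m V *m (B *m V)^T).
  by rewrite mul_col_mx tr_col_mx mul_col_row.
rewrite sum_latent /= !outer !mul0mx !mul1mx !trmx0.
rewrite ?mul0mx ?mulmx0 !add_block_mx !addr0 ?add0r /Sigma; congr block_mx.
- by rewrite /Sigma11 /Sigma_xixi /Sigma_deltadelta trmx_mul !mulmxA.
- by rewrite /Sigma12 /Sigma_xixi !trmx_mul !mulmxA.
- by rewrite /Sigma12 /Sigma_xixi !trmx_mul !trmxK !mulmxA.
- rewrite /Sigma22 /Sigma_xixi /Sigma_epseps /Sigma_zetazeta.
  by rewrite !(trmx_mul, mulmxDr, mulmxDl, mulmxA) addrAC.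
Qed.

End reduced_form.

Section mesh.
Variables (R : realType) (rho : R).

Lemma near_mesh_le (T e : R) : 0 < e -> \forall n \near \oo, T / n%:R <= e.
Proof.
move=> e0; near=> n.
have n0 : 0 < n%:R :> R by near: n; exact: nbhs_infty_gtr.
rewrite ler_pdivrMr // mulrC -ler_pdivrMr //.
by near: n; exact: nbhs_infty_ger.
Unshelve. all: by end_near. Qed.

Lemma near_lt_ln (C : R) : \forall n \near \oo, C < ln n%:R.
Proof.
near=> n; have n0 : 0 < n%:R :> R by near: n; exact: nbhs_infty_gtr.
rewrite -ltr_expR lnK ?posrE //.
by near: n; exact: nbhs_infty_gtr.
Unshelve. all: by end_near. Qed.

Lemma near_div_sqrt_le (C e : R) : 0 < e -> \forall n \near \oo, C / Num.sqrt n%:R <= e.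
Proof.
move=> e0; near=> n; have n0 : 0 < n%:R :> R by near: n; exact: nbhs_infty_gtr.
rewrite ler_pdivrMr ?sqrtr_gt0 // mulrC -ler_pdivrMr //.
rewrite (le_trans (ler_norm _)) // -sqrtr_sqr ler_wsqrtr //.
by near: n; exact: nbhs_infty_ger.
Unshelve. all: by end_near. Qed.

Lemma powR_sqr_le_sqrt (h : R) : 1 / 3 <= rho -> 0 < h -> h <= 1 ->
  (h `^ rho) ^+ 2 <= Num.sqrt h.
Proof.
move=> rho3 h0 h1; rewrite -powR_mulrn ?powR_ge0 // -powRrM -powR12_sqrt ?(ltW h0) //.
by apply: ger_powR; [rewrite h0|lra].
Qed.

Lemma le_sqrt_mul_powR (h : R) : rho < 1 / 2 -> 0 < h -> h <= 1 ->
  h <= Num.sqrt h * h `^ rho.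
Proof.
move=> rho2 h0 h1; rewrite -{1}(sqr_sqrtr (ltW h0)) expr2 ler_wpM2l ?sqrtr_ge0 //.
rewrite -powR12_sqrt ?(ltW h0) //.
by apply: ger_powR; [rewrite h0|lra].
Qed.

(** The ratio is [h^(1 - 2 rho)] with a positive exponent, so [k.+1 >= 2 / (1 - 2 rho)] suffices.
    Order [h^2] is asked for because it outweighs a union bound over [T / h] increments. *)
Lemma powR_ratio_small : rho < 1 / 2 -> exists k : nat, forall h : R, 0 < h -> h <= 1 ->
  (h / (h `^ rho) ^+ 2) ^+ k.+1 <= h ^+ 2.
Proof.
move=> rho2; have r0 : 0 < 1 - 2 * rho by lra.
exists (Num.bound (2 / (1 - 2 * rho))) => h h0 h1.
set k := Num.bound _.
have kP : 2 <= (1 - 2 * rho) * k.+1%:R.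
  rewrite mulrC -ler_pdivrMr // ltW // (lt_le_trans (archi_boundP _)) ?ler_nat //.
  by rewrite divr_ge0 // ltW.
have -> : h / (h `^ rho) ^+ 2 = h `^ (1 - 2 * rho).
  rewrite powRB; last by apply/implyP => _; rewrite gt_eqF.
  rewrite powRr1 ?(ltW h0) //; congr (_ / _).
  by rewrite mulrC powRrM powR_mulrn // powR_ge0.
rewrite -powR_mulrn ?powR_ge0 // -powRrM -[h ^+ 2]powR_mulrn ?(ltW h0) //.
by apply: ger_powR; rewrite ?h0.
Qed.
End mesh.

Section quadratic_covariation.
Variables (R : realType) (p n : nat) (E : finType) (G : 'I_p -> E -> R).
Variables (w : 'I_n -> E -> R) (h K gam : R).
Hypothesis G_le : forall k e, `|G k e| <= gam.

Lemma linear_comb_le i k (m : R) : (forall e, `|w i e| <= m) ->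
  `|\sum_e G k e * w i e| <= gam * #|E|%:R * m.
Proof.
move=> wm; apply: (le_trans (ler_norm_sum _ _ _)).
apply: (@le_trans _ _ (\sum_(e : E) gam * m)).
  by apply: ler_sum => e _; rewrite normrM ler_pM.
by rewrite sumr_const -[leLHS]mulr_natr mulrAC.
Qed.

(** Bilinear expansion over pairs of noises; the Kronecker deltas sum to the product of the rows of
    [G]. *)
Lemma covariation_le k l :
  (forall e e', `|\sum_i (w i e * w i e' / h - (e == e')%:R)| <= K) ->
  `|\sum_i ((\sum_e G k e * w i e) * (\sum_e G l e * w i e) / h
     - \sum_e G k e * G l e)| <= gam ^+ 2 * #|E|%:R ^+ 2 * K.
Proof.
move=> wK.
have -> : \sum_i ((\sum_e G k e * w i e) * (\sum_e G l e * w i e) / h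
     - \sum_e G k e * G l e) =
   \sum_e \sum_e' G k e * G l e' * \sum_i (w i e * w i e' / h - (e == e')%:R).
  transitivity (\sum_i \sum_e \sum_e' G k e * G l e' * (w i e * w i e' / h - (e == e')%:R)).
    apply: eq_bigr => i _; rewrite mulr_suml mulr_suml -sumrB; apply: eq_bigr => e _.
    have -> : G k e * G l e = \sum_e' G k e * G l e' * (e == e')%:R.
      rewrite (bigD1 e) //= eqxx mulr1 big1 ?addr0 // => e' /negbTE.
      by rewrite eq_sym => ->; rewrite mulr0.
    rewrite mulr_sumr mulr_suml -sumrB; apply: eq_bigr => e' _.
    by ring.
  rewrite exchange_big /=; apply: eq_bigr => e _.
  rewrite exchange_big /=; apply: eq_bigr => e' _.
  by rewrite mulr_sumr.
apply: (le_trans (ler_norm_sum _ _ _)).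
apply: (@le_trans _ _ (\sum_(e : E) \sum_(e' : E) gam * gam * K)).
  apply: ler_sum => e _; apply: (le_trans (ler_norm_sum _ _ _)).
  apply: ler_sum => e' _; rewrite !normrM ler_pM ?mulr_ge0 //.
  by rewrite ler_pM.
rewrite !sumr_const -mulrnA -[leLHS]mulr_natr natrM -!expr2.
by rewrite le_eqVlt; apply/orP; left; apply/eqP; ring.
Qed.
End quadratic_covariation.

Section union_bounds.
Context d (T : measurableType d) (R : realType).

Lemma measure_bigsetU_le (P : {measure set T -> \bar R}) (I : Type) (s : seq I)
    (A : I -> set T) : (forall i, measurable (A i)) ->
  (P (\big[setU/set0]_(i <- s) A i) <= \sum_(i <- s) P (A i))%E.
Proof.
move=> mA; elim: s => [|i s IH]; first by rewrite !big_nil measure0.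
rewrite !big_cons; apply: (le_trans (measureU2 _ _ _)) => //.
  exact: bigsetU_measurable.
exact: leeD2l.
Qed.

Lemma measure_bigsetU_const_le (P : {measure set T -> \bar R}) (I : finType)
    (A : I -> set T) (c : R) : (forall i, measurable (A i)) ->
  (forall i, P (A i) <= c%:E)%E ->
  (P (\big[setU/set0]_i A i) <= (#|I|%:R * c)%:E)%E.
Proof.
move=> mA Ac; apply: (le_trans (measure_bigsetU_le P _ mA)).
apply: (@le_trans _ _ (\sum_(i : I) c%:E)%E); first exact: lee_sum.
by rewrite sumEFin sumr_const mulr_natl.
Qed.

Lemma sub_bigsetU (I : finType) (A : I -> set T) i : A i `<=` \big[setU/set0]_j A j.
Proof. by rewrite (bigD1 i) //=; exact: subsetUl. Qed.

Lemma probability_exhaust (P : probability T R) (A : (set T)^nat) (e : R) : 0 < e ->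
  (forall n, measurable (A n)) -> {homo A : m n / (m <= n)%N >-> m `<=` n} ->
  (forall x, exists n, A n x) -> exists n, (P (~` A n) <= e%:E)%E.
Proof.
move=> e0 mA ndA AT.
have UT : \bigcup_n A n = setT.
  by apply/seteqP; split=> // x _; have [n An] := AT x; exists n.
have : P \o A @ \oo --> P (\bigcup_n A n).
  apply: nondecreasing_cvg_mu => //; first by rewrite UT.
  by move=> m n mn; apply/subsetPset; exact: ndA.
rewrite UT probability_setT => cP.
have /fine_cvg/cvgrPdist_lt/(_ e e0)[n _ /(_ n (leqnn n)) /=] := cP.
rewrite ltr_norml => /andP[_ nP]; exists n.
by rewrite probability_setC // -[P (A n)]fineK ?fin_num_measure // -EFinB lee_fin ltW.
Qed.
End union_bounds.

(** * The observed increments and the four exceptional events *)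

Section covariation.
Context (R : realType) disp (Omega : measurableType disp) (P : probability Omega R).
Variables (Fil : R -> set (set Omega)) (Fil_filtration : is_filtration Fil).
Variables (k1 k2 p1 p2 : nat) (r : 'I_4 -> nat).
Variable W : forall i : 'I_4, R -> Omega -> 'cV[R]_(r i).
Hypothesis W_wiener : forall i, is_wiener P Fil (W i).
Hypothesis W_indep : forall t i i', 0 <= t -> i != i' -> forall G A B, Fil t G ->
  increments_after (W i) t A -> increments_after (W i') t B ->
  P (G `&` (A `&` B)) = (P G * (P A * P B))%E.
Unset Implicit Arguments.
Variables (lambda0 : 'I_4 -> R) (F f : forall i : 'I_4, 'cV[R]_(ldim k1 p1 p2 k2 i) -> R).
Hypotheses (lambda0_gt0 : forall i, 0 < lambda0 i)
  (F_density : forall i, is_density (@punctured R (ldim k1 p1 p2 k2 i)) (F i))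
  (f_def : forall i z, f i z = lambda0 i * F i z).
Variable mu : forall i : 'I_4, random_measure R Omega (ldim k1 p1 p2 k2 i).
Hypothesis mu_poisson : forall i, is_poisson_random_measure P Fil (mu i) (f i).
Variables (a : forall i : 'I_4,
     'cV[R]_(ldim k1 p1 p2 k2 i) -> 'cV[R]_(ldim k1 p1 p2 k2 i))
  (c : forall i : 'I_4, 'cV[R]_(ldim k1 p1 p2 k2 i) ->
     'cV[R]_(ldim k1 p1 p2 k2 i) -> 'cV[R]_(ldim k1 p1 p2 k2 i)).
Hypotheses (a_borel : forall i, measurable_fun setT (a i))
  (c_borel : forall i, measurable_fun
     (setT `*` @punctured R (ldim k1 p1 p2 k2 i)) (fun x => c i x.1 x.2))
  (a_lipschitz : forall i, exists2 L : R, 0 < L &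
     forall x y, enorm (a i x - a i y) <= L * enorm (x - y)).
Variables (sem0 : sem_param R k1 p1 p2 k2 r)
  (x0 : forall i : 'I_4, 'cV[R]_(ldim k1 p1 p2 k2 i))
  (Y : forall i : 'I_4, R -> Omega -> 'cV[R]_(ldim k1 p1 p2 k2 i))
  (eta : R -> Omega -> 'cV[R]_k2).
Hypotheses (sem0_regular : sem_regular sem0)
  (Y_cadlag : forall i, cadlag (Y i)) (Y_adapted : forall i, adapted Fil (Y i))
  (Y_sde : forall i,
     solves_jump_sde P (a i) (Vol sem0 i) (c i) (x0 i) (W i) (mu i) (Y i))
  (eta_eq : structural_equation sem0 Y eta).
Variables (T : R) (T_gt0 : 0 < T).

Set Implicit Arguments.
Let E : finType := {i : 'I_4 & 'I_(r i)}.
Let h n : R := T / n%:R.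

Let h_gt0 n : (0 < n)%N -> 0 < h n.
Proof. by move=> n0; rewrite divr_gt0 // ltr0n. Qed.

Let grid_ge0 n i : 0 <= i%:R * h n.
Proof. by rewrite mulr_ge0 // divr_ge0 // ltW. Qed.

Let gridS n i : i.+1%:R * h n - i%:R * h n = h n.
Proof. by rewrite -natr1 mulrDl mul1r addrAC subrr add0r. Qed.

Let grid_lt n i : (0 < n)%N -> i%:R * h n < i.+1%:R * h n.
Proof. by move=> n0; rewrite -subr_gt0 gridS h_gt0. Qed.

Let grid_le n i j : (i <= j)%N -> i%:R * h n <= j%:R * h n.
Proof. by move=> ij; rewrite ler_wpM2r ?ler_nat // divr_ge0 // ltW. Qed.

Let grid_leT n i : (i < n)%N -> i.+1%:R * h n <= T.
Proof.
move=> i_lt; have n0 : 0 < n%:R :> R by rewrite ltr0n (leq_trans _ i_lt).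
by rewrite /h mulrCA -[leRHS]mulr1 ler_pM2l // ler_pdivrMr // mul1r ler_nat.
Qed.

Definition dW n i (e : {i : 'I_4 & 'I_(r i)}) : Omega -> R :=
  increment_coord W (i%:R * h n) (i.+1%:R * h n) e.

Let measurable_dW n i e : measurable_fun setT (dW n i e).
Proof.
exact: (increment_coord_measurable Fil_filtration W_wiener _ (grid_ge0 n i) (grid_ge0 n i.+1)).
Qed.

(** Every path is bounded on [[0, T]], so the events of being bounded by [K] at all grid points
    increase to [Omega]. They are countable intersections over all meshes, so a single [K] serves
    every [n]. *)
Lemma grid_bounded (e : R) : 0 < e -> exists2 G : set Omega,
  measurable G /\ (P (~` G) <= e%:E)%E & exists K : R, forall w, G w ->
  forall i n k j, (k < n)%N -> `|Y i (k%:R * h n) w j 0| <= K.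
Proof.
move=> e0.
pose A (K : nat) : set Omega := \bigcap_(i in [set: 'I_4]) \bigcap_n \bigcap_(k in `I_n)
  \bigcap_(j in [set: 'I_(ldim k1 p1 p2 k2 i)])
    [set w | `|Y i (k%:R * h n) w j 0| <= K%:R].
have mA K : measurable (A K).
  apply: fin_bigcap_measurable => // i _.
  apply: bigcapT_measurable => n; apply: fin_bigcap_measurable => [|k _].
    exact: finite_II.
  apply: fin_bigcap_measurable => // j _.
  have mY : measurable_fun setT (fun w => `|Y i (k%:R * h n) w j 0|).
    apply: measurableT_comp => //.
    exact: (adapted_coord_measurable Fil_filtration _ (@Y_adapted i)).
  rewrite -[X in measurable X]setTI.
  rewrite (_ : [set w | _] = (fun w => `|Y i (k%:R * h n) w j 0|) @^-1` `]-oo, K%:R]).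
    by apply: mY => //; exact: measurable_itv.
  by apply/seteqP; split => w /=; rewrite in_itv.
have [//|||K AK] := @probability_exhaust _ _ _ P A e e0.
- move=> m n mn w Aw i _ k _ l lk j _; apply: (le_trans (Aw i I k I l lk j I)).
  by rewrite ler_nat.
- move=> w.
  have bnd (i : 'I_4) : exists K : nat, forall s, 0 <= s -> s <= T ->
      forall j, `|Y i s w j 0| <= K%:R.
    by apply: cadlag_coord_bounded => // t t0; exact: Y_cadlag.
  have [K KP] := choice bnd.
  exists (\max_(i < 4) K i)%N => i _ n _ k /= kn j _.
  apply: le_trans (KP i _ _ _ j) _ => //.
  + by rewrite (le_trans _ (grid_leT kn)) // grid_le.
  + by rewrite ler_nat leq_bigmax.
exists (A K) => //; exists K%:R => w Aw i n k j kn.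
exact: (Aw i I n I k kn j I).
Qed.

Lemma dW_tail n (l : R) k : (0 < n)%N -> 0 < l ->
  let A (x : 'I_n * E) := [set w | (l <= `|dW n x.1 x.2 w|)%R] in
  measurable (\big[setU/set0]_x A x) /\
  (P (\big[setU/set0]_x A x) <=
   ((n * #|E|)%:R * (2 * (k.+1)`!%:R * (8 * h n / (3 * l ^+ 2)) ^+ k.+1))%R%:E)%E.
Proof.
move=> n0 l0 A.
have mA x : measurable (A x).
  rewrite -[X in measurable X]setTI.
  have mabs : measurable_fun setT (fun w => `|dW n x.1 x.2 w|).
    by apply: measurableT_comp => //; exact: measurable_dW.
  rewrite (_ : A x = (fun w => `|dW n x.1 x.2 w|) @^-1` `[l, +oo[).
    by apply: mabs => //; exact: measurable_itv.
  by apply/seteqP; split => w /=; rewrite in_itv/= andbT.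
split; first by apply: bigsetU_measurable => x _.
rewrite -[n in (n * _)%N]card_ord -card_prod.
apply: measure_bigsetU_const_le => // -[i e] /=.
have := increment_tail Fil_filtration W_wiener (grid_ge0 n i) (grid_lt i n0) e k l0.
by rewrite gridS.
Qed.

Lemma dW_covariation n (K : R) : (0 < n)%N -> 0 < K ->
  let A (x : E * E) := [set w | (K * Num.sqrt n%:R <=
     `|\sum_(i < n) (dW n i x.1 w * dW n i x.2 w / h n - (x.1 == x.2)%:R)|)%R] in
  measurable (\big[setU/set0]_x A x) /\
  (P (\big[setU/set0]_x A x) <= ((#|E| * #|E|)%:R * (60 / K ^+ 2))%R%:E)%E.
Proof.
move=> n0 K0 A.
pose u (e e' : E) i w := dW n i e w * dW n i e' w / h n - (e == e')%:R.
have noise e e' i : centered_noise P (Fil (i%:R * h n)) 60 (u e e' i).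
  have := increment_noise Fil_filtration W_wiener W_indep (grid_ge0 n i) (grid_lt i n0) e e'.
  by rewrite gridS.
have [sF mono] := Fil_filtration.
have mA x : measurable (A x).
  have mS : measurable_fun setT (fun w => `|\sum_(i < n) u x.1 x.2 i w|).
    apply: measurableT_comp => //; apply: measurable_sum => i.
    by have [] := noise x.1 x.2 i.
  rewrite -[X in measurable X]setTI.
  rewrite (_ : A x = (fun w => `|\sum_(i < n) u x.1 x.2 i w|)
      @^-1` `[K * Num.sqrt n%:R, +oo[).
    by apply: mS => //; exact: measurable_itv.
  by apply/seteqP; split => w /=; rewrite in_itv/= andbT.
split; first by apply: bigsetU_measurable => x _.
rewrite -card_prod; apply: measure_bigsetU_const_le => // -[e e'] /=.
apply: (@martingale_concentration _ _ _ P n (fun i => Fil (i%:R * h n)) 60 K (u e e')) => //.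
- by move=> i _; have [] := sF _ (grid_ge0 n i).
- move=> i j B ji _ mB.
  have mu' : measurable_fun setT
      (u e e' j : g_sigma_algebraType (Fil (i%:R * h n)) -> R).
    have mdW x : measurable_fun setT
        (dW n j x : g_sigma_algebraType (Fil (i%:R * h n)) -> R).
      by apply: (increment_coord_adapted Fil_filtration W_wiener) => //; apply: grid_le => //; exact: ltnW.
    by apply: measurable_funB => //; apply: measurable_funM => //; exact: measurable_funM.
  have := mu' measurableT B mB; rewrite setTI.
  by rewrite /measurable /= (sigma_algebra_id (sF _ (grid_ge0 n i)).1).
Qed.

Definition jump_interval n w : {pred 'I_n} :=
  [pred i : 'I_n | [exists j : 'I_4, mu j w
     (@jump_block R (ldim k1 p1 p2 k2 j) (i%:R * h n) (i.+1%:R * h n)) != 0%E]].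

(** Markov's inequality for the number of pairs of an interval and a process that jumps in it: its
    mean is at most [n h] times the total rate, that is [T] times the total rate, for every [n]. *)
Lemma jump_count n (K : nat) : (0 < n)%N -> (0 < K)%N ->
  exists2 B : set Omega, measurable B /\
    (P B <= (T * (\sum_j lambda0 j) / K%:R)%:E)%E &
    forall w, ~ B w -> (#|@jump_interval n w| <= K)%N.
Proof.
move=> n0 K0.
pose ev (x : 'I_n * 'I_4) := [set w | mu x.2 w
     (@jump_block R (ldim k1 p1 p2 k2 x.2) (x.1%:R * h n) (x.1.+1%:R * h n)) != 0%E].
have mev x : measurable (ev x) by exact: measurable_jump_event (mu_poisson x.2) _ _.
pose cnt w : R := \sum_x \1_(ev x) w.
have mcnt : measurable_fun setT cnt by apply: measurable_sum => x; exact: measurable_indic.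
have cnt0 w : 0 <= cnt w by apply: sumr_ge0 => x _; rewrite indicE.
have Ecnt : (\int[P]_w (cnt w)%:E <= (T * \sum_j lambda0 j)%:E)%E.
  rewrite (_ : (fun w => (cnt w)%:E) = fun w => \sum_x (\1_(ev x) w)%:E)%E; last first.
    by apply/funext => w; rewrite sumEFin.
  rewrite ge0_integral_sum //; last first.
    by move=> x; apply/measurable_EFinP; exact: measurable_indic.
  apply: (@le_trans _ _ (\sum_(x : 'I_n * 'I_4) (lambda0 x.2 * h n)%:E)%E).
    apply: lee_sum => -[i j] _; rewrite integral_indic // setIT.
    have := jump_probability (lambda0_gt0 j) (F_density j) (f_def j) (mu_poisson j)
      (grid_ge0 n i) (ltW (grid_lt i n0)).
    by rewrite gridS.
  rewrite sumEFin lee_fin -(pair_bigA _ (fun (i : 'I_n) j => lambda0 j * h n)) /=.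
  rewrite -mulr_suml sumr_const card_ord -[leLHS]mulr_natr -mulrA /h divfK.
    by rewrite mulrC.
  by rewrite pnatr_eq0 -lt0n.
have [icnt Rcnt] := ge0_integrableR mcnt cnt0 Ecnt.
exists [set w | K%:R <= cnt w].
  split.
    rewrite -[X in measurable X]setTI.
    rewrite (_ : [set w | _] = cnt @^-1` `[K%:R, +oo[).
      by apply: mcnt => //; exact: measurable_itv.
    by apply/seteqP; split => w /=; rewrite in_itv/= andbT.
  apply: le_trans (markov_ineq icnt cnt0 _) _; first by rewrite ltr0n.
  by rewrite lee_fin ler_wpM2r.
move=> w /negP; rewrite -ltNge => cntK.
rewrite -(ler_nat R) (le_trans _ (ltW cntK)) //.
rewrite -sum1_card natr_sum big_mkcond /= /cnt.
rewrite -(pair_bigA _ (fun (i : 'I_n) j => \1_(ev (i, j)) w)) /=.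
apply: ler_sum => i _; case: ifPn => [|_]; last by apply: sumr_ge0 => j _; rewrite indicE.
rewrite inE => /existsP[j evj]; rewrite (bigD1 j) //= indicE mem_set //=.
by rewrite lerDl; apply: sumr_ge0 => j' _; rewrite indicE.
Qed.

Definition noise_coef k (e : {i : 'I_4 & 'I_(r i)}) : R :=
  (load sem0 (tag e) *m Vol sem0 (tag e)) k (tagged e).

Lemma noise_coefE n i w k : \sum_(e : E) noise_coef k e * dW n i e w =
  (\sum_j load sem0 j *m (Vol sem0 j *m
     (W j (i.+1%:R * h n) w - W j (i%:R * h n) w))) k 0.
Proof.
rewrite summxE.
rewrite -(sig_big_dep (fun _ => true) (fun _ _ => true) (fun j l =>
  (load sem0 j *m Vol sem0 j) k l *
     (W j (i.+1%:R * h n) w - W j (i%:R * h n) w) l 0)) /=.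
by apply: eq_bigr => j _; rewrite mulmxA mxE.
Qed.

Lemma Sigma_noise_coef k l : Sigma sem0 k l = \sum_(e : E) noise_coef k e * noise_coef l e.
Proof.
rewrite Sigma_load summxE.
rewrite -(sig_big_dep (fun _ => true) (fun _ _ => true) (fun j l' =>
  (load sem0 j *m Vol sem0 j) k l' * (load sem0 j *m Vol sem0 j) l l')) /=.
by apply: eq_bigr => j _; rewrite mxE; apply: eq_bigr => o _; rewrite [_^T _ _]mxE.
Qed.

(** [B] depends on the bound [K] and the coefficients but not on [n]; [N] gathers the null sets of
    the four equations. *)
Lemma increment_close (K : R) : exists (B : R) (N : set Omega),
  [/\ 0 <= B, measurable N, P N = 0%E &
  forall w, ~ N w ->
    (forall i n k j, (k < n)%N -> `|Y i (k%:R * h n) w j 0| <= K) ->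
    forall n (i : 'I_n), i \notin @jump_interval n w -> forall k,
      `|increment (observed sem0 Y eta) T n w i k 0 - \sum_(e : E) noise_coef k e * dW n i e w|
        <= B * h n].
Proof.
have a_bound (i : 'I_4) : exists C : R, 0 <= C /\ forall x : 'cV_(ldim k1 p1 p2 k2 i),
    (forall j, `|x j 0| <= K) -> forall j, `|a i x j 0| <= C.
  have [L L0 aL] := a_lipschitz i.
  (* Linear growth from the Lipschitz condition at 0; the dimension converts the coordinatewise
     bound into one on the Euclidean norm. *)
  exists (enorm (a i 0) + L * ((ldim k1 p1 p2 k2 i)%:R * `|K|)).
  split=> [|x xK j].
    by rewrite addr_ge0 ?sqrtr_ge0 // mulr_ge0 ?(ltW L0) // mulr_ge0.
  have -> : a i x j 0 = a i 0 j 0 + (a i x - a i 0) j 0 by rewrite !mxE addrCA subrr addr0.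
  apply: (le_trans (ler_normD _ _)); apply: lerD; first exact: coord_le_enorm.
  apply: (le_trans (coord_le_enorm _ _)); apply: (le_trans (aL _ _)).
  rewrite ler_pM2l // subr0; apply: (le_trans (enorm_le_sum _)).
  apply: (@le_trans _ _ (\sum_(l < ldim k1 p1 p2 k2 i) `|K|)).
    by apply: ler_sum => l _; apply: (le_trans (xK l)); exact: ler_norm.
  by rewrite sumr_const card_ord mulr_natl.
have [C CP] := choice a_bound.
have null (i : 'I_4) : exists N : set Omega, [/\ measurable N, P N = 0%E &
    forall w, ~ N w -> forall t, 0 <= t -> forall j : 'I_(ldim k1 p1 p2 k2 i),
    Y i t w j 0 = x0 i j 0
      + \int[lebesgue_measure]_(s in `[0, t]) (a i (left_limit (Y i) s w) j 0)
      + (Vol sem0 i *m W i t w) j 0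
      + \int[mu i w]_(x in `]0, t] `*` @punctured R _)
          (c i (left_limit (Y i) x.1 w) x.2 j 0)].
  have [N [mN N0 NP]] := Y_sde i; exists N; split=> // w Nw t t0 j.
  have [_ H] := contrapT (fun nH => Nw (NP w nH)).
  exact: H.
have [N NP] := choice null.
exists (\sum_j \sum_k \sum_l `|load sem0 j k l| * C j), (\big[setU/set0]_i N i); split.
- apply: sumr_ge0 => j _; apply: sumr_ge0 => k _; apply: sumr_ge0 => l _.
  by rewrite mulr_ge0 //; have [] := CP j.
- by apply: bigsetU_measurable => i _; have [] := NP i.
- apply/eqP; rewrite eq_le measure_ge0 andbT.
  apply: (le_trans (measure_bigsetU_le P _ _)) => [i|]; first by have [] := NP i.
  by rewrite big1 // => i _; have [] := NP i.
move=> w Nw YK n i iJ k.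
rewrite noise_coefE /increment.
have i_n := ltn_ord i; have n0 : (0 < n)%N by rewrite (leq_trans _ i_n).
rewrite !(observed_load _ sem0_regular eta_eq); try exact: grid_ge0.
rewrite -/(h n).
set v := fun j => Y j (i.+1%:R * h n) w - Y j (i%:R * h n) w -
   Vol sem0 j *m (W j (i.+1%:R * h n) w - W j (i%:R * h n) w).
have -> : (\sum_j load sem0 j *m Y j (i.+1%:R * h n) w -
     \sum_j load sem0 j *m Y j (i%:R * h n) w) k 0 -
  (\sum_j load sem0 j *m (Vol sem0 j *m
     (W j (i.+1%:R * h n) w - W j (i%:R * h n) w))) k 0 =
  \sum_j \sum_l load sem0 j k l * v j l 0.
  rewrite -sumrB !summxE -sumrB; apply: eq_bigr => j _.
  rewrite -mulmxBr [X in X - _]mxE [X in _ - X]mxE -sumrB; apply: eq_bigr => l _.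
  by rewrite -mulrBr; congr (_ * _); rewrite /v !mxE.
have vC j l : `|v j l 0| <= C j * h n.
  have [C0 aC] := CP j; have [_ _ sde] := NP j.
  have Nwj : ~ N j w by move=> Nj; apply: Nw; exact: (sub_bigsetU Nj).
  rewrite -(gridS n i).
  apply: (@sde_increment_le R _ (fun t => Y j t w) T T_gt0 _ K _ (a j) (C j) _ _ (c j) _
    (mu j w) _ (Vol sem0 j) (fun t => W j t w) (x0 j)).
  - by move=> t t0; exact: Y_cadlag.
  - by move=> n' k' l' kn; exact: YK.
  - exact: a_borel.
  - exact: aC.
  - exact: c_borel.
  - exact: grid_ge0.
  - exact: grid_le.
  - exact: grid_leT.
  - move: iJ; rewrite inE negb_exists => /forallP/(_ j); rewrite negbK => /eqP.
    exact.
  - by move=> t t0 l'; exact: sde.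
apply: (le_trans (ler_norm_sum _ _ _)); rewrite mulr_suml; apply: ler_sum => j _.
apply: (le_trans (ler_norm_sum _ _ _)).
apply: (@le_trans _ _ (\sum_l `|load sem0 j k l| * C j * h n)).
  by apply: ler_sum => l _; rewrite normrM -mulrA ler_wpM2l.
rewrite -mulr_suml ler_wpM2r ?(ltW (h_gt0 n0)) // (bigD1 k) //= lerDl.
apply: sumr_ge0 => k' _; apply: sumr_ge0 => l _; rewrite mulr_ge0 //.
by have [] := CP j.
Qed.

Let p := (p1 + p2)%N.

(** The probability [e] is shared equally by four events: unbounded paths, large Gaussian
    covariations [BC], too many jumps [BJ], and a large Gaussian increment [BT]. The first is fixed
    before [n], so all constants are; outside the four events and a null set the deterministic
    estimates apply. *)
Lemma truncated_covariation_tight (D rho e : R) :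
  0 < D -> 1 / 3 <= rho -> rho < 1 / 2 -> 0 < e ->
  exists (K : R) (Kj : nat), \forall n \near \oo,
    exists2 G : set Omega, measurable G /\ (P (~` G) <= e%:E)%E &
    forall w, G w ->
      let dX := increment (observed sem0 Y eta) T n w in
      (forall k l, `|\sum_(i < n | enorm (dX i) <= D * (T / n%:R) `^ rho)
          (dX i k 0 * dX i l 0 / (T / n%:R) - Sigma sem0 k l)| <= K * Num.sqrt n%:R) /\
      n%:R - Kj%:R <= \sum_(i < n | enorm (dX i) <= D * (T / n%:R) `^ rho) 1 :> R.
Proof.
move=> D0 rho3 rho2 e0; have e4 : 0 < e / 4 by rewrite divr_gt0.
have [Gg [mGg PGg] [K0 GgP]] := grid_bounded e4.
have [B [N [B0 mN PN NP]]] := increment_close K0.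
pose gam : R := \sum_k \sum_(x : E) `|noise_coef k x|.
have gam0 : 0 <= gam by apply: sumr_ge0 => k _; exact: sumr_ge0.
have coef_le k x : `|noise_coef k x| <= gam.
  rewrite /gam (bigD1 k) //= (bigD1 x) //= -addrA lerDl addr_ge0 ?sumr_ge0 // => k' _.
  exact: sumr_ge0.
pose Q : R := #|E|%:R.
have Q0 : 0 <= Q by [].
(* Chosen so that the bound [60 Q^2 / Kc^2] is at most [e / 4]; the 1 gives [Kc <= Kc^2]. *)
pose Kc : R := 1 + 240 * Q ^+ 2 / e.
have Kc1 : 1 <= Kc by rewrite lerDl divr_ge0 ?(ltW e0) // mulr_ge0 ?sqr_ge0.
have Kc0 : 0 < Kc by apply: lt_le_trans Kc1.
have Kc_le : Q ^+ 2 * (60 / Kc ^+ 2) <= e / 4.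
  rewrite mulrA ler_pdivrMr ?exprn_gt0 //.
  apply: (@le_trans _ _ (e / 4 * Kc)); last by rewrite ler_pM2l // expr2 ler_peMl // ltW.
  have -> : e / 4 * Kc = e / 4 + Q ^+ 2 * 60 by rewrite /Kc; field; rewrite gt_eqF.
  by rewrite lerDr ltW.
pose Lam := \sum_j lambda0 j.
pose Kj := (Num.bound (4 * (T * Lam) / e)).+1.
have Lam0 : 0 <= Lam by apply: sumr_ge0 => j _; exact/ltW/lambda0_gt0.
have Kj_le : T * Lam / Kj%:R <= e / 4.
  rewrite ler_pdivrMr ?ltr0n //.
  have h4 : 0 <= 4 * (T * Lam) / e.
    by rewrite divr_ge0 ?(ltW e0) // mulr_ge0 // mulr_ge0 // ltW.
  have := archi_boundP h4; rewrite ltr_pdivrMr // => h5.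
  have : (Num.bound (4 * (T * Lam) / e))%:R * e <= Kj%:R * e.
    by rewrite ler_pM2r // ler_nat.
  by lra.
(* [cc] bounds the [p] coordinates of the Gaussian part so that together they use at most half of
   the threshold. [mm] is the corresponding bound on scalar noises: a combination of [Q] of them
   with coefficients at most [gam] stays below [cc]. *)
pose cc := D / (2 * p.+1%:R).
have cc0 : 0 < cc by rewrite divr_gt0 // mulr_gt0.
pose mm := cc / (gam * Q + 1).
have gQ : 0 < gam * Q + 1 by rewrite ltr_wpDl // mulr_ge0.
have mm0 : 0 < mm by rewrite divr_gt0.
have [k kP] := powR_ratio_small rho2.
pose A := Q * (2 * (k.+1)`!%:R * (8 / (3 * mm ^+ 2)) ^+ k.+1).
have A0 : 0 <= A.
  rewrite mulr_ge0 // mulr_ge0 ?mulr_ge0 // exprn_ge0 // divr_ge0 //.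
  by rewrite mulr_ge0 ?sqr_ge0.
pose s : R := \sum_k \sum_l `|Sigma sem0 k l|.
have s_le k' l : `|Sigma sem0 k' l| <= s.
  rewrite /s (bigD1 k') //= (bigD1 l) //= -addrA lerDl addr_ge0 ?sumr_ge0 // => k'' _.
  exact: sumr_ge0.
pose Kv := gam ^+ 2 * Q ^+ 2 * Kc.
have Kv0 : 0 <= Kv by rewrite mulr_ge0 ?(ltW Kc0) // mulr_ge0 ?sqr_ge0.
exists (Kv + B * Num.sqrt T * (1 + s + Kv) + B ^+ 2 * T
    + 2 * Kj%:R * (D ^+ 2 / Num.sqrt T + s)).
exists Kj.
near=> n.
have n0 : (0 < n)%N by near: n; exists 1%N.
have hn0 : 0 < h n by exact: h_gt0.
have h1 : h n <= 1 by near: n; exact: near_mesh_le.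
have hB : h n <= (D / (2 * (p%:R * B + 1))) ^+ 2.
  near: n; apply: near_mesh_le; rewrite exprn_gt0 // divr_gt0 // mulr_gt0 //.
  by rewrite ltr_wpDl // mulr_ge0.
have hA : h n <= e / 4 / (A * T + 1).
  near: n; apply: near_mesh_le; rewrite divr_gt0 // ltr_wpDl // mulr_ge0 // ltW //.
pose g := h n `^ rho.
have g0 : 0 < g by exact: powR_gt0.
have l0 : 0 < mm * g by exact: mulr_gt0.
have [BJ [mBJ PBJ] BJP] := @jump_count n Kj n0 (ltn0Sn _).
have [mBC PBC] := dW_covariation n0 Kc0.
have [mBT PBT] := dW_tail k n0 l0.
set BC := \big[setU/set0]_(x : E * E) _ in mBC PBC.
set BT := \big[setU/set0]_(x : 'I_n * E) _ in mBT PBT.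
exists (~` (~` Gg `|` N `|` BC `|` BJ `|` BT)).
  split.
    apply: measurableC; do 3 (apply: measurableU => //); apply: measurableU => //.
    exact: measurableC.
  rewrite setCK.
  have PBT' : (P BT <= (e / 4)%:E)%E.
    apply: (le_trans PBT); rewrite lee_fin.
    have -> : 8 * h n / (3 * (mm * g) ^+ 2) = 8 / (3 * mm ^+ 2) * (h n / g ^+ 2).
      by field; rewrite !gt_eqF.
    rewrite exprMn.
    apply: (@le_trans _ _ ((n * #|E|)%:R * (2 * (k.+1)`!%:R *
        ((8 / (3 * mm ^+ 2)) ^+ k.+1 * h n ^+ 2)))).
      rewrite ler_wpM2l // ler_wpM2l ?mulr_ge0 // ler_wpM2l ?kP //.
      by rewrite exprn_ge0 // divr_ge0 // mulr_ge0 ?sqr_ge0.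
    have -> : (n * #|E|)%:R * (2 * (k.+1)`!%:R * ((8 / (3 * mm ^+ 2)) ^+ k.+1 * h n ^+ 2))
        = A * (n%:R * h n) * h n.
      by rewrite natrM /A -/Q; ring.
    (* Of the factor [h^2] provided by the choice of [k], one power absorbs the [n] increments of
       the union bound; the remaining [A T h] tends to 0. *)
    have -> : n%:R * h n = T by rewrite /h mulrC divfK // pnatr_eq0 -lt0n.
    have AT : 0 <= A * T by rewrite mulr_ge0 // ltW.
    apply: (@le_trans _ _ ((A * T + 1) * h n)); first by rewrite ler_wpM2r ?(ltW hn0) // lerDl.
    by rewrite mulrC -ler_pdivlMr // ltr_wpDl.
  have PBC' : (P BC <= (e / 4)%:E)%E.
    by apply: (le_trans PBC); rewrite lee_fin natrM -expr2.
  have PBJ' : (P BJ <= (e / 4)%:E)%E by apply: (le_trans PBJ); rewrite lee_fin.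
  have -> : e%:E = ((e / 4)%:E + 0 + (e / 4)%:E + (e / 4)%:E + (e / 4)%:E)%E.
    by rewrite adde0 -!EFinD; congr EFin; lra.
  have mU1 : measurable (~` Gg `|` N) by apply: measurableU => //; exact: measurableC.
  have mU2 : measurable (~` Gg `|` N `|` BC) by exact: measurableU.
  apply: (le_trans (measureU2 _ (measurableU _ _ mU2 mBJ) mBT)); apply: leeD => //.
  apply: (le_trans (measureU2 _ mU2 mBJ)); apply: leeD => //.
  apply: (le_trans (measureU2 _ mU1 mBC)); apply: leeD => //.
  apply: (le_trans (measureU2 _ (measurableC mGg) mN)); apply: leeD => //.
  by rewrite [leLHS]PN.
move=> w; rewrite !setCU setCK => -[[[[Gw Nw] BCw] BJw] BTw].
pose dX := increment (observed sem0 Y eta) T n w; rewrite -/dX.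
have dWl (i : 'I_n) x : `|dW n i x w| <= mm * g.
  rewrite leNgt; apply/negP => H; apply: BTw.
  by apply: (sub_bigsetU (A := fun x : 'I_n * E => [set w | (mm * g <= `|dW n x.1 x.2 w|)%R]) (i := (i, x))); exact: ltW.
pose z (i : 'I_n) : 'cV[R]_p := \col_k' \sum_(x : E) noise_coef k' x * dW n i x w.
have cov k' l : `|\sum_i (z i k' 0 * z i l 0 / h n - Sigma sem0 k' l)| <= Kv * Num.sqrt n%:R.
  have := @covariation_le R p n E noise_coef (fun i x => dW n i x w) (h n)
    (Kc * Num.sqrt n%:R) gam coef_le k' l.
  rewrite -Sigma_noise_coef mulrA -/Q -/Kv => H.
  rewrite (eq_bigr (fun i : 'I_n => (\sum_e0 noise_coef k' e0 * dW n i e0 w) *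
    (\sum_e0 noise_coef l e0 * dW n i e0 w) / h n - Sigma sem0 k' l)); last first.
    by move=> i _; rewrite !mxE.
  apply: H => x x'; rewrite leNgt; apply/negP => H; apply: BCw.
  by apply: (sub_bigsetU (A := fun x : E * E => [set w | (Kc * Num.sqrt n%:R <=
     `|\sum_(i < n) (dW n i x.1 w * dW n i x.2 w / h n - (x.1 == x.2)%:R)|)%R]) (i := (x, x'))); exact: ltW.
have zc (i : 'I_n) k' : `|z i k' 0| <= cc * g.
  rewrite mxE; apply: (le_trans (@linear_comb_le R p n E noise_coef (fun (i : 'I_n) x => dW n i x w) gam
    coef_le i k' _ (dWl i))).
  rewrite mulrA ler_pM2r // -/Q /mm mulrCA ler_piMr ?(ltW cc0) //.
  by rewrite ler_pdivrMr // mul1r lerDl.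
have noJ (i : 'I_n) : i \notin @jump_interval n w -> forall k', `|dX i k' 0 - z i k' 0| <= B * h n.
  move=> iJ k'; have -> : z i k' 0 = \sum_(x : E) noise_coef k' x * dW n i x w.
    by rewrite mxE.
  exact: (NP w Nw (GgP w Gw) n i iJ k').
have c1 : p%:R * cc <= D / 2.
  rewrite /cc mulrCA ler_pM2l // invfM mulrCA ler_piMr ?invr_ge0 //.
  by rewrite ler_pdivrMr // mul1r ler_nat.
have c2 : cc <= D.
  rewrite ler_pdivrMr ?mulr_gt0 // ler_peMr ?(ltW D0) //.
  by rewrite -natrM ler1n.
have g2 : g ^+ 2 <= Num.sqrt (h n) by exact: powR_sqr_le_sqrt.
have dr : p%:R * (B * h n) <= D / 2 * g.
  have pB : 0 <= p%:R * B by rewrite mulr_ge0.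
  have pB1 : 0 < p%:R * B + 1 by rewrite ltr_wpDl.
  have sh : Num.sqrt (h n) <= D / (2 * (p%:R * B + 1)).
    rewrite -[leRHS]ger0_norm -?sqrtr_sqr ?ler_wsqrtr //.
    by rewrite divr_ge0 ?(ltW D0) // mulr_ge0 // ltW.
  rewrite mulrA; apply: (@le_trans _ _ (p%:R * B * (Num.sqrt (h n) * g))).
    by rewrite ler_wpM2l // le_sqrt_mul_powR.
  rewrite mulrA ler_pM2r //.
  apply: (@le_trans _ _ ((p%:R * B + 1) * (D / (2 * (p%:R * B + 1))))).
    by rewrite ler_pM ?sqrtr_ge0 // lerDl.
  by rewrite le_eqVlt; apply/orP; left; apply/eqP; field; rewrite gt_eqF.
split.
  move=> k' l.
  exact: (@truncated_sum_le R p n T D B cc g Kv s Kj dX z (Sigma sem0)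
    (@jump_interval n w) n0 T_gt0 D0 B0 Kv0 g0 c1 c2 (ltW cc0) s_le g2 dr noJ zc
    (BJP w BJw) cov k' l).
exact: (@truncation_card R p n T D B cc g Kj dX z (@jump_interval n w) g0 c1
  dr noJ zc (BJP w BJw)).
Unshelve. all: by end_near.
Qed.
End covariation.

(** * Maximized log-likelihoods *)

Section rational_points.
Variables (R : realType) (q : nat) (U : set 'cV[R]_q).
Hypotheses (U_open : open U) (U_neq0 : U !=set0).

Let x0 : 'cV[R]_q := projT1 (cid U_neq0).

(** A sequence through all rational points of [U]. Indices that code none are sent to [x0], so that
    the sequence never leaves [U]. *)
Definition rational_point (n : nat) : 'cV[R]_q :=
  let x := if unpickle n is Some M then map_mx ratr (M : 'cV[rat]_q) else x0 in
  if pselect (U x) then x else x0.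

Lemma rational_point_in n : U (rational_point n).
Proof.
rewrite /rational_point; case: pselect => //= _.
by rewrite /x0; case: cid.
Qed.

Lemma rational_point_dense (O : set 'cV[R]_q) : open O -> O `&` U !=set0 ->
  exists n, O (rational_point n).
Proof.
move=> oO [x OUx].
have /nbhs_ballP[e /= e0 eB] : nbhs x (O `&` U).
  by apply: open_nbhs_nbhs; split=> //; exact: openI.
have rat_near i : exists a : rat, ball (x i 0) e (ratr a).
  have [|a] := @rat_in_itvoo R (x i 0 - e) (x i 0 + e); first by lra.
  rewrite in_itv /= => /andP[h1 h2]; exists a; rewrite /ball /= ltr_norml.
  by apply/andP; split; lra.
have [g gP] := choice rat_near.
pose M : 'cV[rat]_q := \col_i g i.
have xM : ball x e (map_mx ratr M : 'cV[R]_q).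
  by split=> // i j; rewrite !mxE ord1; exact: gP.
have [OM UM] := eB _ xM.
exists (pickle M); rewrite /rational_point pickleK.
by case: pselect.
Qed.

(* When [H] is unbounded above, both sides are the junk value 0. *)
Lemma sup_rational_point (H : 'cV[R]_q -> R) :
  {within closure U, continuous H} ->
  sup [set H x | x in closure U] =
  fine (ereal_sup [set (H (rational_point n))%:E | n in setT]).
Proof.
move=> cH; set A := [set H x | x in closure U].
pose B := [set H (rational_point n) | n in setT].
have BA : B `<=` A.
  move=> _ [n _ <-]; exists (rational_point n) => //.
  by apply: subset_closure; exact: rational_point_in.
have AB a e : A a -> 0 < e -> exists2 b, B b & a - e < b.
  move=> [x clx <-] e0.
  have := (subspace_continuousP _ _).1 cH x clx.
  move=> /cvgrPdist_lt/(_ e e0).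
  rewrite /prop_near1 /within /= nbhsE => -[V [Vo Vx] VP].
  have [y [Uy Vy]] := clx V (open_nbhs_nbhs (conj Vo Vx)).
  have [n Vn] := rational_point_dense Vo (ex_intro _ y (conj Vy Uy)).
  exists (H (rational_point n)); first by exists n.
  have := VP _ Vn (subset_closure (rational_point_in n)).
  by rewrite /from_subspace /= ltr_norml => /andP[h1 h2]; lra.
have B0 : B !=set0 by exists (H (rational_point 0%N)); exists 0%N.
have A0 : A !=set0 by case: B0 => b /BA ?; exists b.
have -> : [set (H (rational_point n))%:E | n in setT] = [set x%:E | x in B].
  apply/seteqP; split=> [_ [n _ <-]|_ [_ [n _ <-] <-]] /=; last by exists n.
  by exists (H (rational_point n)) => //; exists n.
have ubBA M : ubound B M -> ubound A M.
  move=> BM a Aa; rewrite leNgt; apply/negP => Ma.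
  have aM : 0 < a - M by rewrite subr_gt0.
  have [b Bb] := AB a (a - M) Aa aM.
  by rewrite opprB addrC subrK ltNge BM.
have [ubB|nubB] := pselect (has_ubound B).
  rewrite ereal_sup_EFin //=; apply/eqP; rewrite eq_le; apply/andP; split.
    apply: ge_sup => //; apply: ubBA; exact: sup_upper_bound.
  apply: ge_sup => // b Bb; apply: sup_upper_bound; last exact: BA.
  by split=> //; case: ubB => M BM; exists M; exact: ubBA.
rewrite sup_out; last by move=> [_ [M AM]]; apply: nubB; exists M => b /BA; exact: AM.
by rewrite hasNub_ereal_sup.
Qed.
End rational_points.

(** * Measurability of the quasi-likelihood at a fixed parameter *)

Section likelihood_measurability.
Context (R : realType) disp (Omega : measurableType disp) (p : nat).
Variables (X : R -> Omega -> 'cV[R]_p) (T D rho : R).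
Hypothesis T_gt0 : 0 < T.
Hypothesis mX : forall t k, 0 <= t -> measurable_fun setT (fun w => X t w k 0).

Lemma measurable_increment n i k :
  measurable_fun setT (fun w => increment X T n w i k 0).
Proof.
rewrite (_ : (fun _ => _) = fun w =>
    X (i.+1%:R * (T / n%:R)) w k 0 - X (i%:R * (T / n%:R)) w k 0).
  by apply: measurable_funB; apply: mX; rewrite mulr_ge0 // divr_ge0 // ltW.
by apply/funext => w; rewrite /increment !mxE.
Qed.

Lemma measurable_truncation n i c :
  measurable_fun setT (fun w => enorm (increment X T n w i) <= c).
Proof.
apply: measurable_fun_ler => //.
rewrite (_ : (fun _ => _) = Num.sqrt \o
    (fun w => \sum_k increment X T n w i k 0 ^+ 2)); last first.
  by apply/funext => w; rewrite enormE.
apply: measurableT_comp; first exact: (continuous_measurable_fun (@sqrt_continuous R)).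
by apply: measurable_sum => k; apply: measurable_funX; exact: measurable_increment.
Qed.

Lemma measurable_quasi_loglik n Sig :
  measurable_fun setT (fun w => quasi_loglik X T D rho n w Sig).
Proof.
rewrite /quasi_loglik; apply: measurable_funB.
- apply: measurable_funM => //.
  under eq_fun do rewrite big_mkcond.
  apply: measurable_sum => i; apply: measurable_fun_ifT => //.
    exact: measurable_truncation.
  under eq_fun do rewrite quad_formE.
  apply: measurable_sum => k; apply: measurable_sum => l.
  by apply: measurable_funM; [apply: measurable_funM => //|]; exact: measurable_increment.
- apply: measurable_funM => //.
  under eq_fun do rewrite big_mkcond.
  apply: measurable_sum => i; apply: measurable_fun_ifT => //.
  exact: measurable_truncation.
Qed.
End likelihood_measurability.

Section loglik_gap.
Variables (R : realType) (Omega : Type) (p : nat) (X : R -> Omega -> 'cV[R]_p).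
Variables (T D rho : R).

Lemma quasi_loglikE n w (Sig : 'M[R]_p) :
  let h := T / n%:R in
  let dX := increment X T n w in
  quasi_loglik X T D rho n w Sig =
  gauss_loglik (\sum_(i < n | enorm (dX i) <= D * h `^ rho) h^-1 *: (dX i *m (dX i)^T))
    (\sum_(i < n | enorm (dX i) <= D * h `^ rho) 1) Sig.
Proof.
move=> h dX; rewrite /quasi_loglik /gauss_loglik -/h -/dX.
have -> : \tr (invmx Sig *m
    \sum_(i < n | enorm (dX i) <= D * h `^ rho) h^-1 *: (dX i *m (dX i)^T)) =
    h^-1 * \sum_(i < n | enorm (dX i) <= D * h `^ rho)
       ((dX i)^T *m invmx Sig *m dX i) 0 0.
  rewrite mulmx_sumr raddf_sum mulr_sumr; apply: eq_bigr => i _ /=.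
  rewrite -scalemxAr mxtraceZ mulmxA mxtrace_mulC mulmxA /mxtrace big_ord_recl big_ord0.
  by rewrite addr0; congr (_ * _); congr (_ _ _); apply/val_inj.
rewrite invfM -[X in _ - _ * X](_ : (\sum_(i < n | enorm (dX i) <= D * h `^ rho) 1)
   * ln (\det Sig) = _); last by rewrite mulr_suml; under eq_bigr do rewrite mul1r.
by ring.
Qed.

(** As soon as [N >= n / 2], the entries of [V - Sig0] are at most [eps = 2 K / sqrt n], and the
    ratio is at most [(n / 2) C0 eps^2 = 2 C0 K^2]. The bound is uniform in [Sig], so it applies at
    a random maximizer. *)
Lemma quasi_loglik_gap (Sig0 : 'M[R]_p) (K : R) (Kj : nat) : posdef Sig0 ->
  exists C : R, \forall n \near \oo, forall w,
    let dX := increment X T n w in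
    (forall k l, `|\sum_(i < n | enorm (dX i) <= D * (T / n%:R) `^ rho)
        (dX i k 0 * dX i l 0 / (T / n%:R) - Sig0 k l)| <= K * Num.sqrt n%:R) ->
    n%:R - Kj%:R <= \sum_(i < n | enorm (dX i) <= D * (T / n%:R) `^ rho) 1 :> R ->
    forall Sig, posdef Sig ->
      quasi_loglik X T D rho n w Sig - quasi_loglik X T D rho n w Sig0 <= C.
Proof.
move=> pSig0; have [C0 [delta [C0_gt0 delta_gt0 pert]]] := posdef_perturb pSig0.
exists (2 * C0 * K ^+ 2); near=> n => w /= cov keep Sig pSig.
have n0 : 0 < n%:R :> R by near: n; exact: nbhs_infty_gtr.
have nKj : 2 * Kj%:R <= n%:R :> R by near: n; exact: nbhs_infty_ger.
have epsd : 2 * K / Num.sqrt n%:R <= delta by near: n; exact: near_div_sqrt_le.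
rewrite !quasi_loglikE; set h := T / n%:R in cov keep *.
set dX := increment X T n w in cov keep *.
set S := \sum_(i < n | _) _; set N : R := \sum_(i < n | _) _ in keep *.
have N2 : n%:R / 2 <= N by apply: le_trans keep; lra.
have N0 : 0 < N by apply: lt_le_trans N2; rewrite divr_gt0.
have Nn : N <= n%:R.
  rewrite /N big_mkcond -[n in n%:R]card_ord -sumr_const.
  by apply: ler_sum => i _; case: ifP.
have sq0 : 0 < Num.sqrt n%:R :> R by rewrite sqrtr_gt0.
pose V := N^-1 *: S; have SE : S = N *: V by rewrite scalerA mulfV ?gt_eqF // scale1r.
have sV : V^T = V.
  rewrite /V linearZ /= /S raddf_sum /=; congr (_ *: _); apply: eq_bigr => i _.
  by rewrite linearZ /= trmx_mul trmxK.
have V_le k l : `|V k l - Sig0 k l| <= 2 * K / Num.sqrt n%:R.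
  have -> : V k l - Sig0 k l = N^-1 * \sum_(i < n | enorm (dX i) <= D * h `^ rho)
        (dX i k 0 * dX i l 0 / h - Sig0 k l).
    rewrite sumrB mulrBr; congr (_ - _).
      rewrite mxE summxE; congr (_ * _); apply: eq_bigr => i _.
      by rewrite !mxE big_ord_recl big_ord0 addr0 !mxE mulrC.
    rewrite (eq_bigr (fun=> 1 * Sig0 k l)); last by move=> i _; rewrite mul1r.
    by rewrite -mulr_suml -/N mulrA mulVf ?mul1r // gt_eqF.
  rewrite normrM gtr0_norm ?invr_gt0 // ler_pdivrMl // (le_trans (cov k l)) //.
  have K0 : 0 <= K by have := le_trans (normr_ge0 _) (cov k l); rewrite pmulr_lge0.
  apply: (@le_trans _ _ (n%:R / 2 * (2 * K / Num.sqrt n%:R))); last first.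
    by rewrite ler_wpM2r // divr_ge0 ?mulr_ge0 // ltW.
  rewrite -{2}(sqr_sqrtr (ltW n0)) le_eqVlt; apply/orP; left; apply/eqP.
  by field; rewrite gt_eqF.
have [pV trV] := pert V _ sV epsd V_le.
rewrite SE; apply: (le_trans (gauss_loglik_ratio_le N0 pSig pSig0 pV)).
apply: (@le_trans _ _ (N / 2 * (C0 * (2 * K / Num.sqrt n%:R) ^+ 2))).
  by rewrite ler_pM2l // divr_gt0.
apply: (@le_trans _ _ (n%:R / 2 * (C0 * (2 * K / Num.sqrt n%:R) ^+ 2))).
  apply: ler_wpM2r; first by rewrite mulr_ge0 ?sqr_ge0 // ltW.
  by rewrite ler_pM2r // invr_gt0.
rewrite exprMn exprVn sqr_sqrtr ?(ltW n0) //.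
by rewrite le_eqVlt; apply/orP; left; apply/eqP; field; rewrite gt_eqF.
Unshelve. all: by end_near. Qed.
End loglik_gap.

(** Extracts from the joint independence of the past and all noises the relation between the past
    and two Wiener processes, where the trivial choice of events is made by restricting the index
    set. *)
Lemma mutually_independent_triple (R : realType) disp (Omega : measurableType disp)
    (P : probability Omega R) (I : finType) (G : I -> set (set Omega)) (i j k : I)
    (A B C : set Omega) : mutually_independent P G ->
  i != j -> i != k -> j != k -> G i A -> G j B -> G k C ->
  P (A `&` (B `&` C)) = (P A * (P B * P C))%E.
Proof.
move=> indep ij ik jk GA GB GC.
pose S l := if l == i then A else if l == j then B else C.
have Si : S i = A by rewrite /S eqxx.
have Sj : S j = B by rewrite /S eq_sym (negbTE ij) eqxx.
have Sk : S k = C by rewrite /S eq_sym (negbTE ik) eq_sym (negbTE jk).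
have := indep [set i; j; k]%SET S _.
rewrite -finset.setUA big_setU1 ?inE ?negb_or ?ij ?ik // big_setU1 ?inE // big_set1.
rewrite Si Sj Sk => <-.
  congr (P _); apply/seteqP; split => w /=.
    by move=> [Aw [Bw Cw]] l; rewrite !inE => /or3P[] /eqP ->; rewrite ?Si ?Sj ?Sk.
  by move=> H; split; [|split]; [rewrite -Si|rewrite -Sj|rewrite -Sk]; apply: H;
    rewrite !inE eqxx ?orbT.
by move=> l; rewrite !inE => /or3P[] /eqP ->; rewrite ?Si ?Sj ?Sk.
Qed.

Theorem theorem4 (R : realType)
  (* filtered probability space *)
  (disp : measure_display) (Omega : measurableType disp)
  (P : probability Omega R) (Fil : R -> set (set Omega))
  (Fil_filtration : is_filtration Fil)
  (* dimensions *)
  (p1 p2 k1 k2 : nat) (r : 'I_4 -> nat)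
  (k1_gt0 : (0 < k1)%N) (k1_le : (k1 <= p1)%N)
  (k2_gt0 : (0 < k2)%N) (k2_le : (k2 <= p2)%N)
  (r_gt0 : forall i, (0 < r i)%N)
  (* driving noises *)
  (W : forall i : 'I_4, R -> Omega -> 'cV[R]_(r i))
  (W_wiener : forall i, is_wiener P Fil (W i))
  (lambda0 : 'I_4 -> R) (lambda0_gt0 : forall i, 0 < lambda0 i)
  (F : forall i : 'I_4, 'cV[R]_(ldim k1 p1 p2 k2 i) -> R)
  (F_density : forall i, is_density (@punctured R (ldim k1 p1 p2 k2 i)) (F i))
  (f : forall i : 'I_4, 'cV[R]_(ldim k1 p1 p2 k2 i) -> R)
  (f_def : forall i z, f i z = lambda0 i * F i z)
  (mu : forall i : 'I_4, random_measure R Omega (ldim k1 p1 p2 k2 i))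
  (mu_poisson : forall i, is_poisson_random_measure P Fil (mu i) (f i))
  (noise_independent : forall t, 0 <= t ->
     mutually_independent P (fun j : option ('I_4 + 'I_4) =>
       match j with
       | None => Fil t
       | Some (inl i) => increments_after (W i) t
       | Some (inr i) => jumps_after (mu i) t
       end))
  (* latent processes and observations under the true parameter *)
  (sem0 : sem_param R k1 p1 p2 k2 r) (sem0_regular : sem_regular sem0)
  (Sigma0_posdef : posdef (Sigma sem0))
  (a : forall i : 'I_4,
     'cV[R]_(ldim k1 p1 p2 k2 i) -> 'cV[R]_(ldim k1 p1 p2 k2 i))
  (a_borel : forall i, measurable_fun setT (a i))
  (c : forall i : 'I_4, 'cV[R]_(ldim k1 p1 p2 k2 i) ->
     'cV[R]_(ldim k1 p1 p2 k2 i) -> 'cV[R]_(ldim k1 p1 p2 k2 i))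
  (c_borel : forall i, measurable_fun
     (setT `*` @punctured R (ldim k1 p1 p2 k2 i)) (fun x => c i x.1 x.2))
  (x0 : forall i : 'I_4, 'cV[R]_(ldim k1 p1 p2 k2 i))
  (Y : forall i : 'I_4, R -> Omega -> 'cV[R]_(ldim k1 p1 p2 k2 i))
  (Y_cadlag : forall i, cadlag (Y i))
  (Y_adapted : forall i, adapted Fil (Y i))
  (Y_sde : forall i,
     solves_jump_sde P (a i) (Vol sem0 i) (c i) (x0 i) (W i) (mu i) (Y i))
  (eta : R -> Omega -> 'cV[R]_k2)
  (eta_eq : structural_equation sem0 Y eta)
  (* sampling scheme *)
  (T : R) (T_gt0 : 0 < T)
  (D : R) (D_gt0 : 0 < D)
  (rho : R) (rho_ge : 1 / 3 <= rho) (rho_lt : rho < 1 / 2)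
  (* parametric models *)
  (M : nat) (q : 'I_M -> nat) (q_gt0 : forall l, (0 < q l)%N)
  (Theta : forall l : 'I_M, set 'cV[R]_(q l))
  (Theta_bounded : forall l, bounded_set (Theta l))
  (Theta_open : forall l, open (Theta l))
  (Theta_convex : forall l,
     convex_set (Theta l : set (convex_lmodType 'cV[R]_(q l))))
  (sem : forall l : 'I_M, 'cV[R]_(q l) -> sem_param R k1 p1 p2 k2 r)
  (sem_reg : forall l th, Theta l th -> sem_regular (sem l th))
  (Psi_unit : forall l th, closure (Theta l) th -> Psi (sem l th) \in unitmx)
  (Sigma_posdef : forall l th, closure (Theta l) th ->
     posdef (Sigma (sem l th))) :
  (* quasi-likelihoods, estimators and QBIC *)
  let X := observed sem0 Y eta in
  let H := fun (l : 'I_M) (n : nat) (w : Omega) (th : 'cV[R]_(q l)) =>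
    quasi_loglik X T D rho n w (Sigma (sem l th)) in
  forall
  (H_continuous : forall l n w, (0 < n)%N ->
     {within closure (Theta l), continuous (H l n w)})
  (H_smooth : forall l n w, (0 < n)%N -> C_closure 3 (Theta l) (H l n w))
  (thetahat : forall l : 'I_M, nat -> Omega -> 'cV[R]_(q l))
  (thetahat_measurable : forall l n, (0 < n)%N ->
     measurable_fun setT (thetahat l n))
  (thetahat_closure : forall l n w, (0 < n)%N ->
     closure (Theta l) (thetahat l n w))
  (thetahat_max : forall l n w, (0 < n)%N ->
     H l n w (thetahat l n w) = sup [set H l n w th | th in closure (Theta l)]),
  let QBIC := fun (n : nat) (l : 'I_M) (w : Omega) =>
    qbic (q l) n (H l n w (thetahat l n w)) in
  (* correctly specified models, optimal model *)
  let correct := [set l : 'I_M |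
    exists2 th, Theta l th & Sigma sem0 = Sigma (sem l th)] in
  forall
  (theta0 : forall l : 'I_M, 'cV[R]_(q l))
  (theta0_true : forall l, correct l ->
     Theta l (theta0 l) /\ Sigma sem0 = Sigma (sem l (theta0 l)))
  (mstar : 'I_M)
  (mstar_optimal :
     [set l | correct l /\ forall l', correct l' -> (q l <= q l')%N]
     = [set mstar])
  (prior : forall l : 'I_M, 'cV[R]_(q l) -> R)
  (prior_density : forall l, is_density (Theta l) (prior l))
  (* (a) *)
  (a_lipschitz : forall i, exists2 L : R, 0 < L &
     forall x y, enorm (a i x - a i y) <= L * enorm (x - y))
  (c_lipschitz : forall i, exists kappa : 'cV[R]_(ldim k1 p1 p2 k2 i) -> R,
     [/\ forall z, z != 0 -> 0 < kappa z,
         poly_growth_on (@punctured R _) kappa,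
         forall x y z, z != 0 ->
           enorm (c i x z - c i y z) <= kappa z * enorm (x - y) &
         forall x z, z != 0 -> enorm (c i x z) <= kappa z * (1 + enorm x)])
  (* (b) *)
  (a_smooth : forall i j, C_poly 4 (fun x => a i x j 0))
  (* (c) *)
  (f_origin : forall i, exists rbar K : R, [/\ 0 < rbar, 0 < K &
     forall z, z != 0 -> enorm z <= rbar ->
       f i z <= K * enorm z `^ (1 - (ldim k1 p1 p2 k2 i)%:R)])
  (f_moments : forall i (L : R), 1 <= L ->
     (\int[lebesgue_cV R _]_(z in @punctured R (ldim k1 p1 p2 k2 i))
        (enorm z `^ L * f i z)%:E < +oo)%E)
  (* (d) *)
  (c_origin : forall i, exists2 c0 : R, 0 < c0 &
     \forall z \near (0 : 'cV[R]_(ldim k1 p1 p2 k2 i))^',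
       c0 * enorm z <= inf [set enorm (c i x z) | x in setT])
  (m : 'I_M) (m_correct : correct m) (m_neq : m <> mstar)
  (mstar_nested : nested_in (Theta mstar) (Theta m) (H mstar) (H m))
  (prior_regular : forall l, l = m \/ l = mstar ->
     [/\ {within closure (Theta l), continuous (prior l)},
         exists C : R, forall th, closure (Theta l) th -> `|prior l th| <= C &
         0 < prior l (theta0 l)])
  (identifiable : forall l, l = m \/ l = mstar -> exists2 chi : R, 0 < chi &
     forall th, Theta l th ->
       contrast (Sigma (sem l (theta0 l))) (Sigma (sem l th))
         <= - chi * enorm (th - theta0 l) ^+ 2),
  P [set w | QBIC n mstar w < QBIC n m w] @[n --> \oo] --> 1%E.
Proof.
have W_indep t i i' : 0 <= t -> i != i' -> forall G A B, Fil t G ->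
    increments_after (W i) t A -> increments_after (W i') t B ->
    P (G `&` (A `&` B)) = (P G * (P A * P B))%E.
  move=> t0 ii' G A B FG WA WB.
  exact: (mutually_independent_triple (noise_independent t t0)
    (i := None) (j := Some (inl i)) (k := Some (inl i'))).
move=> X H H_continuous H_smooth thetahat thetahat_measurable thetahat_closure thetahat_max.
move=> QBIC correct theta0 theta0_true mstar mstar_optimal prior prior_density.
move=> a_lipschitz _ _ _ _ _ m m_correct _ mstar_nested _ _.
have mstar_correct : correct mstar.
  have : [set mstar] mstar by [].
  by rewrite -mstar_optimal => -[].
have q_lt : (q mstar < q m)%N by case: mstar_nested.
have [Fil_meas _] := Fil_filtration.
have mY i t j : 0 <= t -> measurable_fun setT (fun w => Y i t w j 0).
  by move=> t0; exact: (adapted_coord_measurable Fil_filtration j (Y_adapted i) t0).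
have mX t k : 0 <= t -> measurable_fun setT (fun w => X t w k 0).
  move=> t0.
  rewrite (_ : (fun _ => _) = fun w => \sum_i \sum_l load sem0 i k l * Y i t w l 0); last first.
    apply/funext => w; rewrite /X (observed_load _ sem0_regular eta_eq) // summxE.
    by apply: eq_bigr => i _; rewrite mxE.
  apply: measurable_sum => i; apply: measurable_sum => l.
  by apply: measurable_funM => //; exact: mY.
(* A prior density of total mass 1 cannot live on the empty set. *)
have Theta_neq0 l : Theta l !=set0.
  apply/set0P; apply/negP => /eqP Theta0.
  have [_ _] := prior_density l; rewrite Theta0 integral_set0 => /eqP.
  by rewrite eqe eq_sym oner_eq0.
(* [Sigma (sem l th)] is not known to be measurable in [th], hence the detour by the
   supremum over countably many parameters. *)
have mH l n : (0 < n)%N -> measurable_fun setT (fun w => H l n w (thetahat l n w)).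
  move=> n0.
  rewrite (_ : (fun _ => _) = fun w => fine (esups
      (fun k => (H l n w (rational_point (Theta_neq0 l) k))%:E) 0%N)); last first.
    apply/funext => w; rewrite thetahat_max //.
    rewrite (sup_rational_point (Theta_open l) (Theta_neq0 l)); last exact: H_continuous.
    congr (fine (ereal_sup _)); apply/seteqP; split=> x /=.
      by move=> [k _ <-]; exists k.
    by move=> [k _ <-]; exists k.
  apply: measurableT_comp; first exact: fine_measurable.
  apply: measurable_fun_esups => k; apply/measurable_EFinP.
  exact: measurable_quasi_loglik.
have mQBIC n : (0 < n)%N -> measurable [set w | QBIC n mstar w < QBIC n m w].
  move=> n0.
  have mQ l : measurable_fun setT (QBIC n l).
    apply: measurable_funD => //; apply: measurable_funM => //; exact: mH.
  have : measurable (setT `&` (fun w => QBIC n mstar w < QBIC n m w) @^-1` [set true]).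
    by apply: measurable_fun_ltr.
  by rewrite setTI.
have good (e : R) : 0 < e -> \forall n \near \oo, (0 < n)%N /\ exists2 G : set Omega,
    measurable G /\ (P (~` G) <= e%:E)%E & G `<=` [set w | QBIC n mstar w < QBIC n m w].
  move=> e0.
  have [K [Kj tight]] := truncated_covariation_tight Fil_filtration W_wiener W_indep
    lambda0_gt0 F_density f_def mu_poisson a_borel c_borel a_lipschitz sem0_regular
    Y_cadlag Y_adapted Y_sde eta_eq T_gt0 D_gt0 rho_ge rho_lt e0.
  have [C gap] := quasi_loglik_gap X T D rho K Kj Sigma0_posdef.
  have [N1 _ N1P] := tight; have [N2 _ N2P] := gap.
  near=> n.
  have n0 : (0 < n)%N by near: n; exists 1%N.
  split=> //.
  have nN1 : (N1 <= n)%N by near: n; exists N1.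
  have nN2 : (N2 <= n)%N by near: n; exists N2.
  have [G mG GP] := N1P n nN1.
  exists G => // w Gw; have [cov keep] := GP w Gw.
  have gapn Sig : posdef Sig -> quasi_loglik X T D rho n w Sig
      - quasi_loglik X T D rho n w (Sigma sem0) <= C.
    exact: (N2P n nN2 w cov keep).
  (* The larger model has at least one parameter more and gains at most [C] in log-likelihood, so
     the two criteria differ by at least [ln n - 2 C]. *)
  have Cln : 2 * C < ln n%:R by near: n; exact: near_lt_ln.
  rewrite /= /QBIC /qbic.
  have [T0 S0] := theta0_true _ mstar_correct.
  have Hm : H m n w (thetahat m n w) - quasi_loglik X T D rho n w (Sigma sem0) <= C.
    by apply: gapn; apply: Sigma_posdef; exact: thetahat_closure.
  have Hstar : quasi_loglik X T D rho n w (Sigma sem0) <= H mstar n w (thetahat mstar n w).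
    (* [sup] is meaningful for sets bounded above; the bound is again [gapn], applied on the whole
       closure of the parameter set. *)
    rewrite thetahat_max //; apply: sup_upper_bound.
      split; first by exists (H mstar n w (theta0 mstar)); exists (theta0 mstar) => //;
        exact: subset_closure.
      exists (C + quasi_loglik X T D rho n w (Sigma sem0)) => _ [th clth <-].
      by rewrite -lerBlDr; apply: gapn; exact: Sigma_posdef.
    by exists (theta0 mstar); [exact: subset_closure|rewrite /H -S0].
  have qn : (q mstar)%:R + 1 <= (q m)%:R :> R by rewrite natr1 ler_nat.
  have ln0 : 0 <= ln n%:R :> R by rewrite ln_ge0 // ler1n.
  nra.
apply/fine_cvgP; split.
  near=> n; apply: fin_num_measure; apply: mQBIC.
  by near: n; exists 1%N.
apply/cvgrPdist_le => e e0.
near=> n.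
have [n0 [G [mG PG] Gsub]] : (0 < n)%N /\ exists2 G : set Omega,
    measurable G /\ (P (~` G) <= e%:E)%E & G `<=` [set w | QBIC n mstar w < QBIC n m w].
  by near: n; exact: good.
have mev := mQBIC n n0.
have Pev : ((1 - e)%:E <= P [set w | (QBIC n mstar w < QBIC n m w)%R])%E.
  apply: (@le_trans _ _ (P G)); last by apply: le_measure; rewrite ?inE.
  move: PG; rewrite probability_setC // -[P G]fineK ?fin_num_measure //.
  by rewrite -EFinB !lee_fin; lra.
rewrite /= ger0_norm.
  by move: Pev; rewrite -[X in (_ <= X)%E]fineK ?fin_num_measure // lee_fin; lra.
rewrite subr_ge0 -lee_fin fineK ?fin_num_measure //; exact: probability_le1.
Unshelve. all: by end_near.
Qed.
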